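(* Let $A$ be a nonzero finite-dimensional algebra over $\mathbb C$, and let $\mathcal A=\mathrm{mod}\text{-}A$ be the category of finite-dimensional right $A$-modules. (1) If $\mathrm{gl.dim}\,A=n<+\infty$, there exists $\sigma\in\mathrm{Stab}(D^b(\mathcal A))$ such that $\mathrm{gldim}(\sigma)=n$. (2) If $\mathrm{gl.dim}\,A=+\infty$, then every $\sigma\in\mathrm{Stab}(D^b(\mathcal A))$ satisfies $\mathrm{gldim}(\sigma)=+\infty$.
   Context: $\mathrm{gl.dim}\,A=\sup\{m\ge0\mid \mathrm{Ext}^m_A(M,N)\ne0\text{ for some }M,N\in\mathcal A\}$ is the homological global dimension. Let $\mathcal D$ be a triangulated category, $\Lambda$ a free abelian group of finite rank and $v:K_0(\mathcal D)\to\Lambda$ a surjective homomorphism. A slicing $\mathcal P$ on $\mathcal D$ is a collection of full additive subcategories $\mathcal P(\phi)\subset\mathcal D$ ($\phi\in\mathbb R$) such that (i) $\mathcal P(\phi+1)=\mathcal P(\phi)[1]$; (ii) $\mathrm{Hom}(E_1,E_2)=0$ whenever $E_i\in\mathcal P(\phi_i)$ and $\phi_1>\phi_2$; (iii) every nonzero $E$ has a finite Harder–Narasimhan filtration $0=E_0\to E_1\to\dots\to E_m=E$ such that the cone of $E_{i-1}\to E_i$ is a nonzero object of $\mathcal P(\phi_i)$, with $\phi_1>\dots>\phi_m$. A stability condition with respect to $(\Lambda,v)$ is a pair $\sigma=(\mathcal P,Z)$ with $\mathcal P$ a slicing and $Z:\Lambda\to\mathbb C$ a homomorphism such that for every $0\ne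 E\in\mathcal P(\phi)$ one has $Z(v(E))=m(E)e^{\pi \mathrm{i}\phi}$ with $m(E)>0$, and satisfying the support property: for a norm $\|\cdot\|$ on $\Lambda\otimes\mathbb R$ there is $C>0$ with $\|v(E)\|\le C|Z(v(E))|$ for all nonzero $E$ in any $\mathcal P(\phi)$. For $\mathcal D=D^b(\mathcal A)$ the group $K_0(\mathcal D)=K_0(\mathcal A)$ is free of finite rank and one may take $\Lambda=K_0(\mathcal D)$, $v=\mathrm{id}$. $\mathrm{Stab}(\mathcal D)$ is the set of stability conditions. The global dimension of $\sigma$ is $\mathrm{gldim}(\sigma)=\sup\{\phi_2-\phi_1 \mid \mathrm{Hom}(E_1,E_2)\ne0 \text{ for some } E_i\in\mathcal P(\phi_i)\}\in[0,+\infty]$. *)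

(* Defs.v *)
(* The field C is R[i] for an arbitrary [realType] R; a nonzero
   finite-dimensional C-algebra is a [falgType R[i]]. *)
From HB Require Import structures.
From mathcomp Require Import all_boot all_order all_algebra all_field.
From mathcomp Require Import all_classical all_reals all_analysis.
From mathcomp Require Import complex.

Set Implicit Arguments.
Unset Strict Implicit.
Unset Printing Implicit Defensive.

Import Order.TTheory GRing.Theory Num.Theory.
Import numFieldNormedType.Exports.

Local Open Scope ring_scope.

Section Modules.
Variables (K : fieldType) (A : falgType K).

(* Finite-dimensional right A-modules. The induced K-structure is the given one
   because the action is K-bilinear and unital. *)
Record rmodule := RModule {
  rm_vect :> vectType K;
  rm_act : rm_vect -> A -> rm_vect;
  rm_act_linl : forall a, linear (fun x => rm_act x a);
  rm_act_linr : forall x, linear (rm_act x);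
  rm_act1 : forall x, rm_act x 1 = x;
  rm_actM : forall x a b, rm_act x (a * b) = rm_act (rm_act x a) b
}.

Record mhom (M N : rmodule) := MHom {
  mh_fun :> M -> N;
  mh_lin : linear mh_fun;
  mh_act : forall x a, mh_fun (rm_act x a) = rm_act (mh_fun x) a
}.

HB.instance Definition _ (M N : rmodule) (f : mhom M N) :=
  GRing.isLinear.Build K M N _ (mh_fun f) (mh_lin f).

Lemma rm_act0 (M : rmodule) a : rm_act (0 : M) a = 0.
Proof.
by have := rm_act_linl (r := M) a (-1) 0 0; rewrite !scaleN1r !addNr.
Qed.

Lemma rm_actD (M : rmodule) (x y : M) a :
  rm_act (x + y) a = rm_act x a + rm_act y a.
Proof. by have := rm_act_linl a 1 x y; rewrite !scale1r. Qed.

Lemma rm_actN (M : rmodule) (x : M) a : rm_act (- x) a = - rm_act x a.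
Proof. by have := rm_act_linl a (-1) x 0; rewrite rm_act0 !addr0 !scaleN1r. Qed.

Definition mid (M : rmodule) : mhom M M.
Proof. by exists (fun x => x). Defined.

Definition mzero (M N : rmodule) : mhom M N.
Proof.
exists (fun=> 0) => [k x y|x a]; first by rewrite scaler0 addr0.
by rewrite rm_act0.
Defined.

Definition mcomp (M N Q : rmodule) (g : mhom N Q) (f : mhom M N) : mhom M Q.
Proof.
exists (fun x => g (f x)) => [k x y|x a]; first by rewrite !linearP.
by rewrite !mh_act.
Defined.

Definition mopp (M N : rmodule) (f : mhom M N) : mhom M N.
Proof.
exists (fun x => - f x) => [k x y|x a]; last by rewrite mh_act rm_actN.
by rewrite linearP opprD scalerN.
Defined.

Definition msum (M N : rmodule) : rmodule.
Proof.
exists (M * N)%type (fun x a => (rm_act x.1 a, rm_act x.2 a)).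
- by move=> a k x y /=; rewrite !rm_act_linl.
- by move=> x k a b /=; rewrite !rm_act_linr.
- by case=> x y /=; rewrite !rm_act1.
- by move=> x a b /=; rewrite !rm_actM.
Defined.

(* Homological global dimension *)

Definition projective (P : rmodule) := forall (M N : rmodule) (p : mhom M N)
    (f : mhom P N), (forall y, exists x, p x = y) ->
  exists g : mhom P M, forall x, p (g x) = f x.

Record proj_resolution (M : rmodule) := ProjResolution {
  pr_obj :> nat -> rmodule;
  pr_d : forall i, mhom (pr_obj i.+1) (pr_obj i);
  pr_aug : mhom (pr_obj 0) M;
  pr_proj : forall i, projective (pr_obj i);
  pr_aug_surj : forall y, exists x, pr_aug x = y;
  pr_exact0 : forall x, pr_aug x = 0 <-> exists y, pr_d 0 y = x;
  pr_exact : forall i x, pr_d i x = 0 <-> exists y, pr_d i.+1 y = x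
}.

Definition ext_cocycle (M N : rmodule) (P : proj_resolution M) m
    (f : mhom (P m) N) :=
  forall x, f (pr_d P m x) = 0.

Definition ext_coboundary (M N : rmodule) (P : proj_resolution M) m :
    mhom (P m) N -> Prop :=
  match m with
  | 0 => fun f => forall x, f x = 0
  | k.+1 => fun f => exists g : mhom (P k) N, forall x, f x = g (pr_d P k x)
  end.

(* Ext^m_A(M, N) = H^m(Hom_A(P, N)) is nonzero, P a projective resolution of M;
   the choice of P is immaterial. *)
Definition ext_neq0 m (M N : rmodule) :=
  exists (P : proj_resolution M) (f : mhom (P m) N),
    ext_cocycle f /\ ~ ext_coboundary f.

Definition gl_dim (R : realType) : \bar R :=
  ereal_sup [set x | exists m M N, ext_neq0 m M N /\ x = (m%:R : R)%:E]%classic.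

(* Bounded cochain complexes. The differential is given for all pairs of
   degrees and is 0 unless the target degree is the successor of the source
   degree: this avoids transports between X (i + 1 + 1) and the like. *)

Record cpx := Cpx {
  cobj :> int -> rmodule;
  cd : forall i j, mhom (cobj i) (cobj j);
  cd_out : forall i j x, j != i + 1 -> cd i j x = 0;
  cdd : forall i j k x, cd j k (cd i j x) = 0;
  c_bounded : exists N : nat, forall i (x : cobj i), (N < `|i|)%N -> x = 0
}.

Record chmap (X Y : cpx) := ChMap {
  cm :> forall i, mhom (X i) (Y i);
  cm_comm : forall i j x, cm j (cd X i j x) = cd Y i j (cm i x)
}.

Definition cm_id (X : cpx) : chmap X X.
Proof. by exists (fun i => mid (X i)). Defined.

Definition cm_zero (X Y : cpx) : chmap X Y.
Proof. by exists (fun i => mzero (X i) (Y i)) => i j x; rewrite linear0. Defined.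

Definition cm_comp (X Y Z : cpx) (g : chmap Y Z) (f : chmap X Y) : chmap X Z.
Proof.
by exists (fun i => mcomp (g i) (f i)) => i j x; rewrite /= !cm_comm.
Defined.

Definition cocycle (X : cpx) i (x : X i) := cd X i (i + 1) x = 0.
Definition coboundary (X : cpx) i (x : X i) :=
  exists y : X (i - 1), cd X (i - 1) i y = x.

(* H^i(f) : H^i(X) -> H^i(Y) is injective and surjective for all i *)
Definition quasi_iso (X Y : cpx) (f : chmap X Y) := forall i,
  (forall x : X i, cocycle x -> coboundary (f i x) -> coboundary x) /\
  (forall y : Y i, cocycle y ->
     exists2 x : X i, cocycle x & coboundary (y - f i x)).

(* Transport X i -> X j: the identity if i = j, and 0 otherwise *)
Definition ctr (X : int -> rmodule) i j : mhom (X i) (X j) :=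
  match i =P j with
  | ReflectT e => eq_rect i (fun k => mhom (X i) (X k)) (mid (X i)) j e
  | ReflectF _ => mzero (X i) (X j)
  end.

Lemma ctr_id (X : int -> rmodule) i x : ctr X i i x = x.
Proof. by rewrite /ctr; case: eqP => // e; rewrite (eq_axiomK e). Qed.

Lemma ctr_neq (X : int -> rmodule) i j x : i != j -> ctr X i j x = 0.
Proof. by rewrite /ctr; case: eqP. Qed.

(* X[1] *)
Definition cshift (X : cpx) : cpx.
Proof.
exists (fun i => X (i + 1)) (fun i j => mopp (cd X (i + 1) (j + 1))).
- move=> i j x ij /=; rewrite cd_out ?oppr0 //.
  by rewrite (inj_eq (addIr _)).
- by move=> i j k x /=; rewrite linearN /= cdd !oppr0.
- case: (c_bounded X) => N HN; exists N.+1 => i x iN; apply: HN.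
  rewrite -ltz_nat abszE (lt_le_trans _ (lerB_normD _ _)) //.
  by rewrite ltrBrDr normr1 -PoszD addn1 -abszE ltz_nat.
Defined.

Definition csum (X Y : cpx) : cpx.
Proof.
exists (fun i => msum (X i) (Y i)) (fun i j => MHom (M := msum (X i) (Y i))
  (N := msum (X j) (Y j)) (mh_fun := fun x => (cd X i j x.1, cd Y i j x.2))
  (fun k x y => congr2 pair (linearP _ k x.1 y.1) (linearP _ k x.2 y.2))
  (fun x a => congr2 pair (mh_act _ x.1 a) (mh_act _ x.2 a))).
- by move=> i j x ij; congr pair; apply: cd_out.
- by move=> i j k x; congr pair; apply: cdd.
- case: (c_bounded X) => N HN; case: (c_bounded Y) => N' HN'.
  exists (maxn N N') => i [x y]; rewrite gtn_max => /andP[h h'].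
  by rewrite (HN _ x h) (HN' _ y h').
Defined.

(* Cone(f)^i = X^(i+1) (+) Y^i with d (x, y) = (- d x, f x + d y) *)
Definition cone_d (X Y : cpx) (f : chmap X Y) (i j : int) :
  mhom (msum (X (i + 1)) (Y i)) (msum (X (j + 1)) (Y j)).
Proof.
exists (fun x => (- cd X (i + 1) (j + 1) x.1,
                  ctr Y (i + 1) j (f (i + 1) x.1) + cd Y i j x.2)).
- move=> k x y; congr pair => /=.
    by rewrite linearP opprD scalerN.
  by rewrite !linearP scalerDr addrACA.
- by move=> x a; congr pair => /=; rewrite !mh_act ?rm_actN // rm_actD.
Defined.

Definition ccone (X Y : cpx) (f : chmap X Y) : cpx.
Proof.
exists (fun i => msum (X (i + 1)) (Y i)) (fun i j => cone_d f i j).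
- move=> i j x ij; congr pair => /=.
    by rewrite cd_out ?oppr0 // (inj_eq (addIr _)).
  by rewrite ctr_neq 1?eq_sym // add0r cd_out.
- move=> i j k x; congr pair => /=.
    by rewrite linearN /= cdd !oppr0.
  rewrite linearD /= cdd addr0.
  have [ej|nj] := eqVneq j (i + 1); last first.
    rewrite [cd X _ _ _]cd_out ?oppr0 ?(inj_eq (addIr _)) // !linear0 add0r.
    by rewrite ctr_neq ?linear0 // eq_sym.
  subst j; rewrite ctr_id.
  have [ek|nk] := eqVneq k (i + 1 + 1); last first.
    by rewrite ctr_neq 1?eq_sym // add0r cd_out.
  by subst k; rewrite ctr_id linearN /= cm_comm addNr.
- case: (c_bounded (cshift X)) => N HN; case: (c_bounded Y) => N' HN'.
  exists (maxn N N') => i [x y]; rewrite gtn_max => /andP[h h'].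
  by rewrite (HN _ x h) (HN' _ y h').
Defined.

(* D^b(mod-A): the localization of the category of bounded complexes at the
   quasi-isomorphisms. Its morphisms X -> Y are the formal composites [dmor X Y]
   of chain maps and inverses of quasi-isomorphisms, taken modulo the smallest
   congruence [deq] which makes [dq] a functor and [dinv s] an inverse of
   [dq s]. *)

Inductive dmor : cpx -> cpx -> Type :=
| dq X Y (f : chmap X Y) : dmor X Y
| dinv X Y (s : chmap X Y) (hs : quasi_iso s) : dmor Y X
| dcomp X Y Z (v : dmor Y Z) (u : dmor X Y) : dmor X Z.

Definition did (X : cpx) : dmor X X := dq (cm_id X).

Inductive deq : forall X Y, dmor X Y -> dmor X Y -> Prop :=
| deq_refl X Y (u : dmor X Y) : deq u u
| deq_sym X Y (u v : dmor X Y) : deq u v -> deq v u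
| deq_trans X Y (u v w : dmor X Y) : deq u v -> deq v w -> deq u w
| deq_congr X Y Z (u u' : dmor X Y) (v v' : dmor Y Z) :
    deq u u' -> deq v v' -> deq (dcomp v u) (dcomp v' u')
| deq_assoc X Y Z T (u : dmor X Y) (v : dmor Y Z) (w : dmor Z T) :
    deq (dcomp w (dcomp v u)) (dcomp (dcomp w v) u)
| deq_idl X Y (u : dmor X Y) : deq (dcomp (did Y) u) u
| deq_idr X Y (u : dmor X Y) : deq (dcomp u (did X)) u
| deq_ext X Y (f g : chmap X Y) : (forall i x, f i x = g i x) ->
    deq (dq f) (dq g)
| deq_comp X Y Z (f : chmap X Y) (g : chmap Y Z) :
    deq (dq (cm_comp g f)) (dcomp (dq g) (dq f))
| deq_invl X Y (s : chmap X Y) (hs : quasi_iso s) :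
    deq (dcomp (dinv hs) (dq s)) (did X)
| deq_invr X Y (s : chmap X Y) (hs : quasi_iso s) :
    deq (dcomp (dq s) (dinv hs)) (did Y).

Definition dzero (X Y : cpx) : dmor X Y := dq (cm_zero X Y).

Definition dhom_neq0 (X Y : cpx) := exists u : dmor X Y, ~ deq u (dzero X Y).

Definition disinv X Y (u : dmor X Y) := exists v : dmor Y X,
  deq (dcomp v u) (did X) /\ deq (dcomp u v) (did Y).

Definition diso X Y := exists u : dmor X Y, disinv u.

Definition dzero_obj X := deq (did X) (dzero X X).

(* F is a cone of u, i.e. u fits into a distinguished triangle
   X -u-> Y -> F -> X[1]: up to isomorphisms in D^b(mod-A) this is the standard
   triangle of a chain map f. *)
Definition is_cone X Y (u : dmor X Y) (F : cpx) :=
  exists (X' Y' : cpx) (f : chmap X' Y') (a : dmor X X') (b : dmor Y Y'),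
    [/\ disinv a, disinv b, deq (dcomp b u) (dcomp (dq f) a)
      & diso F (ccone f)].

(* Group morphisms K_0(D^b(mod-A)) -> G *)
Definition triangle_additive (G : zmodType) (v : cpx -> G) :=
  forall X Y F (u : dmor X Y), is_cone u F -> v Y = v X + v F.

(* v exhibits G as the Grothendieck group K_0(D^b(mod-A)) *)
Definition is_K0 (G : zmodType) (v : cpx -> G) :=
  triangle_additive v /\
  forall (H : zmodType) (w : cpx -> H), triangle_additive w ->
    exists2 g : {additive G -> H}, (forall E, g (v E) = w E) &
      forall g' : {additive G -> H}, (forall E, g' (v E) = w E) -> g' =1 g.

(* Slicings; the E_i, E_{i-1} -> E_i, its cone and phi_i of a Harder-Narasimhan
   filtration are [X i], [u i.-1], [F i.-1] and [phi i.-1]. *)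

Definition HN_filtration (R : realType) (P : R -> cpx -> Prop) (E : cpx) :=
  exists (m : nat) (X : nat -> cpx) (u : forall i, dmor (X i) (X i.+1))
         (F : nat -> cpx) (phi : nat -> R),
    [/\ dzero_obj (X 0), diso (X m) E,
        forall i, (i < m)%N ->
          [/\ is_cone (u i) (F i), ~ dzero_obj (F i) & P (phi i) (F i)]
      & forall i, (i.+1 < m)%N -> phi i.+1 < phi i].

Record slicing (R : realType) := Slicing {
  sl_obj :> R -> cpx -> Prop;
  sl_iso : forall phi E F, diso E F -> sl_obj phi E -> sl_obj phi F;
  sl_zero : forall phi E, dzero_obj E -> sl_obj phi E;
  sl_sum : forall phi E F, sl_obj phi E -> sl_obj phi F -> sl_obj phi (csum E F);
  sl_shift : forall phi E,
    sl_obj (phi + 1) E <-> exists2 F, sl_obj phi F & diso E (cshift F);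
  sl_hom : forall phi1 phi2 E1 E2, sl_obj phi1 E1 -> sl_obj phi2 E2 ->
    phi2 < phi1 -> forall u : dmor E1 E2, deq u (dzero E1 E2);
  sl_HN : forall E, ~ dzero_obj E -> HN_filtration sl_obj E
}.

End Modules.

Section Stability.
Variables (R : realType) (A : falgType R[i]).

(* Stability conditions with respect to the free abelian group Lambda = Z^r and
   v : K_0 -> Lambda. All norms on Lambda (x) R = R^r being equivalent, the
   support property is stated for the norm of ['rV[R]_r]. *)
Record stability_condition (r : nat) (v : cpx A -> 'rV[int]_r) :=
  StabilityCondition {
    st_slicing :> slicing A R;
    st_Z : {additive 'rV[int]_r -> R[i]};
    st_phase : forall (phi : R) E, st_slicing phi E -> ~ dzero_obj E ->
      exists2 m : R, 0 < m &
        st_Z (v E) = m%:C%C * (cos (pi * phi) +i* sin (pi * phi))%C;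
    st_support : exists2 C : R, 0 < C &
      forall phi E, st_slicing phi E -> ~ dzero_obj E ->
        (`|map_mx (intr : int -> R) (v E)|)%:C%C <= C%:C%C * `|st_Z (v E)|
  }.

(* Stab(D^b(mod-A)): Lambda = K_0(D^b(mod-A)) and v = id, where K_0 is
   identified with some Z^r. *)
Record Stab := MkStab {
  stab_rank : nat;
  stab_class : cpx A -> 'rV[int]_stab_rank;
  stab_K0 : is_K0 stab_class;
  stab_cond :> stability_condition stab_class
}.

Definition gldim (sigma : Stab) : \bar R :=
  ereal_sup [set x | exists phi1 phi2 E1 E2,
    [/\ sigma phi1 E1, sigma phi2 E2, dhom_neq0 E1 E2
      & x = (phi2 - phi1)%:E]]%classic.

End Stability.

(* Main.v *)
From Corelib Require Setoid Morphisms.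
From HB Require Import structures.
Require Import Defs.
From mathcomp Require Import all_boot all_order all_algebra all_field.
From mathcomp Require Import all_classical all_reals all_analysis.
From mathcomp Require Import complex.
From mathcomp Require Import zify.

Import Order.TTheory GRing.Theory Num.Theory.
Local Open Scope ring_scope.

(**
  Part 1. Put all modules in phase 0: let [P phi] consist of the complexes whose
  cohomology is concentrated in degree [- phi] ([deg_slice]), so that [P phi] is
  zero unless [phi] is an integer, and let the central charge be the alternating
  sum of the dimensions of the cohomology modules. Harder-Narasimhan filtrations
  are given by truncation ([deg_slice_HN]), and maps to an object of smaller phase
  are Ext groups of negative degree. A nonzero map from an object of phase [phi1]
  to one of phase [phi2] is a nonzero element of [Ext^(phi2 - phi1)] between
  modules ([ext_hom]); hence the global dimension of this stability condition is
  that of the algebra ([gldim_degree]). The group [K_0] is free on the finitely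
  many simple modules ([kclass_K0]): the class of a complex is the Euler
  characteristic of the multiplicities of simple modules, and dévissage
  determines every additive function by its values on simple modules. The
  multiplicities in a module [M] are the dimensions of [M e], suitably normalized,
  for idempotents [e] which kill all simple modules but one
  ([separating_idempotent]); they are at most the dimension of [M], which is the
  support property.

  Part 2. Suppose that a nonzero map between semistable objects increases the phase
  by at most [G]. The finitely many simple modules have finitely many Harder-
  Narasimhan factors, so for large [p] the factors of a simple module [T] shifted
  by [p] have phases exceeding those of the factors of a simple module [S] by more
  than [G], and there are no maps between them. Vanishing of maps passes to
  extensions in both variables, hence to maps from [S] to [T[p]] and then, by
  dévissage, to maps from [M] to [N[p]] for all modules ([homz_stalks_large]).
  So [Ext^p] vanishes for large [p] and the algebra has finite global dimension.

  Both parts rest on a description of the morphisms of the derived category,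
  which are given as formal composites of chain maps and inverses of
  quasi-isomorphisms. Functors that preserve quasi-isomorphisms, such as
  truncations, the shift and cohomology, act on formal composites by recursion;
  this gives the vanishing of maps in negative degrees ([homz_trunc]) and the
  invariance of cohomology. For the rest a complex [Q] is replaced by one which is
  projective in degrees at least [k], where [k] bounds the target [W] from below
  ([kproj_res]). A formal composite acts on homotopy classes of maps from [Q] to
  the truncations of its source and target above [k], because lifts along
  quasi-isomorphisms exist and are unique up to homotopy; this action ([act])
  respects the relations between formal composites. It follows that morphisms
  from [Q] to [W] in the derived category are homotopy classes of chain maps
  ([kproj_homz]), from which the exactness in both variables ([homz_tri_l],
  [homz_tri_r]) and the comparison with Ext groups are derived.
*)

Set Implicit Arguments.
Unset Strict Implicit.
Unset Printing Implicit Defensive.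

(* These names also denote notions of measure theory and analysis. *)
Local Notation mzero := Defs.mzero.
Local Notation msum := Defs.msum.
Local Notation dcomp := Defs.dcomp.
Local Notation dinv := Defs.dinv.

(** * Submodules, quotients and factorizations *)

Section Modules.
Context {K : fieldType} {A : falgType K}.
Implicit Types L M N P Q S T : rmodule A.

Lemma rm_act0r M (x : M) : rm_act x 0 = 0.
Proof. by have := rm_act_linr x (-1) 0 0; rewrite !scaleN1r !addNr. Qed.

(** A subspace of largest dimension inside [S] is all of [S], since any further
    vector of [S] could be added to it. Submodules can thus be given by
    propositions, without computing bases. *)
Lemma pred_vspace (V : vectType K) (S : V -> Prop) :
  S 0 -> (forall k x y, S x -> S y -> S (k *: x + y)) ->
  exists U : {vspace V}, forall x, x \in U <-> S x.
Proof.
move=> S0 SP.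
pose good n := `[< exists U : {vspace V}, \dim U = n /\ forall x, x \in U -> S x >].
have ex : exists n, good n.
  exists 0%N; apply/asboolP; exists 0%VS; split; first by rewrite dimv0.
  by move=> x; rewrite memv0 => /eqP ->.
have le n : good n -> (n <= \dim {:V})%N.
  by move=> /asboolP[U [<- _]]; rewrite dimvS ?subvf.
case: (ex_maxnP ex le) => n /asboolP[U [dU SU]] maxn.
exists U => x; split; first exact: SU.
move=> Sx; apply: contrapT => /negP xU.
suff : (n.+1 <= n)%N by rewrite ltnn.
apply: maxn; apply/asboolP; exists (<[x]> + U)%VS; split.
  rewrite dimv_disjoint_sum.
    have -> : \dim <[x]> = 1%N.
      by rewrite dim_vline; case: eqP xU => // ->; rewrite mem0v.
    by rewrite dU.
  apply/eqP; rewrite -subv0; apply/subvP => y; rewrite memv_cap => /andP[].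
  move=> /vlineP[k ->]; case: (eqVneq k 0) => [->|k0]; first by rewrite scale0r !mem0v.
  by move=> h; case: xU; rewrite -[x]scale1r -(mulVf k0) -scalerA memvZ.
move=> y /memv_addP[u /vlineP[k ->] [v vU ->]].
by apply: SP => //; apply: SU.
Qed.

Record is_submod M (S : M -> Prop) : Prop := IsSubmod {
  ism0 : S 0;
  ismP : forall k x y, S x -> S y -> S (k *: x + y);
  ismA : forall x a, S x -> S (rm_act x a)
}.

Lemma ismD M (S : M -> Prop) x y : is_submod S -> S x -> S y -> S (x + y).
Proof. by move=> h Sx Sy; rewrite -[x]scale1r; apply: ismP. Qed.

Lemma submod_ex M (S : M -> Prop) : is_submod S ->
  exists (N : rmodule A) (i : mhom N M),
    (forall x, i x = 0 -> x = 0) /\ forall x, S x <-> exists y, i y = x.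
Proof.
move=> hS; have [U US] := pred_vspace (ism0 hS) (ismP hS).
pose act (x : subvs_of U) a := vsproj U (rm_act (vsval x) a).
have actE x a : vsval (act x a) = rm_act (vsval x) a.
  by apply: vsprojK; apply/US; apply: ismA => //; apply/US/subvsP.
have vl k (x y : subvs_of U) : vsval (k *: x + y) = k *: vsval x + vsval y.
  exact: linearP.
have h1 a : linear (fun x => act x a).
  by move=> k x y; apply: subvs_inj; rewrite actE 2!vl !actE rm_act_linl.
have h2 x : linear (act x).
  by move=> k a b; apply: subvs_inj; rewrite vl !actE rm_act_linr.
have h3 x : act x 1 = x by apply: subvs_inj; rewrite actE rm_act1.
have h4 x a b : act x (a * b) = act (act x a) b.
  by apply: subvs_inj; rewrite !actE rm_actM.
have l : linear (@vsval K M U) by move=> k x y; rewrite linearP.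
exists (RModule h1 h2 h3 h4), (@MHom K A (RModule h1 h2 h3 h4) M _ l actE).
split; first by move=> x /= /eqP; rewrite -[0]/(vsval (0 : subvs_of U)) => /eqP/val_inj.
move=> x; split=> [/US xU|[y <-]]; last by apply/US/subvsP.
by exists (vsproj U x); rewrite /= vsprojK.
Qed.

(** The quotient is carried by a linear complement of the submodule, with the
    action followed by the projection. *)
Lemma quotmod_ex M (S : M -> Prop) : is_submod S ->
  exists (N : rmodule A) (p : mhom M N),
    (forall y, exists x, p x = y) /\ forall x, S x <-> p x = 0.
Proof.
move=> hS; have [U US] := pred_vspace (ism0 hS) (ismP hS).
pose W := (U^C)%VS; pose pr := daddv_pi W U.
have dWU : (W :&: U = 0)%VS by rewrite capvC capv_compl.
have prW x : pr x \in W by exact: memv_pi.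
have prU x : x - pr x \in U.
  have e : daddv_pi W U x + daddv_pi U W x = x.
    by apply: daddv_pi_add => //; rewrite addvC addv_complf memvf.
  by rewrite -{1}e /pr addrC addKr memv_pi.
have pr0 x : x \in U -> pr x = 0.
  move=> xU; apply/eqP; rewrite -memv0 -dWU memv_cap prW /=.
  by rewrite -[pr x](subKr x) memvB.
have prid x : x \in W -> pr x = x.
  move=> xW; apply/eqP; rewrite eq_sym -subr_eq0 -memv0 -dWU memv_cap prU andbT.
  exact: memvB.
pose act (x : subvs_of W) a := vsproj W (pr (rm_act (vsval x) a)).
have actE x a : vsval (act x a) = pr (rm_act (vsval x) a) by apply: vsprojK.
have pract x a : pr (rm_act (pr x) a) = pr (rm_act x a).
  have -> : rm_act x a = rm_act (pr x) a + rm_act (x - pr x) a.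
    by rewrite -rm_actD addrC subrK.
  rewrite linearD /= [pr (rm_act (x - _) _)]pr0 ?addr0 //.
  by apply/US; apply: (ismA hS); apply/US; apply: prU.
have vl k (x y : subvs_of W) : vsval (k *: x + y) = k *: vsval x + vsval y.
  exact: linearP.
have h1 a : linear (fun x => act x a).
  by move=> k x y; apply: subvs_inj; rewrite actE 2!vl !actE rm_act_linl linearP.
have h2 x : linear (act x).
  by move=> k a b; apply: subvs_inj; rewrite vl !actE rm_act_linr linearP.
have h3 x : act x 1 = x.
  by apply: subvs_inj; rewrite actE rm_act1 prid // subvsP.
have h4 x a b : act x (a * b) = act (act x a) b.
  by apply: subvs_inj; rewrite !actE pract rm_actM.
have l : linear (fun x : M => vsproj W (pr x)) by move=> k x y; rewrite !linearP.
have pa x a : vsproj W (pr (rm_act x a)) = act (vsproj W (pr x)) a.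
  by apply: subvs_inj; rewrite actE !vsprojK // pract.
exists (RModule h1 h2 h3 h4), (@MHom K A M (RModule h1 h2 h3 h4) _ l pa).
split; first by move=> y; exists (vsval y); rewrite /= prid ?subvsP // vsvalK.
move=> x; split=> [/US xU|/= e].
  by rewrite /= pr0 // linear0.
apply/US; have : pr x = 0 by rewrite -[pr x](@vsprojK _ _ W) // e linear0.
by move=> e0; have := prU x; rewrite e0 subr0.
Qed.

Lemma mh0 M N (f : mhom M N) : f 0 = 0.
Proof. exact: linear0. Qed.
Lemma mhD M N (f : mhom M N) x y : f (x + y) = f x + f y.
Proof. exact: linearD. Qed.
Lemma mhN M N (f : mhom M N) x : f (- x) = - f x.
Proof. exact: linearN. Qed.
Lemma mhB M N (f : mhom M N) x y : f (x - y) = f x - f y.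
Proof. exact: linearB. Qed.

Definition injm M N (f : mhom M N) := forall x, f x = 0 -> x = 0.
Definition surjm M N (f : mhom M N) := forall y, exists x, f x = y.
Definition bijm M N (f : mhom M N) := injm f /\ surjm f.
Definition trivm M := forall x : M, x = 0.
Definition miso M N := exists f : mhom M N, bijm f.

Lemma injmP M N (f : mhom M N) x y : injm f -> f x = f y -> x = y.
Proof.
by move=> hf e; apply/eqP; rewrite -subr_eq0; apply/eqP/hf; rewrite linearB /= e subrr.
Qed.

(** Lifting along an injection and descending along a surjection are made total
    functions of the two maps, so that the terms and the differentials of a
    complex can be defined before the factorization property is proved. *)
Definition mlift L M N (i : mhom M N) (f : mhom L N) : mhom L M :=
  match pselect (exists g : mhom L M, forall x, i (g x) = f x) with
  | left h => projT1 (cid h)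
  | right _ => mzero L M
  end.

Lemma mliftE L M N (i : mhom M N) (f : mhom L N) : injm i ->
  (forall x, exists y, i y = f x) -> forall x, i (mlift i f x) = f x.
Proof.
move=> hi hf; rewrite /mlift; case: pselect => [h|[]]; first by case: (cid h).
have [g hg] := choice hf.
have gl : linear g.
  by move=> k x y; apply: (injmP hi); rewrite linearP /= !hg linearP.
have ga x a : g (rm_act x a) = rm_act (g x) a.
  by apply: (injmP hi); rewrite mh_act !hg mh_act.
by exists (MHom gl ga).
Qed.

Definition mdesc L M N (p : mhom M L) (f : mhom M N) : mhom L N :=
  match pselect (exists g : mhom L N, forall x, g (p x) = f x) with
  | left h => projT1 (cid h)
  | right _ => mzero L N
  end.

Lemma mdescE L M N (p : mhom M L) (f : mhom M N) : surjm p ->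
  (forall x, p x = 0 -> f x = 0) -> forall x, mdesc p f (p x) = f x.
Proof.
move=> hp hf; rewrite /mdesc; case: pselect => [h|[]]; first by case: (cid h).
have [s hs] := choice hp.
have fs x y : p x = p y -> f x = f y.
  move=> e; apply/eqP; rewrite -subr_eq0 -linearB; apply/eqP/hf.
  by rewrite linearB /= e subrr.
have gl : linear (fun y => f (s y)).
  by move=> k x y; rewrite -linearP; apply: fs; rewrite linearP /= !hs.
have ga x a : f (s (rm_act x a)) = rm_act (f (s x)) a.
  by rewrite -mh_act; apply: fs; rewrite mh_act !hs.
by exists (MHom gl ga) => x /=; apply: fs; rewrite hs.
Qed.

Definition minv M N (f : mhom M N) : mhom N M := mlift f (mid N).

Lemma minvK M N (f : mhom M N) : bijm f -> forall y, f (minv f y) = y.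
Proof. by move=> [fi fs]; apply: mliftE. Qed.

Lemma minvKl M N (f : mhom M N) : bijm f -> forall x, minv f (f x) = x.
Proof. by move=> hf x; apply: (injmP hf.1); rewrite minvK. Qed.

Lemma bij_minv M N (f : mhom M N) : bijm f -> bijm (minv f).
Proof.
move=> hf; split=> [y e|x]; first by rewrite -(minvK hf y) e linear0.
by exists (f x); rewrite minvKl.
Qed.

Lemma bij_comp M N P (g : mhom N P) (f : mhom M N) :
  bijm g -> bijm f -> bijm (mcomp g f).
Proof.
move=> [gi gs] [fi fs]; split=> [x /= /gi/fi //|y].
by have [z <-] := gs y; have [x <-] := fs z; exists x.
Qed.

Lemma miso_refl M : miso M M.
Proof. by exists (mid M); split=> // y; exists y. Qed.
Lemma miso_sym M N : miso M N -> miso N M.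
Proof. by case=> f hf; exists (minv f); apply: bij_minv. Qed.
Lemma miso_trans M N P : miso M N -> miso N P -> miso M P.
Proof. by case=> f hf [g hg]; exists (mcomp g f); apply: bij_comp. Qed.

Lemma miso_triv M N : trivm M -> trivm N -> miso M N.
Proof.
move=> hM hN; exists (mzero M N); split=> [x _|y]; first exact: hM.
by exists 0; rewrite (hN y).
Qed.

Lemma im_submod M N (f : mhom M N) : is_submod (fun y => exists x, f x = y).
Proof.
split=> [|k _ _ [x <-] [y <-]|_ a [x <-]]; first by exists 0; rewrite linear0.
  by exists (k *: x + y); rewrite linearP.
by exists (rm_act x a); rewrite mh_act.
Qed.

Lemma ker_submod M N (f : mhom M N) : is_submod (fun x => f x = 0).
Proof.
split=> [|k x y ex ey|x a ex]; first by rewrite linear0.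
  by rewrite linearP /= ex ey scaler0 addr0.
by rewrite mh_act ex rm_act0.
Qed.

Lemma cap_submod M (S T : M -> Prop) :
  is_submod S -> is_submod T -> is_submod (fun x => S x /\ T x).
Proof.
move=> [a b c] [a' b' c']; split=> // [k x y [? ?] [? ?]|x e [? ?]]; split; auto.
Qed.

Lemma imp_submod M (p : Prop) (S : M -> Prop) :
  is_submod S -> is_submod (fun x => p -> S x).
Proof. by move=> [a b c]; split=> // *; auto. Qed.

Lemma zero_submod M : is_submod (fun x : M => x = 0).
Proof. exact: (ker_submod (mid M)). Qed.

Definition sub_ex M (S : M -> Prop) (h : is_submod S) :
  {N : rmodule A & {i : mhom N M | injm i /\ forall x, S x <-> exists y, i y = x}}.
Proof. by case: (cid (submod_ex h)) => N /cid[i hi]; exists N, i. Qed.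
Definition subm M (S : M -> Prop) (h : is_submod S) : rmodule A := projT1 (sub_ex h).
Definition sub_inc M (S : M -> Prop) (h : is_submod S) : mhom (subm h) M :=
  sval (projT2 (sub_ex h)).

Lemma sub_inc_inj M (S : M -> Prop) (h : is_submod S) : injm (sub_inc h).
Proof. exact: (svalP (projT2 (sub_ex h))).1. Qed.
Lemma sub_incP M (S : M -> Prop) (h : is_submod S) x :
  S x <-> exists y, sub_inc h y = x.
Proof. exact: (svalP (projT2 (sub_ex h))).2. Qed.
Lemma sub_incS M (S : M -> Prop) (h : is_submod S) y : S (sub_inc h y).
Proof. by apply/(sub_incP h); exists y. Qed.

Definition quo_ex M (S : M -> Prop) (h : is_submod S) :
  {N : rmodule A & {p : mhom M N | surjm p /\ forall x, S x <-> p x = 0}}.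
Proof. by case: (cid (quotmod_ex h)) => N /cid[p hp]; exists N, p. Qed.
Definition quom M (S : M -> Prop) (h : is_submod S) : rmodule A := projT1 (quo_ex h).
Definition quo_pr M (S : M -> Prop) (h : is_submod S) : mhom M (quom h) :=
  sval (projT2 (quo_ex h)).

Lemma quo_pr_surj M (S : M -> Prop) (h : is_submod S) : surjm (quo_pr h).
Proof. exact: (svalP (projT2 (quo_ex h))).1. Qed.
Lemma quo_prP M (S : M -> Prop) (h : is_submod S) x : S x <-> quo_pr h x = 0.
Proof. exact: (svalP (projT2 (quo_ex h))).2. Qed.

Definition mses L M N (i : mhom L M) (p : mhom M N) :=
  [/\ injm i, surjm p & forall x, p x = 0 <-> exists y, i y = x].

Lemma sub_quo_ses M (S : M -> Prop) (h : is_submod S) : mses (sub_inc h) (quo_pr h).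
Proof.
split; [exact: sub_inc_inj|exact: quo_pr_surj|move=> x].
by split=> [/(quo_prP h)/(sub_incP h)|/(sub_incP h)/(quo_prP h)].
Qed.

Lemma mx00_eq (x y : 'M[K]_(0, 0)) : x = y.
Proof. by rewrite [x]thinmx0 [y]thinmx0. Qed.

Definition zmodule : rmodule A.
Proof.
apply: (@RModule K A 'M[K]_(0, 0) (fun x _ => x)) => //.
by move=> x k a b; apply: mx00_eq.
Defined.

Lemma zmodule_triv : trivm zmodule.
Proof. move=> x; exact: mx00_eq. Qed.

(** * Ranks of idempotents *)

Definition ract M (e : A) (x : M) : M := rm_act x e.

Lemma ract_is_linear M e : linear (@ract M e).
Proof. exact: rm_act_linl. Qed.
HB.instance Definition _ M e :=
  GRing.isLinear.Build K M M _ (@ract M e) (@ract_is_linear M e).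

(** The dimension of [M e]; for an idempotent [e] it is the dimension of
    [Hom(eA, M)], hence additive in [M]. For [e = 1] it is that of [M]. *)
Definition rdim (e : A) M : nat := \dim (limg (linfun (@ract M e))).

(** For an idempotent [e], the elements of [M e] are those with [x e = x], so the
    functor [M |-> M e] is exact. *)
Lemma rdim_ses e L M N (i : mhom L M) (p : mhom M N) : e * e = e ->
  mses i p -> rdim e M = (rdim e L + rdim e N)%N.
Proof.
move=> ee [hi hp hx]; rewrite /rdim.
set WM := limg _; set WL := limg _; set WN := limg _.
have inW (Q : rmodule A) (x : Q) :
    x \in limg (linfun (@ract Q e)) <-> rm_act x e = x.
  split=> [/memv_imgP[y _ ->]|<-].
    by rewrite lfunE /= /ract -rm_actM ee.
  by apply/memv_imgP; exists x; rewrite ?memvf // lfunE.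
rewrite -(limg_ker_dim (linfun p) WM); congr addn; last first.
  congr (\dim _); apply/vspaceP => y; apply/memv_imgP/idP => [[x /inW xW ->]|].
    by apply/inW; rewrite lfunE /= -mh_act xW.
  move=> /inW yW; have [x xy] := hp y; exists (rm_act x e).
    by apply/inW; rewrite -rm_actM ee.
  by rewrite lfunE /= mh_act xy yW.
rewrite -(@limg_dim_eq _ _ _ (linfun i) WL).
  congr (\dim _); apply/vspaceP => x; rewrite memv_cap memv_ker lfunE /=.
  apply/andP/memv_imgP => [[/inW xW /eqP/hx[y yx]]|[y /inW yW ->]].
    exists y; last by rewrite lfunE.
    by apply/inW/(injmP hi); rewrite mh_act yx.
  rewrite lfunE /=; split; first by apply/inW; rewrite -mh_act yW.
  by apply/eqP/hx; exists y.
apply/eqP; rewrite -subv0; apply/subvP => y; rewrite memv_cap memv_ker lfunE /= memv0.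
by move=> /andP[_ /eqP/hi ->].
Qed.

Lemma rdim_iso e M N : e * e = e -> miso M N -> rdim e M = rdim e N.
Proof.
move=> ee [f [fi fs]].
have s : mses (mzero zmodule M) f.
  split=> // [x _|x]; first exact: zmodule_triv.
  by split=> [/fi ->|[y <-]]; [exists 0|rewrite linear0].
rewrite (rdim_ses ee s) [X in (X + _)%N](_ : _ = 0%N) //; apply/eqP.
rewrite -leqn0 (leq_trans (dimvS (subvf _))) // dimvf.
by rewrite /dim /=.
Qed.

Lemma rdim_eq0 e M : rdim e M = 0%N <-> forall x : M, rm_act x e = 0.
Proof.
split=> [/eqP|h]; first rewrite dimv_eq0 => /eqP h x.
  by apply/eqP; rewrite -memv0 -h; apply/memv_imgP; exists x; rewrite ?memvf ?lfunE.
apply/eqP; rewrite dimv_eq0 -subv0; apply/subvP => _ /memv_imgP[y _ ->].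
by rewrite lfunE /= /ract h mem0v.
Qed.

Lemma rdim_triv e M : trivm M -> rdim e M = 0%N.
Proof. by move=> h; apply/rdim_eq0 => x; apply: h. Qed.

Definition mdim M := rdim 1 M.

Lemma mdim_eq0 M : mdim M = 0%N <-> trivm M.
Proof. by rewrite /mdim rdim_eq0; split=> h x; have := h x; rewrite rm_act1. Qed.

Lemma mdim_ses L M N (i : mhom L M) (p : mhom M N) :
  mses i p -> mdim M = (mdim L + mdim N)%N.
Proof. by apply: rdim_ses; rewrite mulr1. Qed.
End Modules.

(** * Simple modules and dévissage *)

Section SimpleModules.
Context {K : fieldType} {A : falgType K}.
Implicit Types L M N P Q S T : rmodule A.

Definition msimple M := ~ trivm M /\
  forall U : M -> Prop, is_submod U -> (forall x, U x -> x = 0) \/ (forall x, U x).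

Lemma schur S T (f : mhom S T) : msimple S -> msimple T ->
  (exists x, f x <> 0) -> bijm f.
Proof.
move=> [_ hS] [_ hT] [x fx]; split.
  by case: (hS _ (ker_submod f)) => // h y _; case: fx; apply: h.
case: (hT _ (im_submod f)) => // h; case: fx; apply: h; by exists x.
Qed.

(** A proper nonzero submodule has smaller dimension, so descending terminates at
    a simple one. *)
Lemma simple_sub M : ~ trivm M -> exists T (i : mhom T M), msimple T /\ injm i.
Proof.
have [n] := ubnP (mdim M); elim: n M => // n IH M; rewrite ltnS => lMn hM.
have [sM|nsM] := pselect (msimple M); first by exists M, (mid M); split.
have [U [hU [x [Ux x0]] [y nUy]]] : exists U : M -> Prop,
    [/\ is_submod U, exists x, U x /\ x <> 0 & exists y, ~ U y].
  apply: contrapT => h; apply: nsM; split=> // U hU.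
  have [a|a] := pselect (forall x, U x -> x = 0); [by left|right=> y].
  apply: contrapT => nUy; apply: h; exists U; split=> //; last by exists y.
  by apply: contrapT => b; apply: a => x Ux; apply: contrapT => x0; apply: b; exists x.
have [hi hp hx] := sub_quo_ses hU.
have dM := mdim_ses (sub_quo_ses hU).
have : (0 < mdim (quom hU))%N.
  rewrite lt0n; apply/eqP => /mdim_eq0 /(_ (quo_pr hU y)) /(quo_prP hU); exact: nUy.
move=> q0; have [||T [i [sT ii]]] := IH (subm hU); first by lia.
  move: Ux => /(sub_incP hU)[z zx] t; apply: x0.
  by rewrite -zx (t z) linear0.
exists T, (mcomp (sub_inc hU) i); split=> // z /= /hi; exact: ii.
Qed.

(** Dévissage: dividing a nonzero module by a simple submodule lowers the
    dimension. *)
Lemma module_devissage (C : rmodule A -> Prop) :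
  (forall M, trivm M -> C M) ->
  (forall T M Q (i : mhom T M) (p : mhom M Q), msimple T -> mses i p -> C Q -> C M) ->
  forall M, C M.
Proof.
move=> h0 h1 M; have [n] := ubnP (mdim M); elim: n M => // n IH M; rewrite ltnS => lMn.
have [tM|ntM] := pselect (trivm M); first exact: h0.
have [T [i [sT ii]]] := simple_sub ntM.
have s : mses i (quo_pr (im_submod i)).
  by split=> //; [exact: quo_pr_surj|move=> x; split=> /(quo_prP (im_submod i))].
apply: (h1 _ _ _ _ _ sT s); apply: IH.
have := mdim_ses s; case: (posnP (mdim T)) => [/mdim_eq0|]; last by lia.
by move=> tT; case: sT => /(_ tT).
Qed.

Definition regmod : rmodule A.
Proof.
apply: (@RModule K A A (fun x a => x * a)) => [a k x y|x k a b|x|x a b].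
- by rewrite mulrDl scalerAl.
- by rewrite mulrDr scalerAr.
- by rewrite mulr1.
- by rewrite mulrA.
Defined.

Definition orbitm M (x : M) : mhom regmod M.
Proof.
by exists (fun a : A => rm_act x a); [exact: rm_act_linr|move=> a b; exact: rm_actM].
Defined.

(** The composition factors of [M] do for [S]: a nonzero map from [M] to a simple
    module either is nonzero on a simple submodule of [M], hence an isomorphism on
    it, or factors through the quotient. *)
Lemma simple_factors M : exists n (S : nat -> rmodule A),
  (forall i, (i < n)%N -> msimple (S i)) /\
  forall T (f : mhom M T), msimple T -> (exists x, f x <> 0) ->
    exists2 i, (i < n)%N & miso (S i) T.
Proof.
elim/module_devissage: M => [M tM|S M Q i p sS [hi hp hx] [n [F [sF hF]]]].
  exists 0%N, (fun=> zmodule); split=> // T f _ [x]; case.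
  by rewrite (tM x) linear0.
exists n.+1, (fun j => if j is j'.+1 then F j' else S); split=> [[|j] //|T f sT [x fx]].
  exact: sF.
have [[y fy]|fi0] := pselect (exists y, mcomp f i y <> 0).
  by exists 0%N => //; exists (mcomp f i); apply: schur => //; exists y.
have fp z : mdesc p f (p z) = f z.
  apply: mdescE => // w /hx[y <-]; apply: contrapT => fy; apply: fi0; by exists y.
have [|j jn jT] := hF T (mdesc p f) sT; last by exists j.+1.
by exists (p x); rewrite fp.
Qed.

(** A simple module is a quotient of the regular one, so there are finitely many
    of them up to isomorphism. *)
Lemma finite_simples : exists n (S : nat -> rmodule A),
  [/\ forall i, (i < n)%N -> msimple (S i),
      forall i j, (i < n)%N -> (j < n)%N -> miso (S i) (S j) -> i = j &
      forall T, msimple T -> exists2 i, (i < n)%N & miso (S i) T].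
Proof.
have [n [F [sF hF]]] := simple_factors regmod.
have {}hF T : msimple T -> exists2 i, (i < n)%N & miso (F i) T.
  move=> sT; have [x x0] : exists x : T, x <> 0.
    by case: sT => + _ => h; apply: contrapT => h'; apply: h => x;
      apply: contrapT => x0; apply: h'; exists x.
  by apply: (hF _ (orbitm x)) => //; exists 1; rewrite /= rm_act1.
(* Repetitions up to isomorphism are discarded one by one. *)
suff [m [S [sS nS SF]]] : exists m (S : nat -> rmodule A),
  [/\ forall i, (i < m)%N -> msimple (S i),
      forall i j, (i < m)%N -> (j < m)%N -> miso (S i) (S j) -> i = j &
      forall j, (j < n)%N -> exists2 i, (i < m)%N & miso (S i) (F j)].
  exists m, S; split=> // T /hF[j jn jT]; have [i im ij] := SF j jn.
  by exists i => //; apply: miso_trans jT.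
elim: n sF {hF} => [_|n IH sF]; first by exists 0%N, (fun=> zmodule).
have [|m [S [sS nS SF]]] := IH; first by move=> i ?; apply: sF; rewrite ltnS ltnW.
have [[i im iF]|hn] := pselect (exists2 i, (i < m)%N & miso (S i) (F n)).
  exists m, S; split=> // j; rewrite ltnS leq_eqVlt => /orP[/eqP ->|]; last exact: SF.
  by exists i.
exists m.+1, (fun j => if j == m then F n else S j); split.
- move=> i; rewrite ltnS leq_eqVlt; case: eqP => //= [_ _|_]; last exact: sS.
  exact: sF.
- move=> i j; rewrite !ltnS [(i <= m)%N]leq_eqVlt [(j <= m)%N]leq_eqVlt.
  case: eqP => [-> _|_ /= im]; case: eqP => [-> _|_ /= jm] //.
  + by move=> h; case: hn; exists j => //; apply: miso_sym.
  + by move=> h; case: hn; exists i.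
  + exact: nS.
- move=> j; rewrite ltnS leq_eqVlt => /orP[/eqP ->|jn].
    by exists m => //; rewrite eqxx; apply: miso_refl.
  have [i im ij] := SF j jn; exists i; first by rewrite ltnW.
  by rewrite (ltn_eqF im).
Qed.

(** * Free modules and projective resolutions *)

(** A map from the regular module is determined by the image of [1], which may be
    chosen freely. *)
Lemma regmod_proj : projective regmod.
Proof.
move=> M N p f hp; have [x hx] := hp (f 1).
exists (orbitm x) => a /=; rewrite mh_act hx -mh_act /=.
by congr (f _); rewrite mul1r.
Qed.

Lemma msum_proj P Q : projective P -> projective Q -> projective (msum P Q).
Proof.
move=> hP hQ M N p f hp.
have iP : {i : mhom P (msum P Q) | forall x, i x = (x, 0)}.
  unshelve eexists (@MHom K A P (msum P Q) (fun x => (x, 0)) _ _) => //.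
    by move=> k x y; congr pair => //=; rewrite scaler0 addr0.
  by move=> x a; congr pair => //=; rewrite rm_act0.
have iQ : {i : mhom Q (msum P Q) | forall x, i x = (0, x)}.
  unshelve eexists (@MHom K A Q (msum P Q) (fun x => (0, x)) _ _) => //.
    by move=> k x y; congr pair => //=; rewrite scaler0 addr0.
  by move=> x a; congr pair => //=; rewrite rm_act0.
have [g hg] := hP _ _ p (mcomp f (sval iP)) hp; have [h hh] := hQ _ _ p (mcomp f (sval iQ)) hp.
have l : linear (fun z : msum P Q => g z.1 + h z.2).
  by move=> k x y /=; rewrite !linearP scalerDr addrACA.
have a z b : g (rm_act z.1 b) + h (rm_act z.2 b) = rm_act (g z.1 + h z.2) b.
  by rewrite rm_actD !mh_act.
exists (@MHom K A (msum P Q) M _ l a) => -[x y] /=.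
rewrite linearD /= hg hh /= (svalP iP) (svalP iQ) -linearD; congr (f _).
by congr pair; rewrite /= ?addr0 ?add0r.
Qed.

Lemma trivm_proj M : trivm M -> projective M.
Proof.
move=> tM X Y p f _; exists (mzero M X) => x.
by rewrite (tM x) /= !linear0.
Qed.

Lemma bij_proj P Q (f : mhom P Q) : bijm f -> projective P -> projective Q.
Proof.
move=> hf hP M N p g hp; have [h hh] := hP _ _ p (mcomp g f) hp.
by exists (mcomp h (minv f)) => x; rewrite /= hh /= minvK.
Qed.

(** One copy of the regular module for each vector of a basis. *)
Lemma proj_cover M : exists P (p : mhom P M), projective P /\ surjm p.
Proof.
suff hs (s : seq M) : exists P (p : mhom P M), projective P /\
    forall x, x \in s -> exists y, p y = x.
  have [P [p [hP hp]]] := hs (vbasis {:M}); exists P, p; split=> // x.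
  rewrite (coord_vbasis (memvf x)); elim/big_rec: _ => [|i y _ [z <-]].
    by exists 0; rewrite linear0.
  have [|w hw] := hp (vbasis {:M})`_i; first by rewrite mem_nth ?size_tuple.
  by exists (coord (vbasis {:M}) i x *: w + z); rewrite linearP /= hw.
elim: s => [|x s [P [p [hP hp]]]].
  exists zmodule, (mzero _ _); split; first exact: (trivm_proj zmodule_triv).
  by move=> x; rewrite in_nil.
have l : linear (fun z : msum regmod P => orbitm x z.1 + p z.2).
  by move=> k u v /=; rewrite rm_act_linr linearP scalerDr addrACA.
have a (z : msum regmod P) b :
    orbitm x (rm_act z b).1 + p (rm_act z b).2 = rm_act (orbitm x z.1 + p z.2) b.
  by rewrite rm_actD -!mh_act.
exists (msum regmod P), (@MHom K A (msum regmod P) M _ l a).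
split; first by apply: msum_proj => //; apply: regmod_proj.
move=> y; rewrite inE => /orP[/eqP ->|/hp[z <-]].
  by exists (1, 0); rewrite /= rm_act1 linear0 addr0.
by exists (0, z); rewrite /= rm_act0r add0r.
Qed.

Lemma proj_resolution_ex M : inhabited (proj_resolution M).
Proof.
have cov N : {P : rmodule A & {p : mhom P N | projective P /\ surjm p}}.
  by case: (cid (proj_cover N)) => P /cid[p hp]; exists P, p.
pose cP N := projT1 (cov N); pose cp N : mhom (cP N) N := sval (projT2 (cov N)).
have cproj N : projective (cP N) := (svalP (projT2 (cov N))).1.
have csurj N : surjm (cp N) := (svalP (projT2 (cov N))).2.
pose om N := subm (ker_submod (cp N)).
pose inc N : mhom (om N) (cP N) := sub_inc (ker_submod (cp N)).
have incP N x : cp N x = 0 <-> exists y, inc N y = x := sub_incP (ker_submod (cp N)) x.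
have inci N : injm (inc N) := @sub_inc_inj _ _ _ _ (ker_submod (cp N)).
(* The iterated kernels of the chosen covers. *)
pose syz n := iter n om M.
pose d n : mhom (cP (syz n.+1)) (cP (syz n)) := mcomp (inc (syz n)) (cp (syz n.+1)).
split; apply: (@ProjResolution K A M (fun n => cP (syz n)) d (cp M)) => //.
- exact: csurj.
- move=> x; split=> [e|[y <-]]; last by apply/(incP M); exists (cp (om M) y).
  have [y <-] := (incP M x).1 e; have [z <-] := csurj _ y; by exists z.
- move=> n x; split=> [/= e|[y <-] /=].
    have [y <-] := (incP _ x).1 (inci _ _ e); have [z <-] := csurj _ y; by exists z.
  rewrite [X in inc _ X](_ : _ = 0) ?linear0 //.
  by apply/(incP (syz n.+1)); exists (cp (syz n.+2) y).
Qed.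

End SimpleModules.

(** * Multiplicities of simple modules *)

Section Multiplicities.
Context {K : fieldType} {A : falgType K}.
Implicit Types L M N P Q T : rmodule A.

(** The powers [1, b, ..., b ^ dim A] are linearly dependent. *)
Lemma annihilating_poly (b : A) : exists2 p : {poly K}, p != 0 & horner_alg b p = 0.
Proof.
set D := \dim {:A}; pose X := [tuple b ^+ i | i < D.+1].
have sX : size X = D.+1 by rewrite size_tuple.
have nfX : ~~ free X.
  apply/negP; rewrite /free sX => /eqP e.
  by have := dimvS (subvf <<X>>%VS); rewrite e ltnn.
have Xi (i : 'I_D.+1) : X`_i = b ^+ i by rewrite -tnth_nth tnth_mktuple.
have [k [kX [i ki]]] : exists k : 'I_D.+1 -> K,
    \sum_i k i *: X`_i = 0 /\ exists i, k i != 0.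
  apply: contrapT => h; move/negP: nfX; apply; apply/freeP => k hk i.
  by apply: contrapT => /eqP ki; apply: h; exists k; split=> //; exists i.
pose p := \sum_i k i *: 'X^i : {poly K}; exists p.
  apply/eqP => p0; have : p`_i = k i; last by rewrite p0 coef0 => e; rewrite -e eqxx in ki.
  rewrite coef_sum (bigD1 i) //= coefZ coefXn eqxx mulr1 big1 ?addr0 // => j ji.
  by rewrite coefZ coefXn eq_sym (inj_eq val_inj) (negPf ji) mulr0.
rewrite -kX /p rmorph_sum; apply: eq_bigr => j _.
by rewrite Xi /= -mul_polyC rmorphM rmorphXn /= horner_algC horner_algX mulr_algl.
Qed.

(** Write an annihilating polynomial of [b] as [X^m r(X)] with [r(0) != 0]. Then
    [b^m] is a multiple of [b^(m+1)] in [K[b]], and so of every higher power. The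
    exponent is taken positive for the idempotent [b^(n+1) q] to kill whatever [b]
    kills. *)
Lemma power_stable (b : A) :
  exists n q, q * b = b * q /\ b ^+ n.+1 = b ^+ n.+1 * b ^+ n.+1 * q.
Proof.
have [p p0 pb] := annihilating_poly b.
have [m [r + pE]] := multiplicity_XsubC p 0; rewrite p0 /= => r0.
have : root (r - (r.[0])%:P) 0 by rewrite rootE !hornerE subrr.
move=> /factor_theorem[s sE]; rewrite subr0 in pE sE.
pose c := r.[0]; have c0 : c != 0 by [].
pose t := - (c^-1 *: horner_alg b s).
have ub : horner_alg b s * b = b * horner_alg b s.
  transitivity (horner_alg b (s * 'X)); first by rewrite rmorphM /= horner_algX.
  by rewrite mulrC rmorphM /= horner_algX.
have bt : t * b = b * t by rewrite /t mulNr mulrN -scalerAl -scalerAr ub.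
have bm : b ^+ m = b ^+ m.+1 * t.
  have rE : r = s * 'X + c%:P by rewrite -sE subrK.
  move: pb; rewrite pE rE rmorphM rmorphD rmorphM /= rmorphXn /= horner_algX horner_algC.
  set u := horner_alg b s in ub * => e.
  have cb : GRing.comm b u by rewrite /GRing.comm ub.
  move: e; rewrite mulrDl mulr_algl -mulrA -exprS => /eqP; rewrite addr_eq0 => /eqP e.
  rewrite /t mulrN -scalerAr -(commrX _ (commr_sym cb)) e scalerN opprK scalerA.
  by rewrite mulVf // scale1r.
have bk k : b ^+ m = b ^+ m * (b ^+ k * t ^+ k).
  elim: k => [|k IH]; first by rewrite !expr0 !mulr1.
  have cbt : GRing.comm t b by [].
  rewrite {1}IH {1}bm [b ^+ m.+1]exprSr -!mulrA; congr (_ * _).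
  by rewrite [t * (_ * _)]mulrA (commrX k cbt) exprS -!mulrA -exprS.
exists m, (t ^+ m.+1); split.
  by have /(commrX m.+1) : GRing.comm b t by [].
by rewrite -mulrA {1}exprS {1}(bk m.+1) mulrA -exprS.
Qed.

(** Take [e] with [S e != 0] and [eA] of least dimension. If [T e != 0] for a simple
    [T] not isomorphic to [S], then some [b] in [eAe] kills a vector of [T e] and
    fixes one of [S e]; the idempotent of [K[b]] given by the stable power of [b]
    has the same properties, hence generates a smaller right ideal than [e],
    although it does not kill [S]. *)
Lemma separating_idempotent S : msimple S -> exists e : A,
  [/\ e * e = e, exists y : S, rm_act y e <> 0 &
      forall T, msimple T -> ~ miso T S -> forall x : T, rm_act x e = 0].
Proof.
move=> sS; pose d (e : A) := \dim (limg (amull e)).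
suff H k (e : A) : (d e < k)%N -> e * e = e -> (exists y : S, rm_act y e <> 0) ->
    exists e : A, [/\ e * e = e, exists y : S, rm_act y e <> 0 &
      forall T, msimple T -> ~ miso T S -> forall x : T, rm_act x e = 0].
  apply: (H _ 1 (ltnSn _)); first by rewrite mulr1.
  apply: contrapT => h; case: sS => + _; apply=> y; apply: contrapT => y0; apply: h.
  by exists y; rewrite rm_act1.
elim: k e => // k IH e; rewrite ltnS => dk ee ye.
have [h|h] := pselect (forall T, msimple T -> ~ miso T S -> forall x : T, rm_act x e = 0).
  by exists e.
have [T [sT [TS [x xe]]]] : exists T, msimple T /\ ~ miso T S /\
    exists x : T, rm_act x e <> 0.
  apply: contrapT => h'; apply: h => T sT TS x; apply: contrapT => xe; apply: h'.
  by exists T; split=> //; split=> //; exists x.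
case: ye => y ye; pose x' := rm_act x e; pose y' := rm_act y e.
have x'e : rm_act x' e = x' by rewrite -rm_actM ee.
have y'e : rm_act y' e = y' by rewrite -rm_actM ee.
pose U z := exists2 a, rm_act x' a = 0 & rm_act y' a = z.
have hU : is_submod U.
  split=> [|c _ _ [a a0 <-] [b b0 <-]|_ c [a a0 <-]].
  - by exists 0; rewrite rm_act0r.
  - by exists (c *: a + b); rewrite rm_act_linr // a0 b0 scaler0 addr0.
  - by exists (a * c); rewrite rm_actM // a0 rm_act0.
(* If the annihilator of x' killed y', then x' |-> y' would define a nonzero map
   from T to S. *)
have [U0|/(_ y')[a xa ya]] := sS.2 _ hU.
  have os : surjm (orbitm x').
    case: (sT.2 _ (im_submod (orbitm x'))) => // os; case: xe.
    by apply: os; exists e.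
  case: TS; exists (mdesc (orbitm x') (orbitm y')); apply: schur => //.
  exists (orbitm x' e); rewrite mdescE // => [|c c0]; first by rewrite /= y'e.
  by apply: U0; exists c.
pose b := e * a * e.
have xb : rm_act x' b = 0 by rewrite !rm_actM x'e xa rm_act0.
have yb : rm_act y' b = y' by rewrite !rm_actM y'e ya y'e.
have eb : e * b = b by rewrite /b !mulrA ee.
have be : b * e = b by rewrite /b -!mulrA ee.
clearbody b; have [n [q [qb bE]]] := power_stable b.
have qbn : q * b ^+ n.+1 = b ^+ n.+1 * q.
  by have /(commrX n.+1) : GRing.comm q b by [].
pose f := b ^+ n.+1 * q.
have bf : b ^+ n.+1 * f = b ^+ n.+1 by rewrite /f mulrA -bE.
have ff : f * f = f by rewrite /f mulrA -[_ * q * _]mulrA qbn mulrA -bE.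
have ef : e * f = f by rewrite /f exprS !mulrA eb.
have fe : f * e = f by rewrite /f -qbn exprSr -!mulrA be.
have ybn k' : rm_act y' (b ^+ k') = y'.
  by elim: k' => [|k' IHk]; rewrite ?expr0 ?rm_act1 // exprS rm_actM yb.
have yf : rm_act y' f = y' by rewrite -{1}(ybn n.+1) -rm_actM bf ybn.
have xf : rm_act x' f = 0 by rewrite /f exprS -!mulrA rm_actM xb rm_act0.
apply: (IH f) => //; last by exists y'; rewrite yf.
apply: leq_trans dk.
have sub : (limg (amull f) <= limg (amull e))%VS.
  apply/subvP => _ /memv_imgP[c _ ->]; apply/memv_imgP; exists (f * c); rewrite ?memvf //.
  by rewrite !lfunE /= mulrA ef.
rewrite (ltn_leqif (dimv_leqif_sup sub)); apply/negP => /subvP /(_ e) le.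
have /le/memv_imgP[c _] : e \in limg (amull e).
  by apply/memv_imgP; exists e; rewrite ?memvf // lfunE /= ee.
rewrite lfunE /= => ec; case: xe; rewrite -/x' -x'e ec.
by rewrite -[f]ff rm_actM rm_actM xf !rm_act0.
Qed.

(** A complete set of simple modules with the multiplicity functions: the
    composition multiplicities, characterized by additivity and their values on
    simple modules. *)
Record mult_system := MultSystem {
  ms_rank : nat;
  ms_simple : 'I_ms_rank -> rmodule A;
  ms_mult : 'I_ms_rank -> rmodule A -> nat;
  ms_simpleP : forall i, msimple (ms_simple i);
  ms_complete : forall T, msimple T -> exists i, miso (ms_simple i) T;
  ms_iso : forall i M N, miso M N -> ms_mult i M = ms_mult i N;
  ms_ses : forall i L M N (f : mhom L M) (g : mhom M N), mses f g ->
    ms_mult i M = (ms_mult i L + ms_mult i N)%N;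
  ms_delta : forall i j, ms_mult i (ms_simple j) = (i == j)
}.

Arguments ms_simple m i : clear implicits.
Arguments ms_mult m i M : clear implicits.

(** With [e_i] the idempotent separating [S_i] from the other simple modules, the
    multiplicity of [S_i] in [M] is [dim (M e_i) / dim (S_i e_i)]; by dévissage the
    division leaves no remainder. *)
Lemma mult_system_ex : inhabited mult_system.
Proof.
have [n [S [sS nS cS]]] := @finite_simples K A.
have h (i : 'I_n) : {e : A | [/\ e * e = e, exists y : S i, rm_act y e <> 0 &
      forall T, msimple T -> ~ miso T (S i) -> forall x : T, rm_act x e = 0]}.
  by apply: cid; apply: separating_idempotent; apply: sS.
pose e i := sval (h i).
have ee i : e i * e i = e i by rewrite /e; case: (h i) => a [].
pose dd i := rdim (e i) (S i).
have d0 i : (0 < dd i)%N.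
  rewrite lt0n; apply/eqP => /rdim_eq0; rewrite /e; case: (h i) => a [/= _ [y ya] _].
  by move=> /(_ y).
have e0 (i : 'I_n) T : msimple T -> ~ miso T (S i) -> rdim (e i) T = 0%N.
  move=> sT nT; apply/rdim_eq0 => x; rewrite /e; case: (h i) => a [/= _ _]; exact.
have dv i M : (dd i %| rdim (e i) M)%N.
  elim/(@module_devissage K A): M => [M tM|T M Q f g sT s dQ]; first by rewrite rdim_triv.
  rewrite (rdim_ses (ee i) s) dvdn_add //.
  have [TS|TS] := pselect (miso T (S i)); first by rewrite (rdim_iso (ee i) TS).
  by rewrite e0.
split; apply: (@MultSystem n S (fun i M => rdim (e i) M %/ dd i)%N).
- by move=> i; apply: sS.
- by move=> T /cS[i ilt iT]; exists (Ordinal ilt).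
- by move=> i M N /(rdim_iso (ee i)) ->.
- by move=> i L M N f g /(rdim_ses (ee i)) ->; rewrite divnDl.
- move=> i j; case: eqP => [->|ij]; first by rewrite divnn d0.
  rewrite e0 ?div0n //; first exact: sS.
  by move=> /(nS _ _ (ltn_ord j) (ltn_ord i)) /val_inj ji; apply: ij.
Qed.

Lemma ms_triv (m : mult_system) i M : trivm M -> ms_mult m i M = 0%N.
Proof.
move=> tM; have : mses (mid M) (mzero M M).
  split=> [x //|y|x]; first by exists 0; rewrite (tM y).
  by split=> // _; exists x.
by move=> /(ms_ses i); rewrite -{1}[ms_mult _ _ _]addn0 => /eqP; rewrite eqn_add2l => /eqP.
Qed.

Lemma ms_simple_mult (m : mult_system) i j T :
  miso (ms_simple m j) T -> ms_mult m i T = (i == j).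
Proof. by move=> h; rewrite -(ms_iso i h) ms_delta. Qed.

Lemma ms_dim (m : mult_system) M :
  mdim M = (\sum_i ms_mult m i M * mdim (ms_simple m i))%N.
Proof.
elim/(@module_devissage K A): M => [M tM|T M Q f g sT s IH].
  by rewrite big1 => [|i _]; [apply/mdim_eq0|rewrite ms_triv].
rewrite (mdim_ses s) {}IH; under [RHS]eq_bigr do rewrite (ms_ses _ s) mulnDl.
rewrite big_split /=; congr addn.
have [j jT] := ms_complete m sT.
rewrite (bigD1 j) //= big1 => [|i ij]; rewrite (ms_simple_mult _ jT);
  last by rewrite (negPf ij).
by rewrite eqxx mul1n addn0 /mdim (rdim_iso _ jT) // mulr1.
Qed.

End Multiplicities.

Arguments ms_simple {K A} m i.
Arguments ms_mult {K A} m i M.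

Arguments mult_system {K} A.

(** * Identities in abelian groups *)

(** Diagram chases end with identities between signed sums of elements of a
    module. They are decided by comparing integer coefficients; rewriting with
    the laws of addition would also act on the degrees, on which the types of
    the elements depend. *)
Inductive zexp := ZVar of nat | ZAdd of zexp & zexp | ZOpp of zexp | ZZero.

Fixpoint zeval (V : zmodType) (env : seq V) e : V :=
  match e with
  | ZVar i => env`_i
  | ZAdd a b => zeval env a + zeval env b
  | ZOpp a => - zeval env a
  | ZZero => 0
  end.

Fixpoint zcoef e (i : nat) : int :=
  match e with
  | ZVar j => (j == i)%:Z
  | ZAdd a b => zcoef a i + zcoef b i
  | ZOpp a => - zcoef a i
  | ZZero => 0
  end.

Lemma zevalE (V : zmodType) (env : seq V) e :
  zeval env e = \sum_(i < size env) env`_i *~ zcoef e i.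
Proof.
elim: e => [j|a IHa b IHb|a IHa|] /=.
- have [lt|ge] := ltnP j (size env); last first.
    rewrite nth_default // big1 // => i _.
    by rewrite [j == i](_ : _ = false) //; apply: gtn_eqF; apply: leq_trans ge.
  rewrite (bigD1 (Ordinal lt)) //= eqxx mulr1z big1 ?addr0 // => i ij.
  by rewrite [j == i](_ : _ = false) //; apply: contraNF ij => /eqP e; apply/eqP/val_inj.
- by rewrite IHa IHb -big_split; apply: eq_bigr => i _; rewrite mulrzDr.
- by rewrite IHa -sumrN; apply: eq_bigr => i _; rewrite mulrNz.
- by rewrite big1 // => i _; rewrite mulr0z.
Qed.

Lemma zeval_eq (V : zmodType) (env : seq V) a b :
  all (fun i => zcoef a i == zcoef b i) (iota 0 (size env)) -> zeval env a = zeval env b.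
Proof.
move=> /allP h; rewrite !zevalE; apply: eq_bigr => i _.
by rewrite (eqP (h i _)) // mem_iota add0n ltn_ord.
Qed.

Ltac zhead f := lazymatch f with ?g _ => zhead g | _ => constr:(f) end.
Ltac zsame_fun f g :=
  let f' := zhead f in let g' := zhead g in constr_eq f' g'; unify f g.
(* Equal atoms may carry convertible but distinct type annotations on their
   projections and applications, which are ignored. *)
Ltac zsame x y :=
  first
    [ constr_eq x y
    | lazymatch constr:((x, y)) with
      | (fst ?a, fst ?b) => zsame a b
      | (snd ?a, snd ?b) => zsame a b
      | (@mh_fun _ _ _ _ ?f ?a, @mh_fun _ _ _ _ ?g ?b) =>
          zsame_fun f g; zsame a b
      end ].
Ltac zfind x l :=
  match l with
  | cons ?y _ => let _ := match goal with _ => zsame x y end in constr:(O)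
  | cons _ ?l' => let n := zfind x l' in constr:(S n)
  end.
Ltac zatoms t l :=
  lazymatch t with
  | @Algebra.add _ ?a ?b => let l1 := zatoms a l in zatoms b l1
  | @Algebra.opp _ ?a => zatoms a l
  | @Algebra.zero _ => l
  | _ => match l with
         | _ => let n := zfind t l in l
         | _ => constr:(cons t l)
         end
  end.
Ltac zreify t l :=
  lazymatch t with
  | @Algebra.add _ ?a ?b =>
      let a' := zreify a l in let b' := zreify b l in constr:(ZAdd a' b')
  | @Algebra.opp _ ?a => let a' := zreify a l in constr:(ZOpp a')
  | @Algebra.zero _ => constr:(ZZero)
  | _ => let n := zfind t l in constr:(ZVar n)
  end.
Ltac zmod :=
  lazymatch goal with
  | |- @eq ?T ?a ?b =>
      let l0 := constr:(@nil T) in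
      let l1 := zatoms a l0 in let l := zatoms b l1 in
      let a' := zreify a l in let b' := zreify b l in
      exact (@zeval_eq _ l a' b' isT)
  end.

(** * Complexes: cohomology, subcomplexes, cones *)

Section Complexes.
Context {K : fieldType} {A : falgType K}.
Implicit Types L M N : rmodule A.
Implicit Types X Y Z W : cpx A.

Definition mfst M N : mhom (msum M N) M.
Proof. by exists (fun x : msum M N => x.1). Defined.
Definition msnd M N : mhom (msum M N) N.
Proof. by exists (fun x : msum M N => x.2). Defined.
Definition mpair L M N (f : mhom L M) (g : mhom L N) : mhom L (msum M N).
Proof.
exists (fun x => (f x, g x) : msum M N) => [k x y|x a]; congr pair => /=.
all: by rewrite ?linearP ?mh_act.
Defined.
Definition madd M N (f g : mhom M N) : mhom M N.
Proof.
exists (fun x => f x + g x) => [k x y|x a]; last by rewrite !mh_act rm_actD.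
by rewrite !linearP scalerDr addrACA.
Defined.

(** An arbitrary degree is written [j + 1] before applying the lemmas on cones,
    whose degree [j] part involves the degree [j + 1] of the source. *)
Lemma int_succ (i : int) : exists j, i = j + 1.
Proof. by exists (i - 1); rewrite subrK. Qed.

Lemma pair_ext (U V : Type) (x y : U * V) : x.1 = y.1 -> x.2 = y.2 -> x = y.
Proof. by case: x y => [a b] [c d] /= -> ->. Qed.

Lemma addr0_oppr (V : zmodType) (a b : V) : a + b = 0 -> - b = a.
Proof. by move/eqP; rewrite addr_eq0 => /eqP. Qed.

Lemma addr0_oppl (V : zmodType) (a b : V) : a + b = 0 -> - a = b.
Proof. by rewrite addrC => /addr0_oppr. Qed.

Lemma cocP X i (x : X i) : cocycle x -> forall j, cd X i j x = 0.
Proof. by move=> h j; case: (eqVneq j (i + 1)) => [->|/cd_out]. Qed.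

(** As the differential vanishes between other pairs of degrees, the source of a
    coboundary may be any degree: this spares transports along [i - 1 + 1 = i]. *)
Lemma cobP X i (x : X i) : coboundary x <-> exists j (y : X j), cd X j i y = x.
Proof.
split=> [[y <-]|[j [y <-]]]; first by exists (i - 1), y.
case: (eqVneq i (j + 1)) => [e|/cd_out e]; last by exists 0; rewrite linear0 e.
have {e} e : j = i - 1 by rewrite e addrK.
by subst j; exists y.
Qed.

Lemma cobS X i (x : X (i + 1)) :
  coboundary x <-> exists y : X i, cd X i (i + 1) y = x.
Proof.
split=> [[y <-]|[y <-]]; last by apply/cobP; exists i, y.
have e : i + 1 - 1 = i by rewrite addrK.
by move: y; rewrite e => y; exists y.
Qed.

Lemma coc_submod X i : is_submod (@cocycle K A X i).
Proof. exact: (ker_submod (cd X i (i + 1))). Qed.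
Lemma cob_submod X i : is_submod (@coboundary K A X i).
Proof. exact: (im_submod (cd X (i - 1) i)). Qed.

Lemma coc_cd X i j (x : X i) : cocycle (cd X i j x).
Proof. exact: cdd. Qed.
Lemma cob_cd X i j (x : X i) : coboundary (cd X i j x).
Proof. by apply/cobP; exists i, x. Qed.
Lemma cob_coc X i (x : X i) : coboundary x -> cocycle x.
Proof. by move=> [y <-]; apply: coc_cd. Qed.
Lemma cob0 X i : coboundary (0 : X i).
Proof. exact: (ism0 (cob_submod X i)). Qed.

Lemma cm_coc X Y (f : chmap X Y) i (x : X i) : cocycle x -> cocycle (f i x).
Proof. by move=> h; rewrite /cocycle -cm_comm h linear0. Qed.
Lemma cm_cob X Y (f : chmap X Y) i (x : X i) : coboundary x -> coboundary (f i x).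
Proof. by move=> [y <-]; rewrite cm_comm; apply: cob_cd. Qed.

Definition acyc X i := forall x : X i, cocycle x -> coboundary x.

Lemma triv_acyc X i : trivm (X i) -> acyc X i.
Proof. by move=> h x _; rewrite (h x); apply: cob0. Qed.

Lemma acyc_qis X Y (f : chmap X Y) :
  (forall i, acyc X i) -> (forall i, acyc Y i) -> quasi_iso f.
Proof.
move=> hX hY i; split=> [x /hX //|y /hY cy]; exists 0.
  exact: (ism0 (coc_submod X i)).
by rewrite linear0 subr0.
Qed.

Lemma bij_qis X Y (f : chmap X Y) : (forall i, bijm (f i)) -> quasi_iso f.
Proof.
move=> hf i; split=> [x _ [y yx]|y cy].
  have [z zy] := (hf (i - 1)).2 y; exists z; apply: (injmP (hf i).1).
  by rewrite cm_comm zy.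
have [x xy] := (hf i).2 y; exists x; last by rewrite xy subrr; apply: cob0.
by apply: (hf (i + 1)).1; rewrite cm_comm xy.
Qed.

Lemma qis_comp X Y Z (g : chmap Y Z) (f : chmap X Y) :
  quasi_iso g -> quasi_iso f -> quasi_iso (cm_comp g f).
Proof.
move=> hg hf i; have [gi gs] := hg i; have [fi fs] := hf i.
split=> [x cx /gi h|z cz]; first by apply: fi => //; apply: h; apply: cm_coc.
have [y cy ey] := gs z cz; have [x cx ex] := fs y cy; exists x => //=.
have -> : z - g i (f i x) = (z - g i y) + g i (y - f i x).
  by rewrite linearB /= addrA subrK.
by apply: (ismD (cob_submod Z i)) => //; apply: cm_cob.
Qed.

Lemma qis_id X : quasi_iso (cm_id X).
Proof. by apply: bij_qis => i; split=> // y; exists y. Qed.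

Lemma cm_ctr X Y (f : chmap X Y) i j x : f j (ctr X i j x) = ctr Y i j (f i x).
Proof.
case: (eqVneq i j) => [e|ne]; first by subst j; rewrite !ctr_id.
by rewrite !ctr_neq // linear0.
Qed.

(** * Subcomplexes and quotient complexes *)

Record is_subcpx X (S : forall i, X i -> Prop) : Prop := IsSubcpx {
  scS : forall i, is_submod (S i);
  scd : forall i j x, S i x -> S j (cd X i j x)
}.

Section SubQuo.
Variables (X : cpx A) (S : forall i, X i -> Prop) (h : is_subcpx S).

Lemma csub_dE i j x : sub_inc (scS h j) (mlift (sub_inc (scS h j))
    (mcomp (cd X i j) (sub_inc (scS h i))) x) = cd X i j (sub_inc (scS h i) x).
Proof.
rewrite mliftE //; first exact: sub_inc_inj.
by move=> y; apply/(sub_incP (scS h j)); apply: (scd h); apply: sub_incS.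
Qed.

Definition csub : cpx A.
Proof.
exists (fun i => subm (scS h i)) (fun i j => mlift (sub_inc (scS h j))
    (mcomp (cd X i j) (sub_inc (scS h i)))).
- move=> i j x ij; apply: (@sub_inc_inj _ _ _ _ (scS h j)).
  by rewrite csub_dE cd_out.
- move=> i j k x; apply: (@sub_inc_inj _ _ _ _ (scS h k)).
  by rewrite !csub_dE cdd.
- have [n hn] := c_bounded X; exists n => i x ni.
  by apply: (@sub_inc_inj _ _ _ _ (scS h i)); apply: hn.
Defined.

Definition csub_inc : chmap csub X.
Proof. by exists (fun i => sub_inc (scS h i)) => i j x; rewrite csub_dE. Defined.

Lemma csub_inc_inj i : injm (csub_inc i).
Proof. exact: sub_inc_inj. Qed.
Lemma csub_incP i (x : X i) : S x <-> exists y, csub_inc i y = x.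
Proof. exact: sub_incP. Qed.
Lemma csub_incS i y : S (csub_inc i y).
Proof. exact: sub_incS. Qed.

Lemma csub_lift_ex Y (f : chmap Y X) : (forall i x, S (f i x)) ->
  exists g : chmap Y csub, forall i x, csub_inc i (g i x) = f i x.
Proof.
move=> hf; have e i x : csub_inc i (mlift (csub_inc i) (f i) x) = f i x.
  by apply: mliftE; [exact: csub_inc_inj|move=> y; apply/csub_incP].
unshelve eexists (@ChMap K A Y csub (fun i => mlift (csub_inc i) (f i)) _) => //.
move=> i j x; apply: (injmP (@csub_inc_inj j)).
by rewrite e cm_comm [RHS]cm_comm e.
Qed.

Lemma cquo_dE i j x : mdesc (quo_pr (scS h i)) (mcomp (quo_pr (scS h j)) (cd X i j))
    (quo_pr (scS h i) x) = quo_pr (scS h j) (cd X i j x).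
Proof.
rewrite mdescE //; first exact: quo_pr_surj.
by move=> y /(quo_prP (scS h i)) Sy; apply/(quo_prP (scS h j)); apply: (scd h).
Qed.

Definition cquo : cpx A.
Proof.
exists (fun i => quom (scS h i)) (fun i j =>
  mdesc (quo_pr (scS h i)) (mcomp (quo_pr (scS h j)) (cd X i j))).
- move=> i j x ij; have [y <-] := @quo_pr_surj _ _ _ _ (scS h i) x.
  by rewrite cquo_dE cd_out // linear0.
- move=> i j k x; have [y <-] := @quo_pr_surj _ _ _ _ (scS h i) x.
  by rewrite !cquo_dE cdd linear0.
- have [n hn] := c_bounded X; exists n => i x ni.
  have [y <-] := @quo_pr_surj _ _ _ _ (scS h i) x.
  by rewrite (hn i y) // linear0.
Defined.

Definition cquo_pr : chmap X cquo.
Proof. by exists (fun i => quo_pr (scS h i)) => i j x; rewrite cquo_dE. Defined.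

Lemma cquo_pr_surj i : surjm (cquo_pr i).
Proof. exact: quo_pr_surj. Qed.
Lemma cquo_prP i (x : X i) : S x <-> cquo_pr i x = 0.
Proof. exact: quo_prP. Qed.

Lemma cquo_desc_ex Y (f : chmap X Y) : (forall i x, S x -> f i x = 0) ->
  exists g : chmap cquo Y, forall i x, g i (cquo_pr i x) = f i x.
Proof.
move=> hf; have e i x : mdesc (cquo_pr i) (f i) (cquo_pr i x) = f i x.
  by apply: mdescE; [exact: cquo_pr_surj|move=> y /cquo_prP/hf].
unshelve eexists (@ChMap K A cquo Y (fun i => mdesc (cquo_pr i) (f i)) _) => //.
move=> i j x; have [y <-] := cquo_pr_surj x.
by rewrite -cm_comm !e cm_comm.
Qed.

End SubQuo.

(** * Cones *)

Lemma cone_coc X Y (f : chmap X Y) i (x : ccone f i) : cocycle x <->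
  cocycle x.1 /\ f (i + 1) x.1 + cd Y i (i + 1) x.2 = 0.
Proof.
split=> [[e1 e2]|[e1 e2]].
  by split; [apply/eqP; rewrite -oppr_eq0 e1|move: e2; rewrite ctr_id].
by apply: pair_ext => /=; rewrite ?ctr_id // e1 oppr0.
Qed.

Lemma cone_cob X Y (f : chmap X Y) i (x : ccone f (i + 1)) : coboundary x <->
  exists x1 y1, - cd X (i + 1) (i + 1 + 1) x1 = x.1 /\
                f (i + 1) x1 + cd Y i (i + 1) y1 = x.2.
Proof.
rewrite cobS; split=> [[[x1 y1] <-]|[x1 [y1 [e1 e2]]]].
  by exists x1, y1; rewrite /= ctr_id.
by exists (x1, y1); apply: pair_ext; rewrite /= ?ctr_id.
Qed.

(** A cocycle [(x, y)] of the cone has [f x = - d y], so [x] is a coboundary, say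
    of [x1]; then [y + f x1] is a cocycle, and subtracting the image of a cocycle
    of [X] makes it a coboundary. *)
Lemma qis_cone_acyc X Y (f : chmap X Y) : quasi_iso f -> forall i, acyc (ccone f) i.
Proof.
move=> hf i; have [j ->] := int_succ i; move=> x /cone_coc[cx e].
have [fi fs] := hf (j + 1); have [gi gs] := hf (j + 1 + 1).
have /gi/cobS[] : coboundary (f (j + 1 + 1) x.1).
  apply/cobS; exists (- x.2); rewrite linearN; apply/eqP; rewrite eq_sym -addr_eq0.
  by apply/eqP.
  done.
move=> x1 x1E; have cy : cocycle (x.2 + f (j + 1) x1).
  by rewrite /cocycle linearD /= -cm_comm x1E; apply: etrans (addrC _ _) e.
have [x2 cx2 /cobS[y2 y2E]] := fs _ cy.
apply/cone_cob; exists (x2 - x1), y2; split.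
  by rewrite linearB /= x1E cx2 sub0r opprK.
by rewrite y2E mhB; zmod.
Qed.

Definition cses X Y Z (f : chmap X Y) (g : chmap Y Z) := forall i, mses (f i) (g i).

Lemma cone_ses_comm X Y Z (f : chmap X Y) (g : chmap Y Z) : cses f g ->
  forall i j (x : ccone f i), mcomp (g j) (msnd _ _) (cd (ccone f) i j x)
    = cd Z i j (mcomp (g i) (msnd _ _) x).
Proof.
move=> s i j x /=; rewrite linearD /= cm_comm -cm_ctr [g j _](_ : _ = 0) ?add0r //.
by have [_ _ h] := s j; apply/h; exists (ctr X (i + 1) j x.1).
Qed.

(** Cocycles and their primitives in the third term are lifted to the middle one;
    the boundaries of the lifts come from the first term. *)
Lemma cses_qis X Y Z (f : chmap X Y) (g : chmap Y Z) (s : cses f g) :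
  quasi_iso (ChMap (cone_ses_comm s)).
Proof.
move=> i; have [j ->] := int_succ i; split.
  move=> [x y] /cone_coc[/= cx e] /cobS[z zE].
  have [_ sj _] := s j; have [inj _ hj] := s (j + 1); have [inj' _ _] := s (j + 1 + 1).
  have [w wz] := sj z.
  have /hj[t tE] : g (j + 1) (y - cd Y j (j + 1) w) = 0.
    by rewrite linearB /= cm_comm wz zE subrr.
  apply/cone_cob; exists t, w; rewrite /= tE subrK; split=> //.
  apply: (injmP inj'); rewrite linearN /= cm_comm tE linearB /= cdd subr0.
  by apply/eqP; rewrite eq_sym -addr_eq0 e.
move=> z cz; have [_ sj hj] := s (j + 1); have [inj _ hj'] := s (j + 1 + 1).
have [_ _ hj''] := s (j + 1 + 1 + 1).
have [y yz] := sj z.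
have /hj'[x xE] : g (j + 1 + 1) (cd Y (j + 1) (j + 1 + 1) y) = 0 by rewrite cm_comm yz.
exists (- x, y); last by rewrite /= yz subrr; apply: cob0.
apply/cone_coc; rewrite /= linearN /= xE addNr; split=> //.
have [inj3 _ _] := s (j + 1 + 1 + 1).
by apply: inj3; rewrite cm_comm linearN /= xE linearN /= cdd oppr0.
Qed.

Lemma csub_quo_ses X (S : forall i, X i -> Prop) (h : is_subcpx S) :
  cses (csub_inc h) (cquo_pr h).
Proof. by move=> i; apply: sub_quo_ses. Qed.

End Complexes.

(** * Truncations *)

Section Truncations.
Context {K : fieldType} {A : falgType K}.
Implicit Types L M N : rmodule A.
Implicit Types X Y Z W : cpx A.
Implicit Types i j k : int.

(** The truncation [tge k] divides by everything in degrees below [k] and by the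
    coboundaries in degree [k]; the truncation [tle k] keeps what lies in degrees
    below [k] and the cocycles in degree [k]. Nothing is imposed when [i < k]. *)
Definition tgeS X k i (x : X i) := (k < i -> x = 0) /\ (i = k -> coboundary x).
Definition tleS X k i (x : X i) := (k < i -> x = 0) /\ (i = k -> cocycle x).

Lemma tge_subcpx X k : is_subcpx (@tgeS X k).
Proof.
split=> [i|i j x [h0 h1]].
  by apply: cap_submod; apply: imp_submod; [exact: zero_submod|exact: cob_submod].
split=> [kj|_]; last exact: cob_cd.
case: (eqVneq j (i + 1)) => [e|/cd_out //]; subst j.
case: (ltgtP k i) => [ki|ik|e]; first by rewrite h0 // mh0.
  by move: kj ik; lia.
by apply: cocP; apply/cob_coc/h1.
Qed.

Lemma tle_subcpx X k : is_subcpx (@tleS X k).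
Proof.
split=> [i|i j x [h0 h1]].
  by apply: cap_submod; apply: imp_submod; [exact: zero_submod|exact: coc_submod].
split=> [kj|_]; last exact: coc_cd.
case: (eqVneq j (i + 1)) => [e|/cd_out //]; subst j.
case: (ltgtP k i) => [ki|ik|e]; first by rewrite h0 // mh0.
  by move: kj ik; lia.
by apply: cocP; apply: h1.
Qed.

Definition tge k X := cquo (tge_subcpx X k).
Definition tge_pr k X : chmap X (tge k X) := cquo_pr (tge_subcpx X k).
Definition tle k X := csub (tle_subcpx X k).
Definition tle_inc k X : chmap (tle k X) X := csub_inc (tle_subcpx X k).

Arguments tge_pr : simpl never.
Arguments tle_inc : simpl never.
Arguments tge : simpl never.
Arguments tle : simpl never.

Lemma tge_prS k X i : surjm (tge_pr k X i).
Proof. exact: cquo_pr_surj. Qed.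

Lemma tge_pr0 k X i (x : X i) : tge_pr k X i x = 0 <-> tgeS k x.
Proof. exact: (iff_sym (cquo_prP (tge_subcpx X k) x)). Qed.

Lemma tge_triv k X i : i < k -> trivm (tge k X i).
Proof.
move=> ik x; have [y <-] := tge_prS x; apply/tge_pr0; split=> [ki|e].
  by exfalso; move: ki ik; lia.
by exfalso; move: ik; rewrite e ltxx.
Qed.

Lemma tge_coc k X i (x : X i) : k <= i -> cocycle (tge_pr k X i x) <-> cocycle x.
Proof.
move=> ki; rewrite /cocycle -cm_comm tge_pr0; split=> [[h _]|->].
  by apply: h; move: ki; lia.
by split=> // _; apply: cob0.
Qed.

Lemma tge_cob k X i (x : X i) : k <= i ->
  coboundary (tge_pr k X i x) <-> coboundary x.
Proof.
move=> ki; split; last exact: cm_cob.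
have [j e] := int_succ i; subst i => /cobS[y]; have [z <-] := tge_prS y => yx.
have /tge_pr0[h0 h1] : tge_pr k X (j + 1) (x - cd X j (j + 1) z) = 0.
  by rewrite mhB cm_comm yx subrr.
rewrite -(subrK (cd X j (j + 1) z) x); apply: (ismD (cob_submod X _)).
  case: (ltgtP k (j + 1)) => [/h0 ->|h|e]; first exact: cob0.
    by move: ki h; lia.
  exact: h1.
exact: cob_cd.
Qed.

Lemma tgem_ex k X Y (f : chmap X Y) : exists g : chmap (tge k X) (tge k Y),
  forall i x, g i (tge_pr k X i x) = tge_pr k Y i (f i x).
Proof.
have [|g hg] := @cquo_desc_ex _ _ _ _ (tge_subcpx X k) _ (cm_comp (tge_pr k Y) f).
  move=> i x [h0 h1]; apply/tge_pr0; split=> [/h0 ->|/h1]; first by rewrite mh0.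
  exact: cm_cob.
by exists g => i x; rewrite hg.
Qed.

Definition tgem k X Y (f : chmap X Y) := sval (cid (tgem_ex k f)).
Lemma tgemE k X Y (f : chmap X Y) i x :
  tgem k f i (tge_pr k X i x) = tge_pr k Y i (f i x).
Proof. exact: (svalP (cid (tgem_ex k f))). Qed.

Lemma tge_pr_qis k X : (forall i, i < k -> acyc X i) -> quasi_iso (tge_pr k X).
Proof.
move=> h i; case: (ltP i k) => ik; split=> [x cx hx|y cy].
- exact: h.
- exists 0; first exact: (ism0 (coc_submod X i)).
  by rewrite (tge_triv ik (y - _)); apply: cob0.
- by apply/(tge_cob _ ik).
- have [x xy] := tge_prS y; exists x; last by rewrite xy subrr; apply: cob0.
  by apply/(tge_coc _ ik); rewrite xy.
Qed.

Definition qis_at X Y (f : chmap X Y) i :=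
  (forall x : X i, cocycle x -> coboundary (f i x) -> coboundary x) /\
  (forall y : Y i, cocycle y -> exists2 x : X i, cocycle x & coboundary (y - f i x)).

(** In degrees at least [k] cocycles and coboundaries may be tested before or
    after truncation, and the other degrees are trivial. *)
Lemma tgem_qis_at k X Y (f : chmap X Y) :
  (forall i, k <= i -> qis_at f i) -> quasi_iso (tgem k f).
Proof.
move=> hf i; case: (ltP i k) => ik.
  split=> [x cx hx|y cy]; first by rewrite (tge_triv ik x); apply: cob0.
  exists 0; first exact: (ism0 (coc_submod _ i)).
  by rewrite (tge_triv ik (y - _)); apply: cob0.
have [fi fs] := hf i ik; split=> [x|y].
  have [x' <-] := tge_prS x; rewrite tgemE.
  by move=> /(tge_coc _ ik) cx /(tge_cob _ ik) hx; apply: cm_cob; apply: fi.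
have [y' <-] := tge_prS y => /(tge_coc _ ik) /fs[x cx hx].
exists (tge_pr k X i x); first exact: cm_coc.
by rewrite tgemE -mhB; apply: cm_cob.
Qed.

Lemma tgem_qis k X Y (f : chmap X Y) : quasi_iso f -> quasi_iso (tgem k f).
Proof. by move=> hf; apply: tgem_qis_at => i _; apply: hf. Qed.

Lemma tge_pr_bij k X : (forall i, i < k -> trivm (X i)) ->
  forall i, bijm (tge_pr k X i).
Proof.
move=> h i; split; last exact: tge_prS.
move=> x /tge_pr0[h0 h1]; case: (ltgtP k i) => [/h0 //|ik|e]; first exact: h.
have [y <-] := h1 (esym e).
by rewrite (h (i - 1) _ y) ?mh0 //; move: e; lia.
Qed.

Lemma tge_pr_bij_gt k X i : k < i -> bijm (tge_pr k X i).
Proof.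
move=> ki; split; last exact: tge_prS.
by move=> x /tge_pr0[h0 _]; apply: h0.
Qed.

Lemma tge_acyc k X i : acyc X i -> acyc (tge k X) i.
Proof.
move=> h; case: (ltP i k) => ik; first by apply: triv_acyc; apply: tge_triv.
by move=> y; have [x <-] := tge_prS y => /(tge_coc _ ik) /h; apply: cm_cob.
Qed.

Lemma tle_incI k X i : injm (tle_inc k X i).
Proof. exact: csub_inc_inj. Qed.

Lemma tle_incP k X i (x : X i) : tleS k x <-> exists y, tle_inc k X i y = x.
Proof. exact: (csub_incP (tle_subcpx X k)). Qed.

Lemma tle_triv k X i : k < i -> trivm (tle k X i).
Proof.
move=> ki x; apply: (@tle_incI k X i).
by have /tle_incP[h _] : exists y, tle_inc k X i y = tle_inc k X i x; [exists x|apply: h].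
Qed.

Lemma tle_coc k X i (x : tle k X i) : cocycle (tle_inc k X i x) <-> cocycle x.
Proof.
split=> [|h]; last exact: cm_coc.
by rewrite /cocycle -cm_comm => /(@tle_incI k X (i + 1)).
Qed.

Lemma tle_cob k X i (x : tle k X i) : i <= k ->
  coboundary (tle_inc k X i x) <-> coboundary x.
Proof.
move=> ik; split=> [|h]; last exact: cm_cob.
have [j e] := int_succ i; subst i => /cobS[y yx].
have /tle_incP[z zy] : tleS k y by split=> h; exfalso; move: ik h; lia.
by apply/cobS; exists z; apply: (injmP (@tle_incI k X (j + 1))); rewrite cm_comm zy.
Qed.

Lemma tle_cocS k X i (x : X i) : i <= k -> cocycle x ->
  exists2 y, cocycle y & tle_inc k X i y = x.
Proof.
move=> ik cx; have /tle_incP[y yx] : tleS k x by split=> // h; exfalso; move: ik h; lia.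
by exists y => //; apply/tle_coc; rewrite yx.
Qed.

Lemma tle_acyc k X i : acyc X i -> acyc (tle k X) i.
Proof.
move=> h; case: (ltP k i) => ik; first by apply: triv_acyc; apply: tle_triv.
by move=> x /tle_coc /h /tle_cob; apply.
Qed.

Lemma tle_inc_qis k X : (forall i, k < i -> acyc X i) -> quasi_iso (tle_inc k X).
Proof.
move=> h i; case: (ltP k i) => ik; split=> [x cx hx|y cy].
- by rewrite (tle_triv ik x); apply: cob0.
- exists 0; first exact: (ism0 (coc_submod _ i)).
  by rewrite mh0 subr0; apply: h.
- by apply/(tle_cob _ ik).
- by have [x cx <-] := tle_cocS ik cy; exists x => //; rewrite subrr; apply: cob0.
Qed.

Lemma tle_map_ex k l X : k <= l -> exists g : chmap (tle k X) (tle l X),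
  forall i x, tle_inc l X i (g i x) = tle_inc k X i x.
Proof.
move=> kl; have [|g hg] := @csub_lift_ex _ _ _ _ (tle_subcpx X l) _ (tle_inc k X).
  move=> i x; have /tle_incP[h0 h1] : exists y, tle_inc k X i y = tle_inc k X i x by exists x.
  split=> [li|e]; first by apply: h0; move: kl li; lia.
  case: (ltgtP k i) => [ki|ik|e']; last exact: h1.
    by rewrite /cocycle h0 // mh0.
  by exfalso; move: kl ik; rewrite e; lia.
by exists g.
Qed.

(** * Complexes concentrated in one degree *)

Definition stalk_obj M j i : rmodule A := if i == j then M else zmodule.

(** The identity in degree [j] and [0] elsewhere. Maps to and from stalk complexes
    are written through [st_in] and [st_out], to avoid equalities of degrees in
    types. *)
Definition st_in M j i : mhom M (stalk_obj M j i) :=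
  match i == j as b return mhom M (if b then M else zmodule) with
  | true => mid M
  | false => mzero _ _
  end.

Definition st_out M j i : mhom (stalk_obj M j i) M :=
  match i == j as b return mhom (if b then M else zmodule) M with
  | true => mid M
  | false => mzero _ _
  end.

Lemma st_outK M j i x : st_in M j i (st_out M j i x) = x.
Proof.
rewrite /st_in /st_out; move: x; rewrite /stalk_obj.
by case: (i == j) => // x; rewrite (zmodule_triv x).
Qed.

Lemma st_inK M j x : st_out M j j (st_in M j j x) = x.
Proof.
by rewrite /st_in /st_out /stalk_obj eqxx.
Qed.

Lemma stalk_triv M j i : i != j -> trivm (stalk_obj M j i).
Proof. by rewrite /stalk_obj => /negPf ->; apply: zmodule_triv. Qed.

Definition stalk M j : cpx A.
Proof.
exists (stalk_obj M j) (fun i k => mzero _ _) => //.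
by exists `|j|%N => i x hi; apply: stalk_triv; apply: contraTneq hi => ->; rewrite ltnn.
Defined.

Lemma st_out0 M j i x : i != j -> st_out M j i x = 0.
Proof. by move=> ij; rewrite (stalk_triv ij x) mh0. Qed.

Lemma st_in_out M j i x : st_out M j i (st_in M j i x) = ctr (fun=> M) i j x.
Proof.
case: (eqVneq i j) => [e|ij]; first by subst i; rewrite st_inK ctr_id.
by rewrite st_out0 // ctr_neq.
Qed.

Lemma to_stalk_comm M j X (f : mhom (X j) M) : (forall i x, f (cd X i j x) = 0) ->
  forall i k x, mcomp (st_in M j k) (mcomp f (ctr X k j)) (cd X i k x) =
  cd (stalk M j) i k (mcomp (st_in M j i) (mcomp f (ctr X i j)) x).
Proof.
move=> hf i k x /=; case: (eqVneq k j) => [e|kj].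
  by subst k; rewrite ctr_id hf mh0.
by rewrite ctr_neq // !mh0.
Qed.

Definition to_stalk M j X (f : mhom (X j) M) (h : forall i x, f (cd X i j x) = 0) :
  chmap X (stalk M j) := 
  @ChMap K A X (stalk M j) (fun i => mcomp (st_in M j i) (mcomp f (ctr X i j)))
    (to_stalk_comm h).

Lemma single_degree X j : (forall i, i != j -> trivm (X i)) ->
  exists f : chmap X (stalk (X j) j), forall i, bijm (f i).
Proof.
move=> h; have h' : forall i x, mid (X j) (cd X i j x) = 0.
  move=> i x /=; case: (eqVneq i j) => [e|ij]; last by rewrite (h i ij x) mh0.
  by subst i; rewrite cd_out // addrC -subr_eq subrr eq_sym oner_eq0.
exists (to_stalk h') => i; case: (eqVneq i j) => [e|ij]; last first.
  split=> [x _|y]; first exact: h.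
  by exists 0; rewrite mh0 (stalk_triv ij y).
subst i; split=> [x /= e|y]; last by exists (st_out _ _ _ y); rewrite /= ctr_id st_outK.
by move: (congr1 (st_out (X j) j j) e); rewrite ctr_id st_inK mh0.
Qed.

Lemma stalkm_comm M N j (f : mhom M N) i k x :
  mcomp (st_in N j k) (mcomp f (st_out M j k)) (cd (stalk M j) i k x) =
  cd (stalk N j) i k (mcomp (st_in N j i) (mcomp f (st_out M j i)) x).
Proof. by rewrite /= !mh0. Qed.

Definition stalkm M N j (f : mhom M N) : chmap (stalk M j) (stalk N j) :=
  @ChMap K A (stalk M j) (stalk N j)
    (fun i => mcomp (st_in N j i) (mcomp f (st_out M j i))) (@stalkm_comm M N j f).

Lemma stalk_ses L M N j (f : mhom L M) (g : mhom M N) :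
  mses f g -> cses (stalkm j f) (stalkm j g).
Proof.
move=> [fi gs hx] i; case: (eqVneq i j) => [e|ij]; last first.
  split=> [x _|y|x]; first exact: stalk_triv.
    by exists 0; rewrite mh0 (stalk_triv ij y).
  split=> _; last exact: (stalk_triv ij).
  by exists 0; rewrite mh0 (stalk_triv ij x).
subst i; split=> [x /= e|y|x /=].
- move: (congr1 (st_out M j j) e); rewrite st_inK mh0 => /fi e'.
  by rewrite -[x]st_outK e' mh0.
- have [x xy] := gs (st_out N j j y); exists (st_in M j j x).
  by rewrite /= st_inK xy st_outK.
- split=> [e|[y <-]]; last by rewrite st_inK (hx _).2 ?mh0 //; exists (st_out L j j y).
  have /hx[y yx] : g (st_out M j j x) = 0.
    by rewrite -[g _](st_inK j) e mh0.
  by exists (st_in L j j y); rewrite st_inK yx st_outK.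
Qed.

Lemma stalk_cob M j i (x : stalk M j i) : coboundary x -> x = 0.
Proof. by case=> y <-. Qed.

Lemma stalk_acyc M j i : i != j -> acyc (stalk M j) i.
Proof. by move=> ij; apply: triv_acyc; apply: stalk_triv. Qed.

End Truncations.

(** * The derived category: isomorphisms, functors, cohomology, homotopies *)

Local Notation "u =d v" := (deq u v) (at level 70).
Local Notation "v \od u" := (dcomp v u) (at level 40, left associativity).

#[global] Hint Resolve deq_refl : core.

Section Derived.
Context {K : fieldType} {A : falgType K}.
Implicit Types L M N : rmodule A.
Implicit Types X Y Z W : cpx A.
Implicit Types i j k : int.


#[global] Instance deq_equiv X Y : RelationClasses.Equivalence (@deq K A X Y).
Proof. split; [exact: deq_refl|exact: deq_sym|exact: deq_trans]. Qed.

#[global] Instance dcomp_proper X Y Z :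
  Morphisms.Proper
    (Morphisms.respectful (@deq K A Y Z)
      (Morphisms.respectful (@deq K A X Y) (@deq K A X Z)))
    (@dcomp K A X Y Z).
Proof. by move=> v v' hv u u' hu; apply: deq_congr. Qed.

(** For the formal inverse of [s], replace [0] by [s 0] and cancel [s]. *)
Lemma dcomp0r X Y Z (v : dmor Y Z) : v \od dzero X Y =d dzero X Z.
Proof.
have dq0 Y' Z' (f : chmap Y' Z') : dq f \od dzero X Y' =d dzero X Z'.
  by rewrite /dzero -deq_comp; apply: deq_ext => i x /=; rewrite mh0.
elim: v X dq0 => {Y Z} [Y Z f|Z Y s hs|Y Z W w IHw v IHv] X dq0.
- exact: dq0.
- by rewrite -(dq0 _ _ s) deq_assoc deq_invl deq_idl.
- by rewrite -deq_assoc IHv // IHw.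
Qed.

Lemma dcomp0l X Y Z (u : dmor X Y) : dzero Y Z \od u =d dzero X Z.
Proof.
have dq0 X' Y' (f : chmap X' Y') : dzero Y' Z \od dq f =d dzero X' Z.
  by rewrite /dzero -deq_comp; apply: deq_ext.
elim: u Z dq0 => {X Y} [X Y f|Y X s hs|X Y W v IHv u IHu] Z dq0.
- exact: dq0.
- by rewrite -(dq0 _ _ s) -deq_assoc deq_invr deq_idr.
- by rewrite deq_assoc IHv // IHu.
Qed.

Lemma disinv_qis X Y (f : chmap X Y) : quasi_iso f -> disinv (dq f).
Proof. by move=> hf; exists (dinv hf); split; [apply: deq_invl|apply: deq_invr]. Qed.

Lemma disinv_comp X Y Z (v : dmor Y Z) (u : dmor X Y) :
  disinv v -> disinv u -> disinv (v \od u).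
Proof.
move=> [v' [v1 v2]] [u' [u1 u2]]; exists (u' \od v'); split.
  by rewrite -deq_assoc (deq_assoc u) v1 deq_idl.
by rewrite -deq_assoc (deq_assoc v') u2 deq_idl.
Qed.

Lemma disinv_cancelr X Y Z (s : dmor X Y) (u v : dmor Y Z) : disinv s ->
  u \od s =d v \od s -> u =d v.
Proof.
by move=> [s' [_ h]] e; rewrite -(deq_idr u) -(deq_idr v) -h !deq_assoc e.
Qed.

Lemma disinv_cancell X Y Z (s : dmor Y Z) (u v : dmor X Y) : disinv s ->
  s \od u =d s \od v -> u =d v.
Proof.
by move=> [s' [h _]] e; rewrite -(deq_idl u) -(deq_idl v) -h -!deq_assoc e.
Qed.

Lemma diso_qis X Y (f : chmap X Y) : quasi_iso f -> diso X Y.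
Proof. by move=> hf; exists (dq f); apply: disinv_qis. Qed.

Lemma diso_refl X : diso X X.
Proof. exact: (diso_qis (qis_id X)). Qed.
Lemma diso_sym X Y : diso X Y -> diso Y X.
Proof. by move=> [u [v [h1 h2]]]; exists v, u. Qed.
Lemma diso_trans Y X Z : diso X Y -> diso Y Z -> diso X Z.
Proof. by move=> [u hu] [v hv]; exists (v \od u); apply: disinv_comp. Qed.

Definition homz X Y := forall u : dmor X Y, u =d dzero X Y.

Lemma homz_iso X X' Y Y' : diso X X' -> diso Y Y' -> homz X Y -> homz X' Y'.
Proof.
move=> [a ha] [b hb] h u; case: (hb) => b' [_ bb'].
apply: (disinv_cancelr ha); rewrite dcomp0l -(deq_idl (u \od a)) -bb' -deq_assoc.
by rewrite (h (b' \od (u \od a))) dcomp0r.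
Qed.

Lemma dhom_neq0P X Y : dhom_neq0 X Y <-> ~ homz X Y.
Proof.
split=> [[u hu] h|h]; first exact: hu.
by apply: contrapT => h'; apply: h => u; apply: contrapT => hu; apply: h'; exists u.
Qed.

Lemma homz_zerol X Y : dzero_obj X -> homz X Y.
Proof. by move=> h u; rewrite -(deq_idr u) h dcomp0r. Qed.
Lemma homz_zeror X Y : dzero_obj Y -> homz X Y.
Proof. by move=> h u; rewrite -(deq_idl u) h dcomp0l. Qed.

(** The zero endomorphism is a quasi-isomorphism, hence an invertible idempotent. *)
Lemma acyc_dzero X : (forall i, acyc X i) -> dzero_obj X.
Proof.
move=> h; have q : quasi_iso (cm_zero X X) by apply: acyc_qis.
apply: (disinv_cancelr (disinv_qis q)).
by rewrite -deq_comp -deq_comp; apply: deq_ext.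
Qed.

(** * Functors on the derived category *)

(** As morphisms of the derived category are formal composites, a functor on
    complexes that preserves quasi-isomorphisms extends to them by recursion. *)
Record qfunctor := QFunctor {
  qf_obj :> cpx A -> cpx A;
  qf_map : forall X Y, chmap X Y -> chmap (qf_obj X) (qf_obj Y);
  qf_id : forall X i x, qf_map (cm_id X) i x = x;
  qf_comp : forall X Y Z (g : chmap Y Z) (f : chmap X Y) i x,
    qf_map (cm_comp g f) i x = qf_map g i (qf_map f i x);
  qf_ext : forall X Y (f g : chmap X Y), (forall i x, f i x = g i x) ->
    forall i x, qf_map f i x = qf_map g i x;
  qf_qis : forall X Y (f : chmap X Y), quasi_iso f -> quasi_iso (qf_map f)
}.

Fixpoint dfun (F : qfunctor) X Y (u : dmor X Y) : dmor (F X) (F Y) :=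
  match u with
  | dq _ _ f => dq (qf_map F f)
  | dinv _ _ s hs => dinv (qf_qis F hs)
  | dcomp _ _ _ v u => dcomp (dfun F v) (dfun F u)
  end.

Lemma dfun_deq (F : qfunctor) X Y (u v : dmor X Y) : u =d v -> dfun F u =d dfun F v.
Proof.
elim=> {X Y u v} /=.
- by [].
- by move=> X Y u v _ ->.
- by move=> X Y u v w _ -> _ ->.
- by move=> X Y Z u u' v v' _ -> _ ->.
- by move=> X Y Z W u v w; rewrite deq_assoc.
- by move=> X Y u; rewrite -[X in _ =d X]deq_idl; apply: deq_congr => //;
    apply: deq_ext => i x /=; rewrite qf_id.
- by move=> X Y u; rewrite -[X in _ =d X]deq_idr; apply: deq_congr => //;
    apply: deq_ext => i x /=; rewrite qf_id.
- by move=> X Y f g h; apply/deq_ext/qf_ext.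
- move=> X Y Z f g; rewrite -deq_comp; apply: deq_ext => i x; exact: qf_comp.
- by move=> X Y s hs; rewrite deq_invl; apply: deq_ext => i x /=; rewrite qf_id.
- by move=> X Y s hs; rewrite deq_invr; apply: deq_ext => i x /=; rewrite qf_id.
Qed.

Lemma dfun_inv (F : qfunctor) X Y (u : dmor X Y) : disinv u -> disinv (dfun F u).
Proof.
have idE Z : dfun F (did Z) =d did (F Z).
  by apply: deq_ext => i x /=; rewrite qf_id.
move=> [v [/(dfun_deq F) /= h1 /(dfun_deq F) /= h2]].
by exists (dfun F v); rewrite -!idE.
Qed.

Lemma dfun_iso (F : qfunctor) X Y : diso X Y -> diso (F X) (F Y).
Proof. by move=> [u hu]; exists (dfun F u); apply: dfun_inv. Qed.

(** Naturality for chain maps implies it for their formal inverses. *)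
Lemma dfun_nat (F : qfunctor) (t : forall X, chmap X (F X)) :
  (forall X Y (f : chmap X Y) i x, qf_map F f i (t X i x) = t Y i (f i x)) ->
  forall X Y (u : dmor X Y), dfun F u \od dq (t X) =d dq (t Y) \od u.
Proof.
move=> nt X Y; elim=> {X Y} [X Y f|X Y s hs|X Y Z v IHv u IHu] /=.
- by rewrite -!deq_comp; apply: deq_ext => i x; apply: nt.
- apply: (disinv_cancell (disinv_qis (qf_qis F hs))).
  rewrite deq_assoc deq_invr deq_idl deq_assoc.
  have -> : dq (qf_map F s) \od dq (t X) =d dq (t Y) \od dq s.
    by rewrite -!deq_comp; apply: deq_ext => i x; apply: nt.
  by rewrite -deq_assoc deq_invr deq_idr.
- by rewrite -deq_assoc IHu deq_assoc IHv -deq_assoc.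
Qed.

Definition tgeF k : qfunctor.
Proof.
exists (tge k) (@tgem K A k) => [X i x|X Y Z g f i x|X Y f g h i x|X Y f].
- by have [y <-] := tge_prS x; rewrite tgemE.
- by have [y <-] := tge_prS x; rewrite !tgemE.
- by have [y <-] := tge_prS x; rewrite !tgemE h.
- exact: tgem_qis.
Defined.

Lemma tge_nat k X Y (u : dmor X Y) :
  dfun (tgeF k) u \od dq (tge_pr k X) =d dq (tge_pr k Y) \od u.
Proof. by apply: (@dfun_nat (tgeF k) (tge_pr k)) => *; apply: tgemE. Qed.

(** By naturality of the truncation such a map factors through [tge k X], which is
    a zero object. *)
Lemma homz_trunc k X Y : (forall i, k <= i -> acyc X i) ->
  (forall i, i < k -> acyc Y i) -> homz X Y.
Proof.
move=> hX hY u; apply: (disinv_cancell (disinv_qis (tge_pr_qis hY))).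
have z : dzero_obj (tge k X).
  apply: acyc_dzero => i; case: (leP k i) => [/hX|]; first exact: tge_acyc.
  by move=> /tge_triv/triv_acyc; apply.
by rewrite -tge_nat (homz_zerol z (dfun (tgeF k) u)) dcomp0l dcomp0r.
Qed.

(** * Cohomology *)

Definition zmod X i := subm (coc_submod X i).
Definition zinc X i : mhom (zmod X i) (X i) := sub_inc (coc_submod X i).

Lemma zcob_submod X i : is_submod (fun z : zmod X i => coboundary (zinc X i z)).
Proof.
have [h0 hP hA] := cob_submod X i.
by split=> [|k x y hx hy|x a hx]; rewrite ?mh0 ?mh_lin ?mh_act; auto.
Qed.

Definition hmod X i := quom (zcob_submod X i).
Definition hcls X i : mhom (zmod X i) (hmod X i) := quo_pr (zcob_submod X i).

Lemma zincI X i : injm (zinc X i).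
Proof. exact: sub_inc_inj. Qed.
Lemma zincP X i (x : X i) : cocycle x <-> exists z, zinc X i z = x.
Proof. exact: (sub_incP (coc_submod X i)). Qed.
Lemma zinc_coc X i z : cocycle (zinc X i z).
Proof. by apply/zincP; exists z. Qed.
Lemma hclsS X i : surjm (hcls X i).
Proof. exact: quo_pr_surj. Qed.
Lemma hclsP X i z : coboundary (zinc X i z) <-> hcls X i z = 0.
Proof. exact: (quo_prP (zcob_submod X i)). Qed.

Lemma hmod_triv X i : acyc X i <-> trivm (hmod X i).
Proof.
split=> [h c|h x /zincP[z <-]].
  by have [z <-] := @hclsS _ _ c; apply/hclsP/h/zinc_coc.
by apply/hclsP; apply: h.
Qed.

Definition zmap X Y (f : chmap X Y) i : mhom (zmod X i) (zmod Y i) :=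
  mlift (zinc Y i) (mcomp (f i) (zinc X i)).

Lemma zmapE X Y (f : chmap X Y) i z : zinc Y i (zmap f i z) = f i (zinc X i z).
Proof.
rewrite mliftE //; first exact: zincI.
by move=> y; apply/zincP/cm_coc/zinc_coc.
Qed.

Definition hmap X Y (f : chmap X Y) i : mhom (hmod X i) (hmod Y i) :=
  mdesc (hcls X i) (mcomp (hcls Y i) (zmap f i)).

Lemma hmapE X Y (f : chmap X Y) i z : hmap f i (hcls X i z) = hcls Y i (zmap f i z).
Proof.
rewrite mdescE //; first exact: hclsS.
by move=> y /hclsP h; apply/hclsP; rewrite zmapE; apply: cm_cob.
Qed.

Lemma hmap_ext X Y (f g : chmap X Y) : (forall i x, f i x = g i x) ->
  forall i c, hmap f i c = hmap g i c.
Proof.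
move=> h i c; have [z <-] := @hclsS _ _ c; rewrite !hmapE; congr (hcls Y i _).
by apply: (injmP (@zincI Y i)); rewrite !zmapE h.
Qed.

Lemma hmap_comp X Y Z (g : chmap Y Z) (f : chmap X Y) i c :
  hmap (cm_comp g f) i c = hmap g i (hmap f i c).
Proof.
have [z <-] := @hclsS _ _ c; rewrite !hmapE; congr (hcls _ i _).
by apply: (injmP (@zincI Z i)); rewrite !zmapE.
Qed.

Lemma hmap_id X i c : hmap (cm_id X) i c = c.
Proof.
have [z <-] := @hclsS _ _ c; rewrite !hmapE; congr (hcls _ i _).
by apply: (injmP (@zincI X i)); rewrite !zmapE.
Qed.

Lemma hmap_qis X Y (f : chmap X Y) i : quasi_iso f -> bijm (hmap f i).
Proof.
move=> hf; have [fi fs] := hf i; split=> c; have [z <-] := @hclsS _ _ c.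
  rewrite hmapE => /hclsP; rewrite zmapE => h; apply/hclsP.
  by apply: fi => //; apply: zinc_coc.
have [x /zincP[w <-] h] := fs _ (zinc_coc z); exists (hcls X i w).
apply/esym/eqP; rewrite -subr_eq0 hmapE -mhB; apply/eqP/hclsP.
by rewrite mhB zmapE.
Qed.

Fixpoint dhmap X Y (u : dmor X Y) i : mhom (hmod X i) (hmod Y i) :=
  match u with
  | dq _ _ f => hmap f i
  | dinv _ _ s _ => minv (hmap s i)
  | dcomp _ _ _ v u => mcomp (dhmap v i) (dhmap u i)
  end.

Lemma dhmap_deq X Y (u v : dmor X Y) : u =d v -> forall i c, dhmap u i c = dhmap v i c.
Proof.
elim=> {X Y u v} //=.
- by move=> X Y u v w _ h _ h' i c; rewrite h h'.
- by move=> X Y Z u u' v v' _ h _ h' i c; rewrite h h'.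
- by move=> X Y u i c; rewrite hmap_id.
- by move=> X Y u i c; rewrite hmap_id.
- exact: hmap_ext.
- by move=> X Y Z f g i c; rewrite hmap_comp.
- by move=> X Y s hs i c; rewrite minvKl ?hmap_id //; apply: hmap_qis.
- by move=> X Y s hs i c; rewrite minvK ?hmap_id //; apply: hmap_qis.
Qed.

(** Cohomology inverts quasi-isomorphisms, so it is a functor on the derived
    category. *)
Lemma diso_hmod X Y i : diso X Y -> miso (hmod X i) (hmod Y i).
Proof.
move=> [u [v [/dhmap_deq h1 /dhmap_deq h2]]]; exists (dhmap u i); split.
  by move=> c e; have := h1 i c; rewrite /= e mh0 hmap_id.
by move=> c; exists (dhmap v i c); have := h2 i c; rewrite /= hmap_id.
Qed.

Lemma diso_acyc X Y i : diso X Y -> acyc X i -> acyc Y i.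
Proof.
move=> /(diso_hmod i)[f [fi fs]] /hmod_triv h; apply/hmod_triv => c.
by have [d <-] := fs c; rewrite (h d) mh0.
Qed.

Lemma dzeroP X : dzero_obj X <-> forall i, acyc X i.
Proof.
split=> [h i|]; last exact: acyc_dzero.
apply/hmod_triv => c; have := dhmap_deq h c; rewrite /= hmap_id => ->.
have [z <-] := @hclsS _ _ c; rewrite hmapE; apply/hclsP; rewrite zmapE /=.
exact: cob0.
Qed.

Lemma diso_zero X Y : dzero_obj X -> dzero_obj Y -> diso X Y.
Proof.
move=> /dzeroP hX /dzeroP hY; apply: (@diso_qis _ _ (cm_zero X Y)).
exact: acyc_qis.
Qed.

(** * Homotopies *)

(** The degrees [j = i - 1] and [k = i + 1] are variables subject to equations, so
    that the identity can be used with any presentation of them. *)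
Definition homotopic X Y (f g : chmap X Y) :=
  exists h : forall i j, mhom (X i) (Y j), forall i j k x, i = j + 1 -> k = i + 1 ->
    f i x - g i x = cd Y j i (h i j x) + h k i (cd X i k x).

Lemma mk_chmap_comm X Y (f : forall i, mhom (X i) (Y i)) :
  (forall i x, f (i + 1) (cd X i (i + 1) x) = cd Y i (i + 1) (f i x)) ->
  forall i j x, f j (cd X i j x) = cd Y i j (f i x).
Proof.
move=> h i j x; case: (eqVneq j (i + 1)) => [e|e]; first by subst j.
by rewrite !cd_out // mh0.
Qed.

Definition mk_chmap X Y (f : forall i, mhom (X i) (Y i))
  (h : forall i x, f (i + 1) (cd X i (i + 1) x) = cd Y i (i + 1) (f i x)) :
  chmap X Y := ChMap (mk_chmap_comm h).

Section Cylinder.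
Context (X : cpx A).

Lemma antidiag_comm i j (x : X i) :
  mpair (mid (X j)) (mopp (mid (X j))) (cd X i j x) =
  cd (csum X X) i j (mpair (mid (X i)) (mopp (mid (X i))) x).
Proof. by apply: pair_ext => //=; rewrite mhN. Qed.

(** The cylinder of [X] as the cone of the antidiagonal [X -> X (+) X]. *)
Definition antidiag : chmap X (csum X X) :=
  @ChMap K A X (csum X X) (fun i => mpair (mid (X i)) (mopp (mid (X i)))) antidiag_comm.
Definition cyl := ccone antidiag.

(** A homotopy from [f] to [g] is a map from the cylinder restricting to [f] and
    [g] on its ends. *)
Lemma cyl_map_comm Y (f g : chmap X Y) (h : forall i j, mhom (X i) (Y j)) :
  (forall i j k x, i = j + 1 -> k = i + 1 ->
    f i x - g i x = cd Y j i (h i j x) + h k i (cd X i k x)) ->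
  let m i : mhom (cyl i) (Y i) := madd (mcomp (h (i + 1) i) (mfst _ _))
    (madd (mcomp (f i) (mcomp (mfst _ _) (msnd _ _)))
          (mcomp (g i) (mcomp (msnd _ _) (msnd _ _)))) in
  forall i x, m (i + 1) (cd cyl i (i + 1) x) = cd Y i (i + 1) (m i x).
Proof.
move=> hh m i [z [a b]]; rewrite /m /= !ctr_id /= !mhD !mhN !cm_comm.
have /eqP := hh (i + 1) i (i + 1 + 1) z erefl erefl.
rewrite -subr_eq => /eqP <-.
zmod.
Qed.

Definition cyl_map Y (f g : chmap X Y) h hh : chmap cyl Y :=
  mk_chmap (@cyl_map_comm Y f g h hh).

Lemma cyl_map_id_homotopy i j k x : i = j + 1 -> k = i + 1 ->
  cm_id X i x - cm_id X i x =
  cd X j i (mzero (X i) (X j) x) + mzero (X k) (X i) (cd X i k x).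
Proof. by move=> _ _; rewrite subrr mh0 addr0. Qed.

Definition cyl_pr : chmap cyl X := cyl_map cyl_map_id_homotopy.

Lemma cyl_pr_qis : quasi_iso cyl_pr.
Proof.
move=> i; have [j ->] := int_succ i; split.
  move=> [z [a b]] /cone_coc[/= cz [e1 e2]] /cobS[t]; rewrite add0r => tE.
  apply/cone_cob; exists a, (0, t); split; first exact: addr0_oppr e1.
  by apply: pair_ext; rewrite /= ?mh0 ?addr0 // tE addKr.
move=> y cy; exists (0, (y, 0)).
  apply/cone_coc; split; first exact: mh0.
  by apply: pair_ext; rewrite /= ?oppr0 ?mh0 add0r.
by rewrite /= add0r addr0 subrr; apply: cob0.
Qed.

Lemma cyl_in0_comm i (x : X i) : let m i : mhom (X i) (cyl i) :=
    mpair (mzero _ _) (mpair (mid (X i)) (mzero _ _)) in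
  m (i + 1) (cd X i (i + 1) x) = cd cyl i (i + 1) (m i x).
Proof.
apply: pair_ext; rewrite /= ?mh0 ?oppr0 // ctr_id.
by apply: pair_ext; rewrite /= ?oppr0 ?mh0 add0r.
Qed.

Lemma cyl_in1_comm i (x : X i) : let m i : mhom (X i) (cyl i) :=
    mpair (mzero _ _) (mpair (mzero _ _) (mid (X i))) in
  m (i + 1) (cd X i (i + 1) x) = cd cyl i (i + 1) (m i x).
Proof.
apply: pair_ext; rewrite /= ?mh0 ?oppr0 // ctr_id.
by apply: pair_ext; rewrite /= ?oppr0 ?mh0 add0r.
Qed.

Definition cyl_in0 : chmap X cyl := mk_chmap cyl_in0_comm.
Definition cyl_in1 : chmap X cyl := mk_chmap cyl_in1_comm.

End Cylinder.

(** The two ends of the cylinder are sections of the same quasi-isomorphism,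
    hence equal in the derived category. *)
Lemma homotopic_deq X Y (f g : chmap X Y) : homotopic f g -> dq f =d dq g.
Proof.
move=> [h hh].
have e : dq (cyl_in0 X) =d dq (cyl_in1 X).
  apply: (disinv_cancell (disinv_qis (@cyl_pr_qis X))).
  by rewrite -!deq_comp; apply: deq_ext => i x /=; rewrite !add0r addr0.
have -> : dq f =d dq (cyl_map hh) \od dq (cyl_in0 X).
  by rewrite -deq_comp; apply: deq_ext => i x /=; rewrite !mh0 add0r addr0.
by rewrite e -deq_comp; apply: deq_ext => i x /=; rewrite !mh0 !add0r.
Qed.

Lemma homotopic_refl X Y (f g : chmap X Y) : (forall i x, f i x = g i x) -> homotopic f g.
Proof.
move=> e; exists (fun i j => mzero _ _) => i j k x _ _.
by rewrite e subrr mh0 addr0.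
Qed.

Lemma homotopic_sym X Y (f g : chmap X Y) : homotopic f g -> homotopic g f.
Proof.
move=> [h hh]; exists (fun i j => mopp (h i j)) => i j k x ij ki.
by rewrite -opprB (hh i j k x ij ki) /= mhN opprD.
Qed.

Lemma homotopic_trans X Y (f g e : chmap X Y) :
  homotopic f g -> homotopic g e -> homotopic f e.
Proof.
move=> [h hh] [h' hh']; exists (fun i j => madd (h i j) (h' i j)) => i j k x ij ki.
rewrite -(subrKA (g i x)) (hh i j k x ij ki) (hh' i j k x ij ki) /= mhD.
by rewrite addrACA.
Qed.

Lemma homotopic_compl X Y Z (u : chmap Y Z) (f g : chmap X Y) :
  homotopic f g -> homotopic (cm_comp u f) (cm_comp u g).
Proof.
move=> [h hh]; exists (fun i j => mcomp (u j) (h i j)) => i j k x ij ki /=.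
by rewrite -mhB (hh i j k x ij ki) mhD cm_comm.
Qed.

End Derived.

(** * Partial projective resolutions compute morphisms *)

Section Resolutions.
Context {K : fieldType} {A : falgType K}.
Implicit Types L M N P : rmodule A.
Implicit Types X Y Z W Q E : cpx A.
Implicit Types i j k l : int.


Lemma proj_lift P M N (d : mhom M N) (f : mhom P N) : projective P ->
  (forall x, exists y, d y = f x) -> exists g : mhom P M, forall x, d (g x) = f x.
Proof.
move=> hP h; pose I := im_submod d.
pose d' := mlift (sub_inc I) d; pose f' := mlift (sub_inc I) f.
have dE y : sub_inc I (d' y) = d y.
  apply: mliftE; first exact: sub_inc_inj.
  by move=> x; apply/(sub_incP I); exists x.
have fE y : sub_inc I (f' y) = f y.
  apply: mliftE; first exact: sub_inc_inj.
  by move=> x; apply/(sub_incP I).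
have [|g hg] := hP _ _ d' f'; last by exists g => x; rewrite -dE hg fE.
move=> y; have [x xy] := sub_incS y; exists x.
by apply: (injmP (@sub_inc_inj _ _ _ _ I)); rewrite dE.
Qed.

(** A complex that is projective in all degrees at least [k] behaves as a
    projective resolution towards complexes that vanish below [k]. This avoids
    unbounded complexes. *)
Definition kproj k Q := forall i, k <= i -> projective (Q i).
Definition lives k X := forall i, i < k -> trivm (X i).

Lemma lives_le k l X : l <= k -> lives k X -> lives l X.
Proof. by move=> lk h i il; apply: h; apply: lt_le_trans lk. Qed.

Lemma kproj_le k l X : l <= k -> kproj l X -> kproj k X.
Proof. by move=> lk h i ki; apply: h; apply: le_trans ki. Qed.

Lemma cpx_bounds X : exists n : nat, forall i, (i < - n%:Z) || (n%:Z < i) -> trivm (X i).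
Proof.
have [n hn] := c_bounded X; exists n => i hi x; apply: hn; move: hi; lia.
Qed.

Lemma lives_ex X : exists k, lives k X.
Proof. by have [n hn] := cpx_bounds X; exists (- n%:Z) => i h; apply: hn; rewrite h. Qed.

(** The homotopy is built by descending induction on the degree: at each step the
    error is a map to cocycles, that is to coboundaries, and projectivity lifts
    it. In degree [k] the coboundaries of [E] vanish, whence [k + 1]. *)
Lemma acyclic_null k Q E (f : chmap Q E) : kproj (k + 1) Q -> lives k E ->
  (forall i, acyc E i) -> homotopic f (cm_zero Q E).
Proof.
move=> hQ hE aE; have [N hN] := cpx_bounds Q.
have claim (n : nat) : exists h : forall i j, mhom (Q i) (E j),
    forall i j l x, N%:Z - n%:Z < i -> i = j + 1 -> l = i + 1 ->
      f i x = cd E j i (h i j x) + h l i (cd Q i l x).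
  elim: n => [|n [h hh]].
    exists (fun i j => mzero _ _) => i j l x ni _ _.
    by rewrite (hN i _ x) ?mh0 ?addr0 //; move: ni; lia.
  pose i0 := N%:Z - n%:Z.
  pose phi := madd (f i0) (mopp (mcomp (h (i0 + 1) i0) (cd Q i0 (i0 + 1)))).
  have phi_cob x : coboundary (phi x).
    apply: aE; rewrite /cocycle /= mhD mhN -cm_comm.
    rewrite (hh (i0 + 1) i0 (i0 + 1 + 1)) //; last by rewrite /i0; lia.
    by rewrite cdd mh0 addr0 subrr.
  have [g hg] : exists g : mhom (Q i0) (E (i0 - 1)), forall x, cd E (i0 - 1) i0 (g x) = phi x.
    case: (leP (k + 1) i0) => ki; first by apply: proj_lift => //; apply: hQ.
    exists (mzero _ _) => x; have [y <-] := phi_cob x.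
    by rewrite (hE (i0 - 1) _ y) //; move: ki; lia.
  exists (fun i j => if i == i0 then mcomp (ctr E (i0 - 1) j) (mcomp g (ctr Q i i0))
                     else h i j) => i j l x ni ij li.
  have -> : (l == i0) = false by apply/eqP; move: ni; rewrite /i0; lia.
  case: eqP => [e|ne]; last by apply: hh => //; move: ni ne; rewrite /i0; lia.
  have {ij} ej : j = i0 - 1 by rewrite -e ij addrK.
  by subst j l i; rewrite /= !ctr_id hg /= subrK.
have [h hh] := claim (absz (N%:Z - k + 1)); exists h => i j l x ij li.
rewrite /= subr0; case: (ltP i k) => ik; first by rewrite (hE i ik (f i x)) (hE i ik (_ + _)).
by apply: hh => //; move: ik; lia.
Qed.

Lemma cone_lives k X Y (f : chmap X Y) : lives k X -> lives k Y -> lives (k - 1) (ccone f).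
Proof.
move=> hX hY i ik [x y].
by rewrite (hX (i + 1) _ x) ?(hY i _ y) //; move: ik; lia.
Qed.

Lemma cone_in_comm X Y (f : chmap X Y) i j (y : Y i) :
  mpair (mzero (Y j) (X (j + 1))) (mid (Y j)) (cd Y i j y) =
  cd (ccone f) i j (mpair (mzero (Y i) (X (i + 1))) (mid (Y i)) y).
Proof. by apply: pair_ext; rewrite /= ?mh0 ?oppr0 // add0r. Qed.

Definition cone_in X Y (f : chmap X Y) : chmap Y (ccone f) :=
  @ChMap K A Y (ccone f) (fun i => mpair (mzero (Y i) (X (i + 1))) (mid (Y i)))
    (cone_in_comm f).

(** The two components of a null-homotopy of the composite with the inclusion into
    the cone are the lift and the homotopy that relates it to [g']. *)
Lemma cone_null_lift Q Y Y' (s : chmap Y Y') (g' : chmap Q Y') :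
  homotopic (cm_comp (cone_in s) g') (cm_zero Q (ccone s)) ->
  exists g : chmap Q Y, homotopic (cm_comp s g) g'.
Proof.
move=> [h hh]; pose g i := mcomp (ctr Y (i - 1 + 1) i) (mcomp (mfst _ _) (h i (i - 1))).
have gE j x : g (j + 1) x = (h (j + 1) j x).1.
  rewrite /g /=; have : j + 1 - 1 = j by rewrite addrK.
  by move: (j + 1 - 1) => j' e; subst j'; rewrite ctr_id.
clearbody g; have eqs j (x : Q (j + 1)) : let a := h (j + 1) j x in
    let b := h (j + 1 + 1) (j + 1) (cd Q (j + 1) (j + 1 + 1) x) in
    cd Y (j + 1) (j + 1 + 1) a.1 = b.1 /\
    g' (j + 1) x - s (j + 1) a.1 = cd Y' j (j + 1) a.2 + b.2.
  have e := hh (j + 1) j (j + 1 + 1) x erefl erefl; split.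
    by have := congr1 fst e; rewrite /= subr0 => /esym/addr0_oppl; rewrite opprK.
  have /= := congr1 snd e; rewrite subr0 ctr_id => ->.
  zmod.
have gc i x : g (i + 1) (cd Q i (i + 1) x) = cd Y i (i + 1) (g i x).
  have [j e] := int_succ i; subst i; rewrite !gE; by have [-> _] := eqs j x.
exists (mk_chmap gc); apply: homotopic_sym.
exists (fun i j => mcomp (msnd _ _) (h i j)) => i j l x ij li; subst l i.
by rewrite /= gE; have [_ ->] := eqs j x.
Qed.

Lemma qis_lift k Q Y Y' (s : chmap Y Y') (g' : chmap Q Y') : kproj k Q ->
  lives k Y -> lives k Y' -> quasi_iso s ->
  exists g : chmap Q Y, homotopic (cm_comp s g) g'.
Proof.
move=> hQ hY hY' hs; apply/cone_null_lift/(@acyclic_null (k - 1)).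
- by rewrite subrK.
- exact: cone_lives.
- exact: (qis_cone_acyc hs).
Qed.

(** The homotopy makes [(g1 - g2, - h)] a map from the shift of [Q] to the acyclic
    cone of [s]; it is null-homotopic, and the first component of a homotopy is, up to
    sign, a homotopy from [g1] to [g2]. *)
Lemma qis_inj k Q Y Y' (s : chmap Y Y') (g1 g2 : chmap Q Y) : kproj k Q ->
  lives k Y -> lives k Y' -> quasi_iso s ->
  homotopic (cm_comp s g1) (cm_comp s g2) -> homotopic g1 g2.
Proof.
move=> hQ hY hY' hs [h hh].
pose c i : mhom (cshift Q i) (ccone s i) :=
  mpair (madd (g1 (i + 1)) (mopp (g2 (i + 1)))) (mopp (h (i + 1) i)).
have cc i x : c (i + 1) (cd (cshift Q) i (i + 1) x) = cd (ccone s) i (i + 1) (c i x).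
  apply: pair_ext; rewrite /= ?ctr_id !mhN ?mhB.
    by rewrite opprD !cm_comm.
  have /= := hh (i + 1) i (i + 1 + 1) x erefl erefl; rewrite -mhB => e.
  by rewrite e; zmod.
have [|||H hH] := @acyclic_null (k - 1) (cshift Q) (ccone s) (mk_chmap cc).
- by rewrite subrK => i ki; apply: hQ; move: ki; lia.
- exact: cone_lives.
- exact: (qis_cone_acyc hs).
pose G i j : mhom (Q i) (Y j) := mopp (mcomp (ctr Y (j - 1 + 1) j)
  (mcomp (mfst _ _) (mcomp (H (i - 1) (j - 1)) (ctr Q i (i - 1 + 1))))).
have GE i j (x : Q (i + 1)) : G (i + 1) (j + 1) x = - (H i j x).1.
  rewrite /G /=; have : j + 1 - 1 = j by rewrite addrK.
  have : i + 1 - 1 = i by rewrite addrK.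
  by move: (j + 1 - 1) (i + 1 - 1) => j' i' e e'; subst j' i'; rewrite !ctr_id.
clearbody G; exists G => i j l x ij li; have [j' e] := int_succ j; subst j i l.
rewrite !GE; have /(congr1 fst) /= := hH (j' + 1) j' (j' + 1 + 1) x erefl erefl.
by rewrite subr0 !mhN => ->.
Qed.

(** The action of a morphism [X -> Y] of the derived category on homotopy classes
    of maps from a fixed complex to the truncations, as a relation.
    After truncation, maps from [Q] lift along the quasi-isomorphisms that a formal
    composite inverts. *)
Section Action.
Context (k : int) (Q : cpx A) (hQ : kproj k Q).

Fixpoint act X Y (u : dmor X Y) : chmap Q (tge k X) -> chmap Q (tge k Y) -> Prop :=
  match u with
  | dq _ _ f => fun e g => homotopic (cm_comp (tgem k f) e) g
  | Defs.dinv _ _ s _ => fun e g => homotopic (cm_comp (tgem k s) g) e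
  | dcomp _ _ _ v u => fun e g => exists2 g', act u e g' & act v g' g
  end.

Lemma tge_lives X : lives k (tge k X).
Proof. by move=> i; apply: tge_triv. Qed.

Lemma act_total X Y (u : dmor X Y) e : exists g, act u e g.
Proof.
elim: u e => {X Y} [X Y f|X Y s hs|X Y Z v IHv u IHu] e /=.
- by exists (cm_comp (tgem k f) e); apply: homotopic_refl.
- by apply: (@qis_lift k) => //; [exact: tge_lives|exact: tge_lives|exact: tgem_qis].
- by have [g' h'] := IHu e; have [g h] := IHv g'; exists g, g'.
Qed.

Lemma act_homotopic X Y (u : dmor X Y) e e' g g' :
  homotopic e e' -> homotopic g g' -> act u e g -> act u e' g'.
Proof.
elim: u e e' g g' => {X Y} [X Y f|X Y s hs|X Y Z v IHv u IHu] e e' g g' he hg /=.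
- move=> h; apply: homotopic_trans hg; apply: homotopic_trans h.
  by apply/homotopic_compl/homotopic_sym.
- move=> h; apply: homotopic_trans he; apply: homotopic_trans h.
  by apply/homotopic_compl/homotopic_sym.
- case=> w hw hv; exists w; first by apply: IHu hw => //; apply: homotopic_refl.
  by apply: IHv hv => //; apply: homotopic_refl.
Qed.

Lemma act_uniq X Y (u : dmor X Y) e e' g g' :
  homotopic e e' -> act u e g -> act u e' g' -> homotopic g g'.
Proof.
elim: u e e' g g' => {X Y} [X Y f|X Y s hs|X Y Z v IHv u IHu] e e' g g' he /=.
- move=> h h'; apply: homotopic_trans h'; apply: homotopic_trans (homotopic_sym h) _.
  exact: homotopic_compl.
- move=> h h'; apply: (@qis_inj k _ _ _ (tgem k s)) => //; try exact: tge_lives.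
    exact: tgem_qis.
  by apply: homotopic_trans h _; apply: homotopic_trans he (homotopic_sym h').
- by move=> [w hw hv] [w' hw' hv']; apply: (IHv w w') => //; apply: (IHu e e').
Qed.

Lemma tgem_ext X Y (f g : chmap X Y) : (forall i x, f i x = g i x) ->
  forall i x, tgem k f i x = tgem k g i x.
Proof. by move=> h i x; exact: (@qf_ext K A (tgeF k) X Y f g h i x). Qed.
Lemma tgem_id X i x : tgem k (cm_id X) i x = x.
Proof. exact: (@qf_id K A (tgeF k) X i x). Qed.
Lemma tgem_comp X Y Z (g : chmap Y Z) (f : chmap X Y) i x :
  tgem k (cm_comp g f) i x = tgem k g i (tgem k f i x).
Proof. exact: (@qf_comp K A (tgeF k) X Y Z g f i x). Qed.

(** Each generating relation of the derived category is checked with existence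
    and uniqueness of lifts along quasi-isomorphisms. *)
Lemma act_deq X Y (u v : dmor X Y) : u =d v -> forall e g, act u e g <-> act v e g.
Proof.
elim=> {X Y u v} //=.
- by move=> X Y u v _ h e g; rewrite h.
- by move=> X Y u v w _ h _ h' e g; rewrite h h'.
- by move=> X Y Z u u' v v' _ h _ h' e g; split=> -[w /h hw /h' hv]; exists w.
- move=> X Y Z W u v w e g; split=> [[a [b hb ha] hw]|[b hb [a ha hw]]].
    by exists b => //; exists a.
  by exists a => //; exists b.
- move=> X Y u e g; split=> [[w hw h]|h].
    apply: act_homotopic hw; first exact: homotopic_refl.
    by apply: homotopic_trans h; apply: homotopic_refl => i x; rewrite /= tgem_id.
  by exists g => //; apply: homotopic_refl => i x; rewrite /= tgem_id.
- move=> X Y u e g; split=> [[w hw h]|h].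
    apply: act_homotopic h; last exact: homotopic_refl.
    apply: homotopic_trans (homotopic_sym hw) _.
    by apply: homotopic_refl => i x; rewrite /= tgem_id.
  by exists e => //; apply: homotopic_refl => i x; rewrite /= tgem_id.
- move=> X Y f g h e d; have E := homotopic_refl (f := cm_comp (tgem k f) e)
    (g := cm_comp (tgem k g) e) (fun i x => tgem_ext h (e i x)).
  by split=> h'; apply: homotopic_trans h' => //; apply: homotopic_sym.
- move=> X Y Z f g e d; split=> [h|[w hw h]].
    exists (cm_comp (tgem k f) e); first exact: homotopic_refl.
    by apply: homotopic_trans h; apply: homotopic_refl => i x; rewrite /= tgem_comp.
  apply: homotopic_trans h; apply: homotopic_trans (homotopic_compl (tgem k g) hw).
  by apply: homotopic_refl => i x; rewrite /= tgem_comp.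
- move=> X Y s hs e g.
  have E : homotopic (cm_comp (tgem k (cm_id X)) e) e.
    by apply: homotopic_refl => i x; rewrite /= tgem_id.
  split=> [[w hw h]|h].
    apply: homotopic_trans E _; apply: homotopic_sym.
    apply: (@qis_inj k _ _ _ (tgem k s)) => //; try exact: tge_lives; first exact: tgem_qis.
    by apply: homotopic_trans h (homotopic_sym hw).
  exists (cm_comp (tgem k s) e); first exact: homotopic_refl.
  apply: homotopic_compl; apply: homotopic_trans (homotopic_sym h) E.
- move=> X Y s hs e g.
  have E : homotopic (cm_comp (tgem k (cm_id Y)) e) e.
    by apply: homotopic_refl => i x; rewrite /= tgem_id.
  split=> [[w hw h]|h].
    by apply: homotopic_trans E _; apply: homotopic_trans (homotopic_sym hw) h.
  have [w hw] := act_total (dinv hs) e; exists w => //=.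
  by apply: homotopic_trans hw _; apply: homotopic_trans (homotopic_sym E) h.
Qed.

Lemma act_sound X Y (u : dmor X Y) e g : act u e g ->
  dq g =d dfun (tgeF k) u \od dq e.
Proof.
elim: u e g => {X Y} [X Y f|X Y s hs|X Y Z v IHv u IHu] e g /=.
- by move/homotopic_deq => <-; rewrite deq_comp.
- move/homotopic_deq => <-; rewrite deq_comp deq_assoc deq_invl deq_idl.
  by [].
- by case=> w /IHu hw /IHv ->; rewrite hw deq_assoc.
Qed.

End Action.

Lemma cm_inv_ex X Y (f : chmap X Y) : (forall i, bijm (f i)) ->
  exists g : chmap Y X, forall i y, f i (g i y) = y.
Proof.
move=> hf; have c i j y : minv (f j) (cd Y i j y) = cd X i j (minv (f i) y).
  by apply: (injmP (hf j).1); rewrite cm_comm !minvK.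
by exists (ChMap c) => i y; rewrite /= minvK.
Qed.

(** Acting on the projection of [Q] to its truncation gives a chain map to the
    truncation of [W], which is [W]. *)
Lemma kproj_rep k Q W (u : dmor Q W) : kproj k Q -> lives k W ->
  exists g : chmap Q W, u =d dq g.
Proof.
move=> hQ hW; have [g /act_sound hg] := act_total hQ u (tge_pr k Q).
have [r hr] := cm_inv_ex (tge_pr_bij hW); exists (cm_comp r g).
apply: (disinv_cancell (disinv_qis (bij_qis (tge_pr_bij hW)))).
by rewrite -tge_nat -hg -deq_comp; apply: deq_ext => i x; rewrite /= hr.
Qed.

(** The relation [act] recovers a chain map up to homotopy from its class in the
    derived category, as [W] agrees with its truncation. *)
Lemma kproj_deq k Q W (g g' : chmap Q W) : kproj k Q -> lives k W ->
  dq g =d dq g' -> homotopic g g'.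
Proof.
move=> hQ hW /(act_deq hQ) h; have [r hr] := cm_inv_ex (tge_pr_bij hW).
have hr' i (x : W i) : r i (tge_pr k W i x) = x.
  by apply: (injmP (tge_pr_bij hW i).1); rewrite hr.
pose e := tge_pr k Q.
have /(act_uniq hQ (homotopic_refl (fun i x => erefl (e i x)))) :
    act (dq g') e (cm_comp (tgem k g) e) by apply/h/homotopic_refl.
move/(_ (cm_comp (tgem k g') e) (homotopic_refl (fun _ _ => erefl))) /(homotopic_compl r) => H.
have E (f : chmap Q W) : homotopic f (cm_comp r (cm_comp (tgem k f) e)).
  by apply: homotopic_refl => i x; rewrite /= tgemE hr'.
exact: homotopic_trans (E g) (homotopic_trans H (homotopic_sym (E g'))).
Qed.

Lemma kproj_homz k Q W : kproj k Q -> lives k W ->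
  homz Q W <-> forall g : chmap Q W, homotopic g (cm_zero Q W).
Proof.
move=> hQ hW; split=> h g; first exact: kproj_deq hQ hW (h (dq g)).
by have [f ->] := kproj_rep g hQ hW; apply: homotopic_deq.
Qed.

End Resolutions.

(** * Partial projective resolutions *)

Section PartialResolutions.
Context {K : fieldType} {A : falgType K}.
Implicit Types L M N P : rmodule A.
Implicit Types X Y Z W Q R E F : cpx A.
Implicit Types i j k l : int.


Lemma ctr_cd X i j k (x : X i) : j = k -> ctr X j k (cd X i j x) = cd X i k x.
Proof. by move=> e; subst k; rewrite ctr_id. Qed.

Lemma ctr_const M j k x : j = k -> ctr (fun=> M) j k x = x.
Proof. by move=> e; subst k; rewrite ctr_id. Qed.

(** One step of the resolution. Given a surjection [p : P -> X^k], the term [X^k]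
    is replaced by [P] and [X^(k-1)] by the fibre product of [X^(k-1)] and [P]
    over [X^k]. The result is a subcomplex of the sum of [X] and of the cone of
    the identity of [P] placed in degree [k]. *)
Section Step.
Context (X : cpx A) (k : int) (P : rmodule A) (p : mhom P (X k)).

Let D := ccone (cm_id (stalk P k)).
Let C := csum X D.
Let out1 i : mhom (C i) P :=
  mcomp (st_out P k (i + 1)) (mcomp (mfst _ _) (msnd (X i) (D i))).
Let out2 i : mhom (C i) P :=
  mcomp (st_out P k i) (mcomp (msnd _ _) (msnd (X i) (D i))).
Let fstX i : mhom (C i) (X i) := mfst (X i) (D i).

(** In the notation of [stepSE], [x = p b] in degree [k], [d x = p a] in degree
    [k - 1], and both conditions are void in the other degrees. *)
Definition stepS i (z : C i) : Prop :=
  madd (mcomp (ctr X i k) (fstX i)) (mopp (mcomp p (out2 i))) z = 0 /\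
  madd (mcomp (cd X i k) (fstX i)) (mopp (mcomp p (out1 i))) z = 0.

Lemma stepSE i (x : X i) (a : stalk P k (i + 1)) (b : stalk P k i) :
  stepS (i := i) (x, (a, b)) <->
  ctr X i k x = p (st_out P k i b) /\ cd X i k x = p (st_out P k (i + 1) a).
Proof.
rewrite /stepS /=; split=> -[e1 e2]; split; try (by apply/eqP; rewrite -subr_eq0 ?e1 ?e2).
  by rewrite e1 subrr.
by rewrite e2 subrr.
Qed.

Lemma step_subcpx : is_subcpx stepS.
Proof.
split=> [i|i j [x [a b]] /stepSE[e1 e2]]; first by apply: cap_submod; apply: ker_submod.
case: (eqVneq j (i + 1)) => [e|e]; last by rewrite cd_out //; apply: ism0;
  apply: cap_submod; apply: ker_submod.
subst j; apply/stepSE; rewrite /= ctr_id addr0 oppr0 cdd !mh0; split=> //.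
rewrite -e2; case: (eqVneq (i + 1) k) => [e|e]; first exact: ctr_cd.
by rewrite ctr_neq // cd_out // eq_sym.
Qed.

Definition stepC := csub step_subcpx.

Lemma step_comm i j (x : stepC i) :
  mcomp (fstX j) (csub_inc step_subcpx j) (cd stepC i j x) =
  cd X i j (mcomp (fstX i) (csub_inc step_subcpx i) x).
Proof.
by rewrite -[LHS]/(fstX j (csub_inc step_subcpx j (cd stepC i j x))) cm_comm.
Qed.

Definition step_pr : chmap stepC X :=
  @ChMap K A stepC X (fun i => mcomp (fstX i) (csub_inc step_subcpx i)) step_comm.

Lemma step_prE i y x a b : csub_inc step_subcpx i y = (x, (a, b)) -> step_pr i y = x.
Proof. by move=> e; rewrite -[LHS]/(fstX i (csub_inc step_subcpx i y)) e. Qed.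

(** The projection to [X] is surjective, with kernel the disc on [ker p]. *)
Lemma step_qis : surjm p -> quasi_iso step_pr.
Proof.
move=> hp i; have [j e] := int_succ i; subst i; split.
  move=> y cy /cobS[w wE]; case yE: (csub_inc step_subcpx (j + 1) y) => [x [a b]].
  have /stepSE[e1 e2] : stepS (i := j + 1) (x, (a, b)).
    by rewrite -yE; apply: csub_incS.
  rewrite (step_prE yE) in wE.
  have a0 : a = 0.
    have /(congr1 (fun z => z.2.2)) : cd C (j + 1) (j + 1 + 1) (x, (a, b)) = 0.
      by rewrite -yE -cm_comm cy mh0.
    by rewrite /= ctr_id addr0.
  have [q qE] := hp (ctr X j k w).
  have /(csub_incP step_subcpx)[v vE] : stepS (i := j) (w, (b, st_in P k j q)).
    apply/stepSE; split.
      case: (eqVneq j k) => [e|ne]; last by rewrite ctr_neq // st_out0 // mh0.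
      by rewrite st_in_out ctr_const // qE.
    rewrite -e1 -wE; case: (eqVneq (j + 1) k) => [e|e]; first by rewrite ctr_cd.
    by rewrite ctr_neq // cd_out // eq_sym.
  apply/cobS; exists v; apply: (injmP (@csub_inc_inj _ _ _ _ step_subcpx (j + 1))).
  rewrite cm_comm vE yE a0 -wE; apply: pair_ext => //=; apply: pair_ext => /=.
    by rewrite oppr0.
  by rewrite ctr_id addr0.
move=> x cx; have [q qE] := hp (ctr X (j + 1) k x).
have /(csub_incP step_subcpx)[v vE] : stepS (i := j + 1) (x, (0, st_in P k (j + 1) q)).
  apply/stepSE; split; last by rewrite (cocP cx) !mh0.
  case: (eqVneq (j + 1) k) => [e|ne]; last by rewrite ctr_neq // st_out0 // mh0.
  by rewrite st_in_out ctr_const // qE.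
exists v; last by rewrite (step_prE vE) subrr; apply: cob0.
apply: (@csub_inc_inj _ _ _ _ step_subcpx); rewrite cm_comm vE.
by apply: pair_ext => //=; apply: pair_ext; rewrite /= ?mh0 ?oppr0 ?addr0.
Qed.

Lemma step_elt i (y : stepC i) : exists x a b,
  [/\ csub_inc step_subcpx i y = (x, (a, b)), ctr X i k x = p (st_out P k i b)
    & step_pr i y = x].
Proof.
have [[x [a b]] yE] : exists z, csub_inc step_subcpx i y = z.
  by exists (csub_inc step_subcpx i y).
exists x, a, b; split=> //; last exact: step_prE yE.
have /stepSE[] // : stepS (i := i) (x, (a, b)).
by rewrite -yE; apply: csub_incS.
Qed.

Definition step_out i : mhom (stepC i) P := mcomp (out2 i) (csub_inc step_subcpx i).

Lemma step_outE i y x a b : csub_inc step_subcpx i y = (x, (a, b)) ->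
  step_out i y = st_out P k i b.
Proof. by move=> e; rewrite -[LHS]/(out2 i (csub_inc step_subcpx i y)) e. Qed.

Lemma step_out_bij i : i = k -> bijm (step_out i).
Proof.
move=> ik; have ne : i + 1 != k by rewrite ik -subr_eq0 addrAC subrr add0r.
split=> [y|q].
  have [x [a [b [yE e _]]]] := step_elt y; rewrite (step_outE yE) => b0.
  apply: (@csub_inc_inj _ _ _ _ step_subcpx i); rewrite yE.
  have -> : b = 0 by rewrite -[b]st_outK b0 mh0.
  have -> : x = 0 by move: e; rewrite b0 mh0; move: (k) ik => l il; subst l; rewrite ctr_id.
  by rewrite (stalk_triv ne a).
have [x xE] : exists x, ctr X i k x = p q.
  by exists (ctr X k i (p q)); move: (p q); move: (k) ik => l il; subst l => z; rewrite !ctr_id.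
have /(csub_incP step_subcpx)[y yE] : stepS (i := i) (x, (0, st_in P k i q)).
  by apply/stepSE; rewrite xE st_in_out ctr_const // cd_out 1?eq_sym // !mh0.
by exists y; rewrite (step_outE yE) st_in_out ctr_const.
Qed.

Lemma step_pr_bij i : k < i -> bijm (step_pr i).
Proof.
move=> ki; have ne : i != k by rewrite gt_eqF.
have ne' : i + 1 != k by rewrite gt_eqF // ltr_wpDr.
split=> [y|x].
  have [x [a [b [yE _ ->]]]] := step_elt y => x0.
  apply: (@csub_inc_inj _ _ _ _ step_subcpx i); rewrite yE x0.
  by rewrite (stalk_triv ne b) (stalk_triv ne' a).
have /(csub_incP step_subcpx)[y yE] : stepS (i := i) (x, (0, 0)).
  by apply/stepSE; rewrite ctr_neq // cd_out ?mh0 // eq_sym.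
by exists y; rewrite (step_prE yE).
Qed.

Lemma step_kproj : kproj (k + 1) X -> projective P -> kproj k stepC.
Proof.
move=> hX hP i ki; case: (eqVneq i k) => [e|ne].
  exact: (bij_proj (bij_minv (step_out_bij e))).
have ki' : k < i by rewrite lt_neqAle eq_sym ne.
apply: (bij_proj (bij_minv (step_pr_bij ki'))); apply: hX.
by move: ki'; lia.
Qed.

End Step.

(** The steps are made in descending degrees, starting above the top of [X]. *)
Lemma kproj_res X k : exists Q (s : chmap Q X), quasi_iso s /\ kproj k Q.
Proof.
suff H (n : nat) (Y : cpx A) : kproj (k + n%:Z) Y ->
    exists Q (s : chmap Q Y), quasi_iso s /\ kproj k Q.
  have [n hn] := cpx_bounds X; apply: (H (absz (n%:Z + 1 - k)%R) X) => i ki.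
  by apply/trivm_proj/hn; move: ki; lia.
elim: n Y => [|n IH] Y hY.
  by exists Y, (cm_id Y); split; [exact: qis_id|rewrite addr0 in hY].
have [P [p [hP hp]]] := proj_cover (Y (k + n%:Z)).
have [|Q [s [hs hQ]]] := IH (stepC p).
  apply: step_kproj => //.
  by move: hY; rewrite -addn1 PoszD addrA.
exists Q, (cm_comp (step_pr p) s); split=> //.
by apply: qis_comp => //; apply: step_qis.
Qed.

(** * Triangles and vanishing of morphisms *)

(** The triangles of the derived category, without the maps. *)
Definition tri X Y F := exists X' Y' (f : chmap X' Y'),
  [/\ diso X X', diso Y Y' & diso F (ccone f)].

Lemma is_cone_tri X Y F (u : dmor X Y) : is_cone u F -> tri X Y F.
Proof.
by move=> [X' [Y' [f [a [b [ha hb _ hF]]]]]]; exists X', Y', f; split=> //;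
  [exists a|exists b].
Qed.

Lemma tri_is_cone X Y F : tri X Y F -> exists u : dmor X Y, is_cone u F.
Proof.
move=> [X' [Y' [f [[a ha] [b hb] hF]]]]; case: (hb) => b' [b1 b2].
exists (b' \od (dq f \od a)), X', Y', f, a, b; split=> //.
by rewrite deq_assoc b2 deq_idl.
Qed.

Lemma tri_iso X X' Y Y' F F' : diso X X' -> diso Y Y' -> diso F F' ->
  tri X Y F -> tri X' Y' F'.
Proof.
move=> hX hY hF [X1 [Y1 [f [h1 h2 h3]]]]; exists X1, Y1, f; split.
- exact: diso_trans (diso_sym hX) h1.
- exact: diso_trans (diso_sym hY) h2.
- exact: diso_trans (diso_sym hF) h3.
Qed.

Lemma cses_tri X Y Z (f : chmap X Y) (g : chmap Y Z) : cses f g -> tri X Y Z.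
Proof.
move=> s; exists X, Y, f; split; try exact: diso_refl.
exact: diso_sym (diso_qis (cses_qis s)).
Qed.

(** Chain maps from a partial resolution [Q] of [W] to [Y] become null-homotopic in
    the cone, hence lift to [X] up to homotopy, where they are null-homotopic. *)
Lemma homz_cone_r W X Y (f : chmap X Y) : homz W X -> homz W (ccone f) -> homz W Y.
Proof.
move=> hX hF; have [k1 l1] := lives_ex X; have [k2 l2] := lives_ex Y.
pose k := Num.min k1 k2; have lX : lives k X by apply: lives_le l1; rewrite ge_min lexx.
have lY : lives k Y by apply: lives_le l2; rewrite ge_min lexx orbT.
have lF := @cone_lives _ _ k X Y f lX lY.
have le : k - 1 <= k by rewrite gerBl.
have [Q [s [hs hQ]]] := kproj_res W (k - 1).
have sW := diso_sym (diso_qis hs).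
apply: (homz_iso (diso_qis hs) (diso_refl Y)).
have hQ' : kproj k Q by apply: kproj_le hQ.
apply/(kproj_homz hQ' lY) => g.
have /(kproj_homz hQ lF) h := homz_iso sW (diso_refl _) hF.
have /(kproj_homz hQ' lX) h' := homz_iso sW (diso_refl _) hX.
have [g1 hg1] := cone_null_lift (h (cm_comp (cone_in f) g)).
apply: homotopic_trans (homotopic_sym hg1) _.
apply: homotopic_trans (homotopic_compl f (h' g1)) _.
by apply: homotopic_refl => i x /=; rewrite mh0.
Qed.

(** The homotopy is the component of the extension on the shift of [X]. *)
Lemma cone_out_ex X Y W (f : chmap X Y) (g : chmap Y W) :
  homotopic (cm_comp g f) (cm_zero X W) ->
  exists g' : chmap (ccone f) W, forall i y, g' i (cone_in f i y) = g i y.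
Proof.
move=> [h hh].
pose m i : mhom (ccone f i) (W i) :=
  madd (mcomp (g i) (msnd _ _)) (mcomp (h (i + 1) i) (mfst _ _)).
have mc i x : m (i + 1) (cd (ccone f) i (i + 1) x) = cd W i (i + 1) (m i x).
  case: x => x y; rewrite /m /= ctr_id !mhD mhN !cm_comm.
  have /= := hh (i + 1) i (i + 1 + 1) x erefl erefl; rewrite subr0 => ->.
  zmod.
by exists (mk_chmap mc) => i y; rewrite /= mh0 addr0.
Qed.

(** The five lemma for a square of quasi-isomorphisms commuting up to homotopy. *)
Lemma cone_map_qis X Y X' Y' (f : chmap X Y) (f' : chmap X' Y')
    (r : chmap X X') (e : chmap Y Y') :
  quasi_iso r -> quasi_iso e -> homotopic (cm_comp e f) (cm_comp f' r) ->
  exists m : chmap (ccone f) (ccone f'), quasi_iso m.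
Proof.
move=> hr he [h hh].
have hE j (x : X (j + 1)) : e (j + 1) (f (j + 1) x) =
    f' (j + 1) (r (j + 1) x) + (cd Y' j (j + 1) (h (j + 1) j x) +
    h (j + 1 + 1) (j + 1) (cd X (j + 1) (j + 1 + 1) x)).
  by rewrite -(hh _ _ _ _ erefl erefl) /=; zmod.
pose m i : mhom (ccone f i) (ccone f' i) :=
  mpair (mcomp (r (i + 1)) (mfst _ _))
        (madd (mcomp (e i) (msnd _ _)) (mcomp (h (i + 1) i) (mfst _ _))).
have mc i x : m (i + 1) (cd (ccone f) i (i + 1) x) = cd (ccone f') i (i + 1) (m i x).
  case: x => x y; apply: pair_ext; rewrite /= ?ctr_id !mhN ?mhD cm_comm // hE.
  zmod.
exists (mk_chmap mc) => i; have [j e0] := int_succ i; subst i; split.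
  move=> [x y] /cone_coc[/= cx exy] /cone_cob[x' [y' [/= ex' ey']]].
  have [ri rs] := hr (j + 1 + 1); have [ri' rs'] := hr (j + 1).
  have [ei es] := he (j + 1).
  have /ri/cobS[//|x0 x0E] : coboundary (r (j + 1 + 1) x).
    by apply/cobS; exists (- x'); rewrite mhN.
  have cd1 : cocycle (- r (j + 1) x0 - x').
    by rewrite /cocycle mhB mhN -cm_comm x0E -ex'; zmod.
  have [x2 cx2 /cobS[t tE]] := rs' _ cd1.
  pose x3 := - x0 - x2.
  have x3E : cd X (j + 1) (j + 1 + 1) x3 = - x by rewrite mhB cx2 subr0 mhN x0E.
  have rx3 : r (j + 1) x3 = x' + cd X' j (j + 1) t.
    by rewrite tE mhB mhN; zmod.
  clearbody x3; have cy3 : cocycle (y - f (j + 1) x3).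
    by rewrite /cocycle mhB -cm_comm x3E mhN opprK; apply: etrans (addrC _ _) exy.
  have /ei/cobS[//|y1 y1E] : coboundary (e (j + 1) (y - f (j + 1) x3)).
    apply/cobS; exists (y' - f' j t - h (j + 1) j x3).
    rewrite !mhB hE x3E mhN rx3 mhD cm_comm.
    have -> : e (j + 1) y = f' (j + 1) x' + cd Y' j (j + 1) y' - h (j + 1 + 1) (j + 1) x.
      by rewrite ey' addrK.
    zmod.
  apply/cone_cob; exists x3, y1; rewrite /= x3E opprK y1E; split=> //.
  zmod.
move=> [x' y'] /cone_coc[/= cx' exy'].
have [ri rs] := hr (j + 1 + 1); have [ei es] := he (j + 1); have [ei' es'] := he (j + 1 + 1).
have [x cx /cobS[t tE]] := rs _ cx'.
have rx : r (j + 1 + 1) x = x' - cd X' (j + 1) (j + 1 + 1) t.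
  by rewrite tE; zmod.
have dy' := addr0_oppr exy'.
have /ei'/cobS[|y0 y0E] : coboundary (e (j + 1 + 1) (f (j + 1 + 1) x)).
  apply/cobS; exists (- y' - f' (j + 1) t + h (j + 1 + 1) (j + 1) x).
  by rewrite hE cx mh0 addr0 rx mhB cm_comm mhD mhB mhN dy'.
- exact: cm_coc.
pose z := y' + f' (j + 1) t - h (j + 1 + 1) (j + 1) x + e (j + 1) y0.
have cz : cocycle z.
  rewrite /cocycle /z mhD mhB mhD -[cd Y' _ _ (e _ _)]cm_comm y0E hE cx mh0 addr0 rx mhB.
  rewrite -dy' !cm_comm -[cd Y' _ _ y']opprK.
  zmod.
have [y2 cy2 /cobS[q qE]] := es _ cz.
exists (x, y2 - y0).
  apply/cone_coc; split=> //=.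
  by rewrite mhB y0E cy2 sub0r subrr.
apply/cone_cob; exists (- t), q; rewrite /= !mhN opprK; split=> //.
rewrite qE /z mhB.
zmod.
Qed.

(** Lift [f] to a map [f'] between partial resolutions [R] and [Q] of [X] and [Y],
    the first one being projective far enough below. A map from [Q] to [W] is
    null-homotopic on [R], hence extends to the cone of [f'], which is
    quasi-isomorphic to the cone of [f]. *)
Lemma homz_cone_l W X Y (f : chmap X Y) : homz X W -> homz (ccone f) W -> homz Y W.
Proof.
move=> hX hF; have [k lW] := lives_ex W.
have [Q [e [he hQ]]] := kproj_res Y k.
have [k1 l1] := lives_ex Q; have [k2 l2] := lives_ex Y.
pose k' := Num.min k (Num.min k1 k2).
have lQ : lives k' Q by apply: lives_le l1; rewrite !ge_min lexx orbT.
have lY : lives k' Y by apply: lives_le l2; rewrite !ge_min lexx !orbT.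
have lW' : lives k' W by apply: lives_le lW; rewrite !ge_min lexx.
have [R [r [hr hR]]] := kproj_res X k'.
have [f' hf'] := qis_lift (cm_comp f r) hR lQ lY he.
have [m hm] := cone_map_qis hr he hf'.
apply: (homz_iso (diso_qis he) (diso_refl W)) => u.
have [g ->] := kproj_rep u hQ lW.
have /(kproj_homz hR lW') h := homz_iso (diso_sym (diso_qis hr)) (diso_refl W) hX.
have [g' hg'] := cone_out_ex (h (cm_comp g f')).
have -> : dq g =d dq g' \od dq (cone_in f').
  by rewrite -deq_comp; apply: deq_ext => i x; rewrite /= -hg'.
have hF' := homz_iso (diso_sym (diso_qis hm)) (diso_refl W) hF.
by rewrite (hF' (dq g')) dcomp0l.
Qed.

Lemma homz_tri_r W X Y F : tri X Y F -> homz W X -> homz W F -> homz W Y.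
Proof.
move=> [X' [Y' [f [hX hY hF]]]] h1 h2.
apply: (homz_iso (diso_refl W) (diso_sym hY)).
by apply: (homz_cone_r (f := f)); [apply: homz_iso h1|apply: homz_iso h2] => //;
  apply: diso_refl.
Qed.

Lemma homz_tri_l W X Y F : tri X Y F -> homz X W -> homz F W -> homz Y W.
Proof.
move=> [X' [Y' [f [hX hY hF]]]] h1 h2.
apply: (homz_iso (diso_sym hY) (diso_refl W)).
by apply: (homz_cone_l (f := f)); [apply: homz_iso h1|apply: homz_iso h2] => //;
  apply: diso_refl.
Qed.

(** * The shift *)

Lemma shift_coc X i (x : cshift X i) : cocycle x <-> cocycle (x : X (i + 1)).
Proof. by split=> [/eqP|/eqP]; rewrite /cocycle /= ?oppr_eq0 => /eqP // ->; rewrite oppr0. Qed.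

Lemma shift_cob X i (x : cshift X i) : coboundary x <-> coboundary (x : X (i + 1)).
Proof.
rewrite cobS; split=> [/cobP[j [y <-]]|[y <-]].
  case: (eqVneq i (j + 1)) => [e|e].
    by subst i; exists (- y); rewrite mhN.
  by exists 0; rewrite mh0 /= cd_out ?oppr0 // (inj_eq (addIr _)).
have [j e] := int_succ i; subst i; apply/cobS.
by exists (- y : X (j + 1)); rewrite /= mhN opprK.
Qed.

Lemma cshiftm_comm X Y (f : chmap X Y) i j (x : cshift X i) :
  f (j + 1) (cd (cshift X) i j x) = cd (cshift Y) i j (f (i + 1) x).
Proof. by rewrite /= mhN cm_comm. Qed.

Definition cshiftm X Y (f : chmap X Y) : chmap (cshift X) (cshift Y) :=
  @ChMap K A (cshift X) (cshift Y) (fun i => f (i + 1)) (cshiftm_comm f).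

Definition cshiftF : qfunctor (A := A).
Proof.
exists (@cshift K A) cshiftm => // [X Y f g h i x|X Y f hf i]; first exact: h.
have [fi fs] := hf (i + 1); split=> [x /shift_coc cx /shift_cob h|y /shift_coc/fs[x cx h]].
  by apply/shift_cob/fi.
by exists x; [apply/shift_coc|apply/shift_cob].
Defined.

(** The cone of a shifted map and the shifted cone are identified by a sign on the
    first component. *)
Lemma tri_shift X Y F : tri X Y F -> tri (cshift X) (cshift Y) (cshift F).
Proof.
move=> [X' [Y' [f [hX hY hF]]]]; exists (cshift X'), (cshift Y'), (cshiftm f).
split; [exact: (dfun_iso cshiftF)|exact: (dfun_iso cshiftF)|].
apply: diso_trans (dfun_iso cshiftF hF) _.
pose m i : mhom (cshift (ccone f) i) (ccone (cshiftm f) i) :=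
  mpair (mopp (mfst (X' (i + 1 + 1)) (Y' (i + 1)))) (msnd _ _).
have mc i x : m (i + 1) (cd (cshift (ccone f)) i (i + 1) x) =
    cd (ccone (cshiftm f)) i (i + 1) (m i x).
  case: x => x y; apply: pair_ext; rewrite /= ?mhN ?opprK ?ctr_id //.
  by rewrite opprD.
apply: (@diso_qis _ _ _ _ (mk_chmap mc)); apply: bij_qis => i; split.
  by move=> [x y] /= [/eqP + ->]; rewrite oppr_eq0 => /eqP ->.
by move=> [x y]; exists (- x, y); rewrite /= opprK.
Qed.

End PartialResolutions.

(** * Ext groups as morphisms in the derived category *)

Section Ext.
Context {K : fieldType} {A : falgType K}.
Implicit Types L M N : rmodule A.
Implicit Types X Y Z W Q R E F : cpx A.
Implicit Types i j k l : int.


Section Resolution.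
Context (M : rmodule A) (P : proj_resolution M) (a : int) (n : nat).

(** The terms of the resolution indexed by integers, so that the transports
    [ctr] apply: [P p] is [G p] by computation. *)
Let G (u : int) : rmodule A := P (absz u).

Let pd (u v : int) : mhom (G u) (G v) :=
  match v return mhom (G u) (G v) with
  | Posz q => mcomp (pr_d P q) (ctr G u (Posz q.+1))
  | Negz q => mzero _ _
  end.

Lemma pd_out u v x : u != v + 1 -> pd u v x = 0.
Proof.
case: v => [q|//] h; rewrite /pd /= ctr_neq ?mh0 //.
by apply: contraNneq h => ->; rewrite -PoszD addn1.
Qed.

Lemma pdd u v w x : pd v w (pd u v x) = 0.
Proof.
case: w => [q|//]; rewrite /=; case: (eqVneq v (Posz q.+1)) => [e|ne]; last first.
  by rewrite ctr_neq // mh0.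
by subst v; rewrite ctr_id /=; apply/(pr_exact (p := P)); exists (ctr G u (Posz q.+2) x).
Qed.

Let inr i := (a - n%:Z <= i) && (i <= a).

Definition brut_obj i : rmodule A := if inr i then G (a - i) else zmodule.

Definition brut_in i : mhom (G (a - i)) (brut_obj i) :=
  match inr i as b return mhom (G (a - i)) (if b then G (a - i) else zmodule) with
  | true => mid _
  | false => mzero _ _
  end.

Definition brut_out i : mhom (brut_obj i) (G (a - i)) :=
  match inr i as b return mhom (if b then G (a - i) else zmodule) (G (a - i)) with
  | true => mid _
  | false => mzero _ _
  end.

Lemma brut_outK i x : brut_in i (brut_out i x) = x.
Proof.
move: x; rewrite /brut_in /brut_out /brut_obj; case: (inr i) => // x.
by rewrite (zmodule_triv x).
Qed.

Lemma brut_inK i x : inr i -> brut_out i (brut_in i x) = x.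
Proof. by rewrite /brut_in /brut_out /brut_obj => ->. Qed.

Lemma brut_triv i : ~~ inr i -> trivm (brut_obj i).
Proof. by rewrite /brut_obj => /negPf ->; apply: zmodule_triv. Qed.

Definition brut_d i j : mhom (brut_obj i) (brut_obj j) :=
  mcomp (brut_in j) (mcomp (pd (a - i) (a - j)) (brut_out i)).

Lemma brut_d_out i j x : j != i + 1 -> brut_d i j x = 0.
Proof.
move=> ne; rewrite -[LHS]/(brut_in j (pd (a - i) (a - j) (brut_out i x))).
rewrite pd_out ?mh0 //; apply: contraNneq ne => e; apply/eqP; move: e; lia.
Qed.

Lemma brut_dd i j k x : brut_d j k (brut_d i j x) = 0.
Proof.
rewrite -[LHS]/(brut_in k (pd (a - j) (a - k) (brut_out j (brut_in j
  (pd (a - i) (a - j) (brut_out i x)))))).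
case: (boolP (inr j)) => hj; first by rewrite brut_inK // pdd mh0.
by rewrite (brut_triv hj (brut_in j _)) !mh0.
Qed.

Lemma brut_bounded : exists N : nat, forall i (x : brut_obj i), (N < `|i|)%N -> x = 0.
Proof.
exists (absz a + n)%N => i x hi; apply: brut_triv; rewrite /inr; move: hi; lia.
Qed.

(** The brutal truncation of the resolution, the term [P p] sitting in degree
    [a - p]. *)
Definition brut : cpx A := Cpx brut_d_out brut_dd brut_bounded.

Definition bi (p : nat) : mhom (P p) (brut (a - p%:Z)) :=
  mcomp (brut_in (a - p%:Z)) (ctr G p (a - (a - p%:Z))).
Definition bo (p : nat) : mhom (brut (a - p%:Z)) (P p) :=
  mcomp (ctr G (a - (a - p%:Z)) p) (brut_out (a - p%:Z)).

Lemma ctrG_K (u v : int) x : u = v -> ctr G u v (ctr G v u x) = x.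
Proof. by move=> e; subst v; rewrite !ctr_id. Qed.

Lemma bioK p x : bi p (bo p x) = x.
Proof.
rewrite -[LHS]/(brut_in _ (ctr G p (a - (a - p%:Z)) (ctr G (a - (a - p%:Z)) p
  (brut_out (a - p%:Z) x)))).
by rewrite ctrG_K ?brut_outK // opprB addrC subrK.
Qed.

Lemma boiK p x : (p <= n)%N -> bo p (bi p x) = x.
Proof.
move=> pn; rewrite -[LHS]/(ctr G (a - (a - p%:Z)) p (brut_out _ (brut_in (a - p%:Z)
  (ctr G p (a - (a - p%:Z)) x)))).
rewrite brut_inK ?ctrG_K // ?opprB 1?addrC ?subrK //.
by rewrite /inr; move: pn; lia.
Qed.

Lemma brut_cd p x : cd brut (a - p.+1%:Z) (a - p%:Z) x = bi p (pr_d P p (bo p.+1 x)).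
Proof.
rewrite -[LHS]/(brut_in _ (pd (a - (a - p.+1%:Z)) (a - (a - p%:Z)) (brut_out _ x))).
rewrite -[RHS]/(brut_in _ (ctr G p (a - (a - p%:Z)) (pr_d P p
  (ctr G (a - (a - p.+1%:Z)) p.+1 (brut_out _ x))))).
congr (brut_in _ _); move: (brut_out _ x).
have : a - (a - p%:Z) = p by rewrite opprB addrC subrK.
by move: (a - (a - p%:Z)) => v e y; subst v; rewrite ctr_id.
Qed.

Lemma brut_proj i : projective (brut i).
Proof.
rewrite /= /brut_obj; case: (inr i); first exact: pr_proj.
exact/trivm_proj/zmodule_triv.
Qed.

Definition baug : mhom (brut a) M :=
  mcomp (pr_aug P) (mcomp (bo 0) (ctr brut a (a - 0%:Z))).

Lemma baug_d i x : baug (cd brut i a x) = 0.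
Proof.
rewrite -[LHS]/(pr_aug P (bo 0 (ctr brut a (a - 0%:Z) (cd brut i a x)))).
rewrite ctr_cd ?subr0 //; case: (eqVneq i (a - 1%:Z)) => [e|ne].
  subst i; rewrite brut_cd boiK //; apply/(pr_exact0 (p := P)); by exists (bo 1 x).
by rewrite cd_out ?mh0 //; apply: contraNneq ne; lia.
Qed.

Definition baug_map : chmap brut (stalk M a) := to_stalk baug_d.

Lemma deg_le i : i <= a -> exists p : nat, i = a - p%:Z.
Proof. by move=> ia; exists (absz (a - i)%R); lia. Qed.

(** The truncated resolution is exact in degrees above [a - n], where it is the
    resolution. *)
Lemma baug_qis_at i : (0 < n)%N -> a - n%:Z < i -> qis_at baug_map i.
Proof.
move=> n0 ni; case: (eqVneq i a) => [e|ne]; last first.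
  split=> [x cx _|y _]; last first.
    by exists 0; [apply: (ism0 (coc_submod _ _))|rewrite (stalk_triv ne (y - _)); apply: cob0].
  case: (ltP a i) => [ai|ia].
    have ninr : ~~ inr i by rewrite /inr; move: ai; lia.
    by rewrite (brut_triv ninr x); apply: cob0.
  have [p e] := deg_le ia; subst i; case: p ni ne x cx {ia} => [|p] ni ne x cx.
    by rewrite subr0 eqxx in ne.
  have := cocP cx (a - p%:Z); rewrite brut_cd => /(congr1 (bo p)).
  rewrite boiK ?mh0; last by move: ni; lia.
  move=> /(pr_exact (p := P))[y yE]; apply/cobP; exists (a - p.+2%:Z), (bi p.+2 y).
  by rewrite brut_cd boiK ?yE ?bioK //; move: ni; lia.
subst i; have e0 : a = a - 0%:Z by rewrite subr0.
have out x : st_out M a a (baug_map a x) = baug x.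
  by rewrite -[LHS]/(st_out M a a (st_in M a a (baug (ctr brut a a x)))) st_inK ctr_id.
have bo0S (z : P 0) : exists x : brut a, bo 0 (ctr brut a (a - 0%:Z) x) = z.
  exists (ctr brut (a - 0%:Z) a (bi 0 z)).
  have -> : ctr brut a (a - 0%:Z) (ctr brut (a - 0%:Z) a (bi 0 z)) = bi 0 z.
    move: (bi 0 z); move: (a - 0%:Z) e0 => b e; subst b => w; by rewrite !ctr_id.
  exact: boiK.
split=> [x _ /stalk_cob/(congr1 (st_out M a a))|y _].
  rewrite out mh0 -[baug x]/(pr_aug P (bo 0 (ctr brut a (a - 0%:Z) x))).
  move=> /(pr_exact0 (p := P))[y yE]; apply/cobP; exists (a - 1%:Z), (bi 1 y).
  have : cd brut (a - 1%:Z) (a - 0%:Z) (bi 1 y) = ctr brut a (a - 0%:Z) x.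
    by rewrite brut_cd boiK // yE bioK.
  by move: (a - 0%:Z) e0 => b e; subst b; rewrite ctr_id.
have [z zE] := pr_aug_surj P (st_out M a a y); have [x xE] := bo0S z.
exists x.
  apply/eqP; have ninr : ~~ inr (a + 1) by rewrite /inr; lia.
  by apply/eqP; apply: brut_triv.
rewrite -[y](st_outK) -[baug_map a x]st_outK out.
rewrite -[baug x]/(pr_aug P (bo 0 (ctr brut a (a - 0%:Z) x))) xE zE subrr.
exact: cob0.
Qed.

End Resolution.

Lemma sub_zero_eq (V : zmodType) (x y : V) : x - 0 = y -> x = y.
Proof. by rewrite subr0. Qed.

(** This is [Ext^m(M, N) = Hom(M, N[m])]. The truncation [Q] of the resolution with
    terms [0, ..., m + 2] is isomorphic to [M], and projective in the degrees that
    matter for maps to [N] placed in degree [a - m]. A chain map from [Q] is a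
    cocycle on the term [m], and a null-homotopy presents it as a coboundary. *)
Lemma ext_hom M N (P : proj_resolution M) (a : int) (m : nat) :
  homz (stalk M a) (stalk N (a - m%:Z)) <->
  (forall f : mhom (P m) N, ext_cocycle f -> ext_coboundary f).
Proof.
pose n := m.+2; pose k := a - n%:Z + 1; pose B := brut P a n; pose Q := tge k B.
have km : k < a - m%:Z by rewrite /k /n; lia.
have kproj_Q : kproj (a - m%:Z) Q.
  move=> i mi; have ki : k < i by apply: lt_le_trans mi.
  exact: (bij_proj (tge_pr_bij_gt B ki) (@brut_proj M P a n i)).
have lN : lives (a - m%:Z) (stalk N (a - m%:Z)).
  by move=> i im; apply: stalk_triv; rewrite lt_eqF.
have QM : diso Q (stalk M a).
  apply: diso_trans (diso_qis (tgem_qis_at (k := k) (f := baug_map P a n) _)) _.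
    by move=> i ki; apply: baug_qis_at => //; move: ki; rewrite /k; lia.
  apply/diso_sym/(diso_qis (f := tge_pr k (stalk M a)))/tge_pr_qis => i ik.
  by apply: stalk_acyc; move: ik km; lia.
have -> : homz (stalk M a) (stalk N (a - m%:Z)) <-> homz Q (stalk N (a - m%:Z)).
  by split; apply: homz_iso; [exact: diso_sym|exact: diso_refl|exact: QM|exact: diso_refl].
rewrite (kproj_homz kproj_Q lN); split=> [h f cf|h g].
  pose phi := mcomp f (bo P a n m).
  have phid i x : phi (cd B i (a - m%:Z) x) = 0.
    rewrite -[LHS]/(f (bo P a n m (cd B i (a - m%:Z) x))).
    case: (eqVneq i (a - m.+1%:Z)) => [e|ne].
      by subst i; rewrite brut_cd boiK // ltnW.
    by rewrite cd_out ?mh0 //; apply: contraNneq ne; lia.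
  have [|g hg] := @cquo_desc_ex _ _ _ _ (tge_subcpx B k) _ (to_stalk phid).
    move=> i x [h0 _]; case: (eqVneq i (a - m%:Z)) => [e|ne]; last exact: stalk_triv.
    by rewrite h0 ?mh0 // e.
  have fE z : f z = st_out N (a - m%:Z) (a - m%:Z) (g _ (tge_pr k B _ (bi P a n m z))).
    rewrite hg -[X in st_out _ _ _ X]/(st_in N _ _ (phi (ctr B _ (a - m%:Z) (bi P a n m z)))).
    rewrite st_inK ctr_id -[RHS]/(f (bo P a n m (bi P a n m z))) boiK //.
    by rewrite /n; lia.
  have [H hH] := h g; pose j := a - m.+1%:Z.
  have hj : a - m%:Z = j + 1 by rewrite /j; lia.
  (* Coboundaries on the term 0 are defined separately: the vanishing maps. *)
  case: m @n @k @B @Q km kproj_Q lN QM h f cf phi phid g hg fE H hH @j hj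
    => [|m] n k B Q km kproj_Q lN QM h f cf phi phid g hg fE H hH j hj.
    move=> z; rewrite fE (sub_zero_eq (hH _ _ _ (tge_pr k B _ (bi P a n 0 z)) hj erefl)).
    rewrite -cm_comm.
    have h1 : ~~ ((a - n%:Z <= a - 0%:Z + 1) && (a - 0%:Z + 1 <= a)) by lia.
    rewrite (brut_triv h1 (cd B _ _ _)) !mh0.
    exact: (etrans (congr1 (st_out _ _ _) (addr0 _)) (mh0 _)).
  pose l := a - m%:Z; have hl : l = a - m.+1%:Z + 1 by rewrite /l; lia.
  exists (mcomp (st_out N _ _) (mcomp (H l (a - m.+1%:Z)) (mcomp (tge_pr k B l) (bi P a n m)))).
  move=> z; rewrite fE (sub_zero_eq (hH _ _ _ (tge_pr k B _ (bi P a n m.+1 z)) hj hl)).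
  rewrite -cm_comm brut_cd boiK; last by rewrite /n; lia.
  by rewrite [cd (stalk _ _) _ _ _](_ : _ = 0) // add0r.
pose f : mhom (P m) N := mcomp (st_out N (a - m%:Z) (a - m%:Z))
  (mcomp (g (a - m%:Z)) (mcomp (tge_pr k B (a - m%:Z)) (bi P a n m))).
have fE z : f z = st_out N _ _ (g _ (tge_pr k B _ (bi P a n m z))) by [].
have gE x : exists2 z, x = tge_pr k B _ (bi P a n m z) & g _ x = st_in N _ (a - m%:Z) (f z).
  have [y <-] := tge_prS x; exists (bo P a n m y); first by rewrite bioK.
  by rewrite fE bioK st_outK.
clearbody f.
have cf : ext_cocycle f.
  move=> z; rewrite fE -[z](@boiK M P a n) //.
  by rewrite -brut_cd cm_comm cm_comm mh0.
case: m @n @k @B @Q km kproj_Q lN QM h g f fE gE cf (h f cf)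
    => [|m] n k B Q km kproj_Q lN QM h g f fE gE cf /= => [f0|[g0 hg0]].
  apply: homotopic_refl => i x.
  case: (eqVneq i (a - 0%:Z)) => [e|ne]; last exact: (stalk_triv ne).
  by subst i; have [z -> ->] := gE x; rewrite f0 mh0.
pose l := a - m%:Z; have kl : k < l by rewrite /k /l /n; lia.
exists (fun i j => mcomp (st_in N (a - m.+1%:Z) j) (mcomp g0 (mcomp (bo P a n m)
  (mcomp (ctr B i l) (minv (tge_pr k B i)))))) => i j l' x ij li.
case: (eqVneq i (a - m.+1%:Z)) => [e|ne]; last first.
  by rewrite (stalk_triv ne (g i x - _)) (stalk_triv ne (_ + _)).
have ll : l' = l by rewrite li e /l; lia.
clear ij li; subst l' i; have [z -> ->] := gE x.
rewrite subr0 hg0 [cd (stalk _ _) _ _ _](_ : _ = 0) // add0r.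
rewrite -cm_comm.
set w := cd B _ _ _; rewrite -[RHS]/(st_in N _ _ (g0 (bo P a n m (ctr B l l
  (minv (tge_pr k B l) (tge_pr k B l w)))))).
rewrite minvKl; last exact: tge_pr_bij_gt.
by rewrite ctr_id /w brut_cd boiK ?boiK // /n; lia.
Qed.

End Ext.

(** * The Grothendieck group *)

Section Grothendieck.
Context {K : fieldType} {A : falgType K}.
Implicit Types L M N : rmodule A.
Implicit Types X Y Z W Q R E F : cpx A.
Implicit Types i j k l : int.


Lemma stalk_iso M N j : miso M N -> diso (stalk M j) (stalk N j).
Proof.
move=> [f hf]; apply: (@diso_qis _ _ _ _ (stalkm j f)); apply: bij_qis => i.
split=> [x|y].
  move=> /(congr1 (st_out N j i)); rewrite -[stalkm j f i x]/(st_in N j i (f (st_out M j i x))).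
  rewrite mh0 st_in_out; case: (eqVneq i j) => [e|ij]; last by move=> _; apply: stalk_triv.
  by subst i; rewrite ctr_id => /hf.1 e; rewrite -[x]st_outK e mh0.
have [x xy] := hf.2 (st_out N j i y); exists (st_in M j i x).
rewrite -[LHS]/(st_in N j i (f (st_out M j i (st_in M j i x)))).
case: (eqVneq i j) => [e|ij]; first by subst i; rewrite st_inK xy st_outK.
by rewrite (stalk_triv ij (st_in N j i _)) (stalk_triv ij y).
Qed.

Lemma single_stalk X M j : (forall i, i != j -> trivm (X i)) -> miso (X j) M ->
  diso X (stalk M j).
Proof.
move=> h m; have [f /bij_qis/diso_qis hf] := single_degree h.
exact: diso_trans hf (stalk_iso j m).
Qed.

Lemma stalk_obj_iso M j : miso (stalk_obj M j j) M.
Proof.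
exists (st_out M j j); split=> [x e|y]; first by rewrite -[x]st_outK e mh0.
by exists (st_in M j j y); rewrite st_inK.
Qed.

Lemma shift_stalk M j : diso (cshift (stalk M (j + 1))) (stalk M j).
Proof.
apply: single_stalk; last exact: stalk_obj_iso.
by move=> i ij; apply: stalk_triv; rewrite (inj_eq (addIr _)).
Qed.

Definition zcpx : cpx A := stalk zmodule 0.

Lemma zcpx_triv i : trivm (zcpx i).
Proof. by move=> x; rewrite -[x]st_outK (zmodule_triv (st_out _ _ _ x)) mh0. Qed.

Lemma triv_dzero X : (forall i, trivm (X i)) -> dzero_obj X.
Proof. by move=> h; apply: acyc_dzero => i; apply: triv_acyc. Qed.

(** The cone of a map to the zero complex is the shift. *)
Lemma tri_rotate0 X : tri X zcpx (cshift X).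
Proof.
exists X, zcpx, (cm_zero X zcpx); split; try exact: diso_refl.
have c i (x : ccone (cm_zero X zcpx) i) : mfst _ _ (cd (ccone (cm_zero X zcpx)) i (i + 1) x) =
    cd (cshift X) i (i + 1) (mfst (X (i + 1)) (zcpx i) x) by [].
apply/diso_sym/(@diso_qis _ _ _ _ (mk_chmap (Y := cshift X) c))/bij_qis => i.
split=> [[x y]|x] /=.
  by move=> ->; rewrite (zcpx_triv y).
by exists (x, 0).
Qed.

Lemma tri_id0 X : tri X X zcpx.
Proof.
exists X, X, (cm_id X); split; try exact: diso_refl.
by apply: diso_zero; [apply: triv_dzero zcpx_triv|apply/acyc_dzero/qis_cone_acyc/qis_id].
Qed.

(** The complex [S] consists of the terms of degree above [l]. *)
Lemma brutal_tri X l : exists S Q,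
  [/\ tri S X Q, miso (Q l) (X l) /\ (forall i, i != l -> trivm (X i) -> trivm (Q i)),
      forall i, l < i -> trivm (Q i) & forall i, (i <= l) || `[< trivm (X i) >] -> trivm (S i)].
Proof.
pose S i (x : X i) := i <= l -> x = 0.
have hS : is_subcpx S.
  split=> [i|i j x h jl]; first by apply: imp_submod; apply: zero_submod.
  case: (eqVneq j (i + 1)) => [e|/cd_out //]; subst j.
  by rewrite h ?mh0 //; move: jl; lia.
exists (csub hS), (cquo hS); split.
- exact: cses_tri (csub_quo_ses hS).
- split.
    apply/miso_sym; exists (cquo_pr hS l); split; last exact: cquo_pr_surj.
    by move=> x /(cquo_prP hS); apply.
  by move=> i _ tX y; have [x <-] := cquo_pr_surj y; rewrite (tX x) mh0.
- move=> i li y; have [x <-] := cquo_pr_surj y; apply/(cquo_prP hS).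
  by move=> il; exfalso; move: li il; lia.
- move=> i h y; apply: (@csub_inc_inj _ _ _ _ hS i).
  case/orP: h => [il|/asboolP tX]; last exact: tX.
  exact: (csub_incS y).
Qed.

Section Additive.
Context (H : zmodType) (w : cpx A -> H) (hw : triangle_additive w).

Lemma add_tri X Y F : tri X Y F -> w Y = w X + w F.
Proof. by move=> /tri_is_cone[u /hw]. Qed.

Lemma add_zcpx : w zcpx = 0.
Proof. by have := add_tri (tri_id0 zcpx); rewrite -{1}[w zcpx]addr0 => /addrI. Qed.

Lemma add_iso X Y : diso X Y -> w X = w Y.
Proof.
move=> h; have t := tri_iso (diso_refl X) h (diso_refl zcpx) (tri_id0 X).
by rewrite (add_tri t) add_zcpx addr0.
Qed.

Lemma add_shift X : w (cshift X) = - w X.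
Proof. by have := add_tri (tri_rotate0 X); rewrite add_zcpx => /esym/addr0_oppl ->. Qed.

(** Dévissage: a bounded complex is an iterated extension of its terms, up to
    shift, and these are iterated extensions of simple modules. *)
Lemma add_devissage : (forall T, msimple T -> w (stalk T 0) = 0) -> forall E, w E = 0.
Proof.
move=> hT; have h0 M : w (stalk M 0) = 0.
  elim/(@module_devissage K A): M => [M tM|T M Q f g sT s wQ].
    rewrite -add_zcpx; apply/add_iso/stalk_iso/miso_triv => //; exact: zmodule_triv.
  by rewrite (add_tri (cses_tri (stalk_ses 0 s))) hT // wQ addr0.
have hj M j : w (stalk M j) = 0.
  have up l : w (stalk M (l + 1)) = 0 <-> w (stalk M l) = 0.
    rewrite -(add_iso (shift_stalk M l)) add_shift.
    by split=> [->|/eqP]; rewrite ?oppr0 // oppr_eq0 => /eqP.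
  case: (intP j) => [|n|n]; first exact: h0.
    by elim: n.+1 => [|m IH]; [exact: h0|rewrite -addn1 PoszD; apply/up].
  by elim: n.+1 => [|m IH]; [exact: h0|apply/up; rewrite -addn1 PoszD opprD subrK].
move=> E; have [n hn] := cpx_bounds E.
suff hd (d : nat) X l : (forall i, (i < l) || (l + d%:Z <= i) -> trivm (X i)) -> w X = 0.
  apply: (hd (n + n).+1 E (- n%:Z)) => i hi; apply: hn.
  by move: hi; rewrite -[(n + n).+1]addn1 !PoszD; lia.
elim: d X l => [|d IH] X l hX.
  rewrite -add_zcpx; apply/add_iso/diso_zero; apply: triv_dzero; last exact: zcpx_triv.
  by move=> i; apply: hX; lia.
have [S [Q [t [mQ hQ] hQ' hS]]] := brutal_tri X l.
rewrite (add_tri t) (IH S (l + 1)) ?add0r.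
  rewrite (add_iso (single_stalk (M := X l) _ mQ)) // => i il.
  case: (ltP l i) => [/hQ' //|li]; apply: hQ => //; apply: hX.
  by rewrite lt_neqAle il li.
move=> i hi; apply: hS; case: (leP i l) => //= li; apply/asboolP/hX.
by move: hi li; rewrite -addn1 PoszD; lia.
Qed.

End Additive.

(** Euler characteristics, with the terms of opposite degrees grouped. *)
Definition euler (V : zmodType) (n : nat) (t : int -> V) : V :=
  t 0 + \sum_(k < n) (t (k.+1)%:Z + t (- (k.+1)%:Z)) *~ (-1) ^+ k.+1.

Lemma euler_rec (V : zmodType) n (t : int -> V) : euler n.+1 t =
  euler n t + (t (n.+1)%:Z + t (- (n.+1)%:Z)) *~ (-1) ^+ n.+1.
Proof. by rewrite /euler big_ord_recr addrA. Qed.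

Lemma euler_widen (V : zmodType) n m (t : int -> V) : (n <= m)%N ->
  (forall i, (i < - n%:Z) || (n%:Z < i) -> t i = 0) -> euler m t = euler n t.
Proof.
move=> nm ht; rewrite -(subnK nm); elim: (m - n)%N => [//|k IH].
rewrite addSn euler_rec IH !ht ?addr0 ?mul0rz ?addr0 //; lia.
Qed.

Lemma eulerD (V : zmodType) n (s t : int -> V) :
  euler n (fun i => s i + t i) = euler n s + euler n t.
Proof.
rewrite /euler addrACA -big_split /=; congr (_ + _); apply: eq_bigr => k _.
by rewrite -mulrzDl addrACA.
Qed.

Lemma eq_euler (V : zmodType) n (s t : int -> V) : s =1 t -> euler n s = euler n t.
Proof. by move=> e; rewrite /euler e; congr (_ + _); apply: eq_bigr => k _; rewrite !e. Qed.

(** Telescoping: only the two terms beyond the range remain. *)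
Lemma euler_succ (V : zmodType) n (t : int -> V) :
  euler n (fun i => t (i + 1)) + euler n t =
  (t (n%:Z + 1) + t (- n%:Z)) *~ (-1) ^+ n.
Proof.
elim: n => [|n IH]; first by rewrite /euler !big_ord0 !addr0 expr0 mulr1z add0r oppr0.
rewrite !euler_rec addrACA IH exprS mulN1r !mulrNz -opprD -mulrzDl -mulrzBl.
rewrite -mulNrz; congr (_ *~ _).
have -> : - (n.+1)%:Z + 1 = - n%:Z by rewrite -addn1 PoszD opprD subrK.
have -> : (n%:Z + 1) = n.+1 by rewrite -addn1 PoszD.
zmod.
Qed.

Section Class.
Context (m : mult_system A).

Definition mvec M : 'rV[int]_(ms_rank m) := \row_j (ms_mult m j M)%:Z.

Lemma mvec_ses L M N (f : mhom L M) (g : mhom M N) : mses f g -> mvec M = mvec L + mvec N.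
Proof. by move=> s; apply/rowP => j; rewrite !mxE (ms_ses j s) PoszD. Qed.
Lemma mvec_iso M N : miso M N -> mvec M = mvec N.
Proof. by move=> h; apply/rowP => j; rewrite !mxE (ms_iso j h). Qed.
Lemma mvec_triv M : trivm M -> mvec M = 0.
Proof. by move=> h; apply/rowP => j; rewrite !mxE ms_triv. Qed.

Lemma mvec_sum M N : mvec (msum M N) = mvec M + mvec N.
Proof.
apply: (@mvec_ses _ _ _ (mpair (mid M) (mzero M N)) (msnd M N)); split.
- by move=> x [].
- by move=> y; exists (0, y).
- by move=> [x y] /=; split=> [->|[z [_ <-]]] //; exists x.
Qed.

Definition cbound E : nat := sval (cid (cpx_bounds E)).
Lemma cboundP E i : (i < - (cbound E)%:Z) || ((cbound E)%:Z < i) -> trivm (E i).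
Proof. exact: (svalP (cid (cpx_bounds E))). Qed.

Definition kclass E : 'rV[int]_(ms_rank m) := euler (cbound E) (fun i => mvec (E i)).

Lemma kclassE E n : (cbound E <= n)%N -> kclass E = euler n (fun i => mvec (E i)).
Proof.
by move=> h; rewrite /kclass (euler_widen h) // => i hi; apply/mvec_triv/cboundP.
Qed.

Definition bmod E i := subm (cob_submod E i).

Lemma mvec_bmod E i : mvec (E i) = mvec (zmod E i) + mvec (bmod E (i + 1)).
Proof.
pose inc := sub_inc (cob_submod E (i + 1)).
pose d := mlift inc (cd E i (i + 1)).
have dE x : inc (d x) = cd E i (i + 1) x.
  apply: mliftE => [|y]; first exact: sub_inc_inj.
  by apply/(sub_incP (cob_submod E (i + 1)))/cob_cd.
apply: (@mvec_ses _ _ _ (zinc E i) d); split; first exact: zincI.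
  move=> y; have /cobS[x xE] := sub_incS y; exists x.
  by apply: (injmP (@sub_inc_inj _ _ _ _ (cob_submod E (i + 1)))); rewrite -/inc dE.
move=> x; rewrite -(zincP x) /cocycle -dE; split=> [->|]; first by rewrite mh0.
exact: sub_inc_inj.
Qed.

Lemma mvec_hmod E i : mvec (zmod E i) = mvec (bmod E i) + mvec (hmod E i).
Proof.
pose inc := sub_inc (cob_submod E i); pose f := mlift (zinc E i) inc.
have fE x : zinc E i (f x) = inc x.
  apply: mliftE => [|y]; first exact: zincI.
  by apply/zincP/cob_coc; apply: (sub_incS (h := cob_submod E i)).
apply: (@mvec_ses _ _ _ f (hcls E i)); split; [|exact: hclsS|].
  move=> x e; apply: (@sub_inc_inj _ _ _ _ (cob_submod E i)).
  by rewrite -/inc -fE e mh0.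
move=> z; rewrite -hclsP; split=> [/(sub_incP (cob_submod E i))[y yE]|[y <-]].
  by exists y; apply: (injmP (@zincI _ _ E i)); rewrite fE.
by rewrite fE; apply: (sub_incS (h := cob_submod E i)).
Qed.

(** With cocycles [Z^i] and coboundaries [B^i], the class of [X^i] is
    [H^i + B^i + B^(i+1)], and the alternating sum of [B^i + B^(i+1)] vanishes. *)
Lemma kclass_hmod E n : (cbound E <= n)%N -> kclass E = euler n (fun i => mvec (hmod E i)).
Proof.
move=> h; rewrite (kclassE h).
have -> : euler n (fun i => mvec (E i)) = euler n (fun i => mvec (hmod E i) +
    (mvec (bmod E (i + 1)) + mvec (bmod E i))).
  by apply: eq_euler => i; rewrite mvec_bmod mvec_hmod; zmod.
rewrite eulerD (eulerD n (fun i => mvec (bmod E (i + 1)))).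
rewrite (euler_succ n (fun i => mvec (bmod E i))) !mvec_triv ?addr0 ?mul0rz ?addr0 //.
  move=> y; apply: (@sub_inc_inj _ _ _ _ (cob_submod E (- n%:Z))).
  have [x <-] := sub_incS y; rewrite (@cboundP E (- n%:Z - 1) _ x) ?mh0 //.
  by move: h; lia.
move=> y; apply: (@sub_inc_inj _ _ _ _ (cob_submod E (n%:Z + 1))).
by apply: (@cboundP E); move: h; lia.
Qed.

Lemma kclass_iso X Y : diso X Y -> kclass X = kclass Y.
Proof.
move=> h; rewrite (@kclass_hmod X (cbound X + cbound Y)) ?leq_addr //.
rewrite (@kclass_hmod Y (cbound X + cbound Y)) ?leq_addl //.
by apply: eq_euler => i; apply/mvec_iso/diso_hmod.
Qed.

Lemma kclass_additive : triangle_additive kclass.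
Proof.
move=> X Y F u /is_cone_tri[X' [Y' [f [hX hY hF]]]].
rewrite (kclass_iso hX) (kclass_iso hY) (kclass_iso hF).
pose n := (cbound X' + cbound Y' + cbound (ccone f)).+1.
rewrite (@kclassE X' n) ?(@kclassE Y' n) ?(@kclassE (ccone f) n); try by rewrite /n; lia.
have -> : euler n (fun i => mvec (ccone f i)) =
    euler n (fun i => mvec (X' (i + 1))) + euler n (fun i => mvec (Y' i)).
  by rewrite -eulerD; apply: eq_euler => i; rewrite -mvec_sum.
rewrite addrA [X in _ = X + _]addrC (euler_succ n (fun i => mvec (X' i))).
by rewrite !mvec_triv ?addr0 ?mul0rz ?add0r //; apply: cboundP; rewrite /n; lia.
Qed.

Lemma kclass_stalk M : kclass (stalk M 0) = mvec M.
Proof.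
rewrite (@kclassE _ (cbound (stalk M 0))) // /euler big1 ?addr0 => [|k _].
  exact: mvec_iso (stalk_obj_iso M 0).
by rewrite !mvec_triv ?addr0 ?mul0rz //; apply: stalk_triv; rewrite ?oppr_eq0.
Qed.

Definition basis_map (H : zmodType) (c : 'I_(ms_rank m) -> H) (x : 'rV[int]_(ms_rank m)) : H :=
  \sum_j c j *~ x 0 j.

Lemma basis_map_additive H c : zmod_morphism (@basis_map H c).
Proof.
by move=> x y; rewrite /basis_map -sumrB; apply: eq_bigr => j _; rewrite !mxE mulrzBr.
Qed.
HB.instance Definition _ H c :=
  GRing.isZmodMorphism.Build _ _ (@basis_map H c) (@basis_map_additive H c).

Lemma kclass_simple (j : 'I_(ms_rank m)) : kclass (stalk (ms_simple m j) 0) = delta_mx 0 j.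
Proof.
rewrite kclass_stalk; apply/rowP => i; rewrite !mxE ms_delta /=.
by case: (i == j).
Qed.

(** The classes of simple modules form the standard basis, and by dévissage an
    additive function is determined by its values on simple modules. *)
Lemma kclass_K0 : is_K0 kclass.
Proof.
split=> [|H w hw]; first exact: kclass_additive.
pose c (j : 'I_(ms_rank m)) := w (stalk (ms_simple m j) 0).
pose g : {additive _ -> H} := basis_map c.
have gd (j : 'I_(ms_rank m)) : g (delta_mx 0 j) = c j.
  rewrite /g /= /basis_map (bigD1 j) //= mxE !eqxx mulr1z big1 ?addr0 // => i ij.
  by rewrite mxE eqxx (negPf ij) mulr0z.
have gE E : g (kclass E) = w E.
  apply/eqP; rewrite -subr_eq0; apply/eqP.
  apply: (@add_devissage H (fun E => g (kclass E) - w E))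
    => [X Y F u t|T /(ms_complete m)[j jT]].
    by rewrite (kclass_additive t) (hw _ _ _ _ t) raddfD /=; zmod.
  rewrite -(kclass_iso (stalk_iso 0 jT)) kclass_simple gd.
  by rewrite -(add_iso hw (stalk_iso 0 jT)) subrr.
exists g => // g' hg' x.
rewrite (matrix_sum_delta x) !raddf_sum; apply: eq_bigr => i _.
rewrite !raddf_sum; apply: eq_bigr => j _; rewrite ord1.
have -> : x 0 j *: delta_mx 0 j = (delta_mx 0 j : 'rV[int]_(ms_rank m)) *~ x 0 j.
  by rewrite -scaler_int intz.
by rewrite !raddfMz -kclass_simple gE hg'.
Qed.

End Class.

End Grothendieck.

(** * The slicing by cohomological degree *)

Section DegreeSlicing.
Context {K : fieldType} {A : falgType K} (R : realType).
Implicit Types L M N : rmodule A.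
Implicit Types X Y Z W Q E F : cpx A.
Implicit Types i j k l : int.


Lemma acyc_csum X Y i : acyc X i -> acyc Y i -> acyc (csum X Y) i.
Proof.
move=> hX hY [x y] [/hX/cobP[j [x' xE]] /hY/cobP[k [y' yE]]].
have [l e] := int_succ i; subst i.
have /cobS[x1 x1E] : coboundary x by apply/cobP; exists j, x'.
have /cobS[y1 y1E] : coboundary y by apply/cobP; exists k, y'.
by apply/cobS; exists (x1, y1); apply: pair_ext.
Qed.

Lemma shift_acyc X i : acyc (cshift X) i <-> acyc X (i + 1).
Proof.
split=> h x cx.
  by apply/(@shift_cob _ _ X i x)/h/shift_coc.
by apply/shift_cob/h/shift_coc.
Qed.

Lemma diso_acycE X Y i : diso X Y -> acyc X i <-> acyc Y i.
Proof. by move=> h; split; apply: diso_acyc => //; apply: diso_sym. Qed.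

(** The inverse shift, on objects. *)
Definition cunshift X : cpx A.
Proof.
exists (fun i => X (i - 1)) (fun i j => mopp (cd X (i - 1) (j - 1))).
- move=> i j x ij /=; rewrite cd_out ?oppr0 //.
  by apply: contraNneq ij => e; apply/eqP; move: e; lia.
- by move=> i j k x /=; rewrite mhN cdd !oppr0.
- case: (c_bounded X) => n hn; exists n.+1 => i x hi; apply: hn; move: hi; lia.
Defined.

Lemma unshift_iso X : diso X (cshift (cunshift X)).
Proof.
have c i j (x : X i) : ctr X j (j + 1 - 1) (cd X i j x) =
    cd (cshift (cunshift X)) i j (ctr X i (i + 1 - 1) x).
  rewrite /= opprK; have : i + 1 - 1 = i by rewrite addrK.
  have : j + 1 - 1 = j by rewrite addrK.
  by move: (i + 1 - 1) (j + 1 - 1) => i' j' e e'; subst i' j'; rewrite !ctr_id.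
apply: (@diso_qis _ _ _ _
  (@ChMap K A X (cshift (cunshift X)) (fun i => ctr X i (i + 1 - 1)) c)).
apply: bij_qis => i /=; have : i + 1 - 1 = i by rewrite addrK.
move: (i + 1 - 1) => i' e; subst i'; split=> [x|y]; first by rewrite ctr_id.
by exists y; rewrite ctr_id.
Qed.

(** Truncate on both sides. *)
Lemma diso_stalk E a : (forall i, i != a -> acyc E i) -> exists M, diso E (stalk M a).
Proof.
move=> h; pose T := tge a E; pose X := tle a T.
have hT : diso E T by apply/diso_qis/tge_pr_qis => i ia; apply: h; rewrite lt_eqF.
have hX : diso X T.
  apply/(diso_qis (f := tle_inc a T))/tle_inc_qis => i ai; apply: tge_acyc; apply: h.
  by rewrite gt_eqF.
exists (X a); apply: diso_trans hT (diso_trans (diso_sym hX) _).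
apply: single_stalk; last exact: miso_refl.
move=> i ia; case: (ltgtP i a) ia => [ia _|ai _|//]; last exact: tle_triv.
by move=> x; apply: (@tle_incI _ _ a T i); apply: tge_triv.
Qed.

(** All modules are given the phase [0]: the objects of phase [phi] are the
    complexes with cohomology only in degree [- phi], which are the zero objects
    unless [phi] is an integer. *)
Definition deg_slice (phi : R) E := forall i, ~ acyc E i -> phi = - i%:~R.

Lemma nzero_deg phi E : deg_slice phi E -> ~ dzero_obj E ->
  exists a, [/\ phi = - a%:~R, ~ acyc E a & forall i, i != a -> acyc E i].
Proof.
move=> h nE; have [a na] : exists a, ~ acyc E a.
  apply: contrapT => h'; apply: nE; apply/dzeroP => i; apply: contrapT => ni.
  by apply: h'; exists i.
exists a; split=> [|//|i ia]; first exact: h.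
apply: contrapT => ni; case/eqP: ia.
by have := h i ni; rewrite (h a na) => /oppr_inj /eqP; rewrite eqr_int => /eqP.
Qed.

Lemma deg_slice_shift phi E : deg_slice (phi + 1) E <->
  exists2 F, deg_slice phi F & diso E (cshift F).
Proof.
split=> [h|[F hF e] i ni].
  exists (cunshift E); last exact: unshift_iso.
  move=> i; have [j ->] := int_succ i => nj.
  have /h e : ~ acyc E j.
    by move=> aE; apply: nj; apply/shift_acyc; apply/(diso_acycE j (unshift_iso E)).
  by apply/eqP; rewrite intrD opprD -e addrK.
have /hF -> : ~ acyc F (i + 1).
  by move=> aF; apply: ni; apply/(diso_acycE i e)/shift_acyc.
by rewrite intrD opprD subrK.
Qed.

(** These are the maps [M[a] -> N[b]] with [b < a], that is the Ext groups of
    negative degree. *)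
Lemma deg_slice_hom phi1 phi2 E1 E2 : deg_slice phi1 E1 -> deg_slice phi2 E2 ->
  phi2 < phi1 -> homz E1 E2.
Proof.
move=> h1 h2 lt; have [z1|n1] := pselect (dzero_obj E1); first exact: homz_zerol.
have [z2|n2] := pselect (dzero_obj E2); first exact: homz_zeror.
have [a [pa _ ha]] := nzero_deg h1 n1; have [b [pb _ hb]] := nzero_deg h2 n2.
have ab : a < b by move: lt; rewrite pa pb ltrN2 ltr_int.
apply: (@homz_trunc _ _ (a + 1)) => i hi; [apply: ha|apply: hb].
  by rewrite gt_eqF //; move: hi; lia.
by rewrite lt_eqF //; move: hi ab; lia.
Qed.

(** * Harder-Narasimhan filtrations *)

(** The inclusion when [k <= l]; made total in order to index a filtration by all
    natural numbers. *)
Definition tmap k l X : chmap (tle k X) (tle l X) :=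
  match pselect (exists g : chmap (tle k X) (tle l X),
    forall i x, tle_inc l X i (g i x) = tle_inc k X i x) with
  | left h => sval (cid h)
  | right _ => cm_zero _ _
  end.

Lemma tmapE k l X i x : k <= l -> tle_inc l X i (tmap k l X i x) = tle_inc k X i x.
Proof.
move=> kl; rewrite /tmap; case: pselect => [h|[]]; first exact: (svalP (cid h)).
exact: tle_map_ex.
Qed.

(** The cone has the cohomology of [X] in the degrees above [k] and up to [l], and
    none elsewhere. *)
Lemma cone_tmap_acyc k l X i : k < l -> (forall j, k < j -> j < l -> acyc X j) ->
  i != l -> acyc (ccone (tmap k l X)) i.
Proof.
move=> kl h; have [j ->] := int_succ i => jl [x y] /cone_coc[/= cx e].
have eI := congr1 (tle_inc l X (j + 1 + 1)) e.
rewrite mhD mh0 tmapE ?(ltW kl) // in eI.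
case: (leP (j + 1) k) => [jk|kj].
  have /tle_incP[y' y'E] : tleS k (tle_inc l X (j + 1) y).
    split=> [kj|ej]; first by exfalso; move: kj jk; lia.
    rewrite /cocycle -cm_comm; move: eI; rewrite [x]tle_triv ?mh0 ?add0r // ej ltrDl.
    by [].
  apply/cone_cob; exists y', 0; rewrite /= mh0 addr0; split.
    apply: (injmP (@tle_incI _ _ k X (j + 1 + 1))); rewrite mhN cm_comm y'E.
    by apply: addr0_oppr; rewrite -cm_comm.
  by apply: (injmP (@tle_incI _ _ l X (j + 1))); rewrite tmapE ?(ltW kl).
have x0 : x = 0 by apply: tle_triv; move: kj; lia.
have aT : acyc (tle l X) (j + 1).
  case: (ltgtP (j + 1) l) jl => [jl|lj|//] _; last by apply: triv_acyc; apply: tle_triv.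
  by apply: tle_acyc; apply: h.
have /aT/cobS[y1 y1E] : cocycle y by move: e; rewrite x0 mh0 add0r.
by apply/cone_cob; exists 0, y1; rewrite /= x0 !mh0 oppr0 add0r.
Qed.

Lemma cone_tmap_nacyc k l X : k < l -> ~ acyc X l -> ~ acyc (ccone (tmap k l X)) l.
Proof.
move=> kl nX h; apply: nX => x cx.
have [y cy <-] := tle_cocS (lexx l) cx; apply: cm_cob.
have /h/cobP[j [[x1 y1] /(congr1 snd) /= e]] : cocycle ((0, y) : ccone (tmap k l X) l).
  by apply/cone_coc; rewrite /= mh0 add0r; split=> //; apply: mh0.
apply/cobP; exists j, y1; rewrite -e.
case: (eqVneq (j + 1) l) => [ej|ne]; last by rewrite ctr_neq // add0r.
by rewrite (@tle_triv _ _ k X (j + 1) _ x1) ?mh0 ?add0r // ej.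
Qed.

Lemma is_cone_cone X Y (f : chmap X Y) : is_cone (dq f) (ccone f).
Proof.
exists X, Y, f, (did X), (did Y); split; try exact: (disinv_qis (qis_id _)).
  by rewrite deq_idl deq_idr.
exact: diso_refl.
Qed.

(** The filtration by the truncations [tle i], where [i] runs over the degrees with
    nonzero cohomology in increasing order; [s] lists them after an initial degree
    below the support of [E], at which the truncation is zero. *)
Lemma deg_slice_HN E : ~ dzero_obj E -> HN_filtration deg_slice E.
Proof.
move=> nE; have [n hn] := cpx_bounds E.
pose degs := [seq (q : nat)%:Z - n%:Z | q <- iota 0 (n + n).+1].
pose c := [seq i <- degs | ~~ `[< acyc E i >]].
pose s := (- n%:Z - 1) :: c.
have degsP i : (i \in degs) = (- n%:Z <= i <= n%:Z).
  apply/mapP/idP => [[k]|h]; first by rewrite mem_iota => hk ->; lia.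
  by exists (absz (i + n%:Z)%R); [rewrite mem_iota|]; lia.
have cP i : ~ acyc E i -> i \in c.
  move=> ni; rewrite mem_filter degsP; apply/andP; split; first by apply/asboolP.
  apply: contrapT => /negP h; apply: ni; apply/triv_acyc/hn; move: h; lia.
have ss : sorted <%R s.
  rewrite /s /= path_sortedE; last exact: lt_trans.
  apply/andP; split.
    by apply/allP => i; rewrite mem_filter degsP => /andP[_]; lia.
  apply: sorted_filter; first exact: lt_trans.
  rewrite /degs sorted_map; apply: sub_sorted (iota_ltn_sorted 0 _) => x y /=.
  by rewrite /relpre /=; lia.
have sm (i j : nat) : (i < size s)%N -> (j < size s)%N -> (s`_i < s`_j) = (i < j)%N.
  by move=> hi hj; apply: (lt_sorted_ltn_nth 0 ss).
have sc (i : nat) : (i < size c)%N -> ~ acyc E s`_i.+1.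
  move=> ic; have := mem_nth 0 ic; rewrite mem_filter => /andP[/asboolPn + _]; exact.
exists (size c), (fun i : nat => tle s`_i E), (fun i : nat => dq (tmap s`_i s`_i.+1 E)),
  (fun i : nat => ccone (tmap s`_i s`_i.+1 E)), (fun i : nat => - (s`_i.+1)%:~R); split.
- apply/dzeroP => i; case: (leP i (- n%:Z - 1)) => hi; last by apply/triv_acyc/tle_triv.
  by apply/tle_acyc/triv_acyc/hn; move: hi; lia.
- apply: (diso_qis (f := tle_inc _ E)); apply: tle_inc_qis => i si.
  apply: contrapT => /cP ci.
  have := nth_index 0 ci; have : (index i c < size c)%N by rewrite index_mem.
  move=> ic e; move: si; rewrite -[X in _ < X]e -[c`__]/(s`_(index i c).+1) sm //; lia.
- move=> i ic.
  have kl : s`_i < s`_i.+1 by rewrite sm //= ltnS ?(ltnW ic) ?ic.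
  have gap j : s`_i < j -> j < s`_i.+1 -> acyc E j.
    move=> ij ji; apply: contrapT => /cP cj.
    have jc : (index j c < size c)%N by rewrite index_mem.
    move: ij ji; rewrite -[j](nth_index 0 cj) -[c`__]/(s`_(index j c).+1).
    rewrite !sm //=; lia.
  split; first exact: is_cone_cone.
    by move=> /dzeroP /(_ s`_i.+1); apply: cone_tmap_nacyc => //; apply: sc.
  move=> j nj; congr (- _%:~R); apply/esym/eqP; apply: contrapT => /negP je.
  by apply: nj; apply: cone_tmap_acyc.
- by move=> i ic; rewrite ltrN2 ltr_int sm //= ltnS // ltnW.
Qed.

Definition degree_slicing : slicing A R.
Proof.
exists deg_slice.
- by move=> phi E F h hE i ni; apply: hE => aE; apply: ni; apply: diso_acyc h aE.
- by move=> phi E /dzeroP h i ni; case: ni; apply: h.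
- move=> phi E F hE hF i ni; have [aE|nE] := pselect (acyc E i); last exact: hE.
  by apply: hF => aF; apply: ni; apply: acyc_csum.
- exact: deg_slice_shift.
- exact: deg_slice_hom.
- exact: deg_slice_HN.
Defined.

End DegreeSlicing.

(** * The stability condition of a finite-dimensional algebra *)

Lemma euler_single (V : zmodType) n (t : int -> V) (a : int) : (absz a <= n)%N ->
  (forall i, i != a -> t i = 0) -> euler n t = t a *~ (-1) ^+ absz a.
Proof.
move=> an ht; rewrite /euler; have [a0|a0] := eqVneq a 0.
  subst a; rewrite big1 ?addr0 ?mulr1z // => k _.
  by rewrite !ht ?addr0 ?mul0rz // oppr_eq0.
have lt : ((absz a).-1 < n)%N by move: an a0; lia.
rewrite ht 1?eq_sym // add0r (bigD1 (Ordinal lt)) //= big1 ?addr0; last first.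
  move=> k nk; rewrite !ht ?addr0 ?mul0rz //; apply: contraNneq nk => e;
    apply/eqP/val_inj => /=.
    by move: e; lia.
  by move: e; lia.
have -> : (absz a).-1.+1 = absz a by move: a0; lia.
congr (_ *~ _); case: (ltP a 0) => ha.
  have -> : - (absz a)%:Z = a by lia.
  by rewrite ht ?add0r //; move: ha; lia.
have -> : (absz a)%:Z = a by lia.
by rewrite [t (- a)]ht ?addr0 //; move: ha a0; lia.
Qed.

Section Trigonometry.
Context (R : realType).

Lemma cos_sin_pi_nat (n : nat) :
  cos (pi * n%:R) = (-1) ^+ n :> R /\ sin (pi * n%:R) = 0 :> R.
Proof.
elim: n => [|n [IHc IHs]]; first by rewrite mulr0 cos0 sin0 expr0.
by rewrite -natr1 mulrDr mulr1 cosDpi sinDpi IHc IHs exprS mulN1r oppr0.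
Qed.

Lemma cos_sin_pi_int (a : int) :
  cos (pi * - a%:~R) = (-1) ^+ absz a :> R /\ sin (pi * - a%:~R) = 0 :> R.
Proof.
have [c s] := cos_sin_pi_nat (absz a).
rewrite mulrN cosN sinN; case: (ltP a 0) => ha.
  have -> : a%:~R = - (absz a)%:R :> R.
    by rewrite -[_%:R]/((absz a)%:Z%:~R) -mulrNz; congr (_%:~R); lia.
  by rewrite mulrN cosN sinN opprK.
have -> : a%:~R = (absz a)%:R :> R by rewrite -[_%:R]/((absz a)%:Z%:~R); congr (_%:~R); lia.
by rewrite c s oppr0.
Qed.

End Trigonometry.

Section StabilityCondition.
Context {R : realType} {A : falgType R[i]} (m : mult_system A).
Implicit Types M N : rmodule A.
Implicit Types X Y E F : cpx A.

Let r := ms_rank m.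

(** The central charge: the Euler characteristic of dimensions. *)
Definition dim_charge : {additive 'rV[int]_r -> R[i]} :=
  basis_map (fun j => (mdim (ms_simple m j))%:R).

Lemma dim_charge_mvec M : dim_charge (mvec m M) = (mdim M)%:R.
Proof.
rewrite (ms_dim m M) natr_sum; apply: eq_bigr => j _.
by rewrite mxE natrM mulrC -mulrzr.
Qed.

Lemma kclass_single E a : (forall i, i != a -> acyc E i) ->
  kclass m E = mvec m (hmod E a) *~ (-1) ^+ absz a.
Proof.
move=> h; rewrite (@kclass_hmod _ _ m E (cbound E + absz a)) ?leq_addr //.
rewrite (euler_single (a := a)) ?leq_addl // => i ia.
by apply/mvec_triv/hmod_triv/h.
Qed.

Lemma mulrz_sign (V : pzRingType) (x : V) p : x *~ (-1) ^+ p = x * (-1) ^+ p.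
Proof. by rewrite -mulrzr rmorphXn rmorphN1. Qed.

Lemma dim_charge_single E a : (forall i, i != a -> acyc E i) ->
  dim_charge (kclass m E) = (mdim (hmod E a))%:R * (-1) ^+ absz a.
Proof. by move=> h; rewrite (kclass_single h) raddfMz dim_charge_mvec mulrz_sign. Qed.

Lemma mdim_gt0 M : ~ trivm M -> (0 < mdim M)%N.
Proof. by move=> h; rewrite lt0n; apply/eqP => /mdim_eq0. Qed.

Lemma mult_le_dim j M : (ms_mult m j M <= mdim M)%N.
Proof.
rewrite (ms_dim m M) (bigD1 j) //=; apply: leq_trans (leq_addr _ _).
by rewrite leq_pmulr // mdim_gt0 //; case: (ms_simpleP j).
Qed.

Lemma stability_phase (phi : R) E : degree_slicing (A := A) R phi E -> ~ dzero_obj E ->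
  exists2 d : R, 0 < d & dim_charge (kclass m E) =
    d%:C%C * (cos (pi * phi) +i* sin (pi * phi))%C.
Proof.
move=> h nE; have [a [-> na ha]] := nzero_deg h nE.
exists (mdim (hmod E a))%:R.
  by rewrite ltr0n mdim_gt0 // => /hmod_triv.
have [-> ->] := cos_sin_pi_int R a.
by rewrite (dim_charge_single ha) complexr0 !rmorph_nat rmorphXn rmorphN1.
Qed.

(** For a complex with one cohomology module [M] the inequality says that the
    multiplicities of [M] are at most its dimension. *)
Lemma stability_support : exists2 C : R, 0 < C &
  forall phi E, degree_slicing (A := A) R phi E -> ~ dzero_obj E ->
    (`|map_mx (intr : int -> R) (kclass m E)|)%:C%C <= C%:C%C * `|dim_charge (kclass m E)|.
Proof.
exists 1 => // phi E h nE; have [a [_ na ha]] := nzero_deg h nE.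
rewrite (dim_charge_single ha) normrM normrX normrN1 expr1n mulr1 normr_nat mul1r.
rewrite -(rmorph_nat (real_complex R)) lecR (kclass_single ha).
rewrite /Num.norm /= mx_normrE; apply/bigmax_leP; split=> // -[i j] _ /=.
rewrite mxE -[_ *~ (_ ^+ _)]scaler_int mxE mxE intz rmorphM rmorphXn rmorphN1 /=.
by rewrite normrM normrX normrN1 expr1n mul1r normr_nat ler_nat mult_le_dim.
Qed.

Definition degree_stability : Stab A :=
  MkStab (kclass_K0 m) (StabilityCondition stability_phase stability_support).

End StabilityCondition.

(** * The global dimension of stability conditions *)

Section GlobalDimension.
Context {R : realType} {A : falgType R[i]}.
Implicit Types M N : rmodule A.
Implicit Types X Y E F : cpx A.

(** The nonvanishing of Ext for one resolution and for every resolution agree. *)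
Lemma ext_neq0_homz M N (a : int) (n : nat) :
  ext_neq0 n M N <-> ~ homz (stalk M a) (stalk N (a - n%:Z)).
Proof.
split=> [[P [f [cf nf]]] /(ext_hom N P a n) h|h]; first exact/nf/h.
have [P] := proj_resolution_ex M; exists P.
apply: contrapT => h'; apply/h/(ext_hom N P a n) => f cf.
by apply: contrapT => nf; apply: h'; exists f.
Qed.

Lemma gl_dim_ub n M N : ext_neq0 n M N -> ((n%:R : R)%:E <= gl_dim A R)%E.
Proof. by move=> h; apply: ereal_sup_ubound; exists n, M, N. Qed.

(** A supremum of natural numbers that is a natural number is attained. *)
Lemma gl_dim_attained (n : nat) : gl_dim A R = (n%:R : R)%:E ->
  exists M N, ext_neq0 n M N.
Proof.
move=> gn; apply: contrapT => h.
have bd k M N : ext_neq0 k M N -> (k < n)%N.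
  move=> e; have := gl_dim_ub e; rewrite gn lee_fin ler_nat leq_eqVlt => /orP[/eqP kn|//].
  by case: h; exists M, N; rewrite -kn.
have : (gl_dim A R <= ((n%:R - 1 : R))%:E)%E.
  apply: ge_ereal_sup => _ [k [M [N [/bd kn ->]]]].
  by rewrite lee_fin lerBrDr natr1 ler_nat.
by rewrite gn lee_fin lerBrDr gerDl ler10.
Qed.

(** Nonzero maps between semistable objects are nonzero elements of
    [Ext^(a - b)(M, N)], for modules [M] in degree [a] and [N] in degree [b]. *)
Lemma gldim_degree (m : mult_system A) (n : nat) : gl_dim A R = (n%:R : R)%:E ->
  gldim (degree_stability m) = (n%:R : R)%:E.
Proof.
move=> gn; apply/le_anti/andP; split.
  apply: ge_ereal_sup => _ [phi1 [phi2 [E1 [E2 [h1 h2 /dhom_neq0P nh ->]]]]].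
  have n1 : ~ dzero_obj E1 by move=> z; apply/nh/homz_zerol.
  have n2 : ~ dzero_obj E2 by move=> z; apply/nh/homz_zeror.
  have [a [-> _ ha]] := nzero_deg h1 n1; have [b [-> _ hb]] := nzero_deg h2 n2.
  have [M hM] := diso_stalk ha; have [N hN] := diso_stalk hb.
  rewrite opprK addrC -rmorphB /=; case: (leP b a) => ab; last first.
    rewrite lee_fin (@le_trans _ _ 0) // -[0]/((0 : int)%:~R) ler_int.
    by move: ab; lia.
  have bE : b = a - (absz (a - b))%:Z by move: ab; lia.
  have : ext_neq0 (absz (a - b)) M N.
    apply/(ext_neq0_homz M N a); rewrite -bE => h; apply: nh.
    exact: homz_iso (diso_sym hM) (diso_sym hN) h.
  move=> /gl_dim_ub; rewrite gn; congr (_ <= _)%E; congr (_%:E).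
  by rewrite -[LHS]/((absz (a - b))%:Z%:~R); congr (_%:~R); move: ab; lia.
have [M [N]] := gl_dim_attained gn; move=> /(ext_neq0_homz M N 0) nh.
apply: ereal_sup_ubound; exists 0, n%:R, (stalk M 0), (stalk N (0 - n%:Z)); split.
- move=> i ni; have [->|i0] := eqVneq i 0; first by rewrite oppr0.
  by case: ni; apply: stalk_acyc.
- move=> i ni; have [->|i0] := eqVneq i (0 - n%:Z); first by rewrite sub0r mulrNz opprK.
  by case: ni; apply: stalk_acyc.
- exact/dhom_neq0P.
- by rewrite subr0.
Qed.

(** * Algebras of infinite global dimension *)

Definition cshiftn (n : nat) X := iter n (@cshift _ A) X.

Lemma tri_cshiftn n X Y F : tri X Y F -> tri (cshiftn n X) (cshiftn n Y) (cshiftn n F).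
Proof. by move=> h; elim: n => //= n; apply: tri_shift. Qed.

Lemma diso_cshiftn n X Y : diso X Y -> diso (cshiftn n X) (cshiftn n Y).
Proof. by move=> h; elim: n => //= n; apply: (dfun_iso (cshiftF (A := A))). Qed.

Lemma cshiftn_zero n X : dzero_obj X -> dzero_obj (cshiftn n X).
Proof.
move=> h; elim: n => //= n /dzeroP IH; apply/dzeroP => i; apply/shift_acyc; exact: IH.
Qed.

Lemma slicing_cshiftn (P : slicing A R) n phi X :
  P phi X -> P (phi + n%:R) (cshiftn n X).
Proof.
move=> h; elim: n => [|n IH] /=; first by rewrite addr0.
rewrite -natr1 addrA; apply/sl_shift; exists (cshiftn n X) => //; exact: diso_refl.
Qed.

Lemma stalk_cshiftn n M (a : int) : diso (cshiftn n (stalk M a)) (stalk M (a - n%:Z)).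
Proof.
elim: n => [|n IH] /=; first by rewrite subr0; apply: diso_refl.
apply: diso_trans (dfun_iso (cshiftF (A := A)) IH) _.
have -> : a - n%:Z = a - n.+1%:Z + 1 by lia.
exact: shift_stalk.
Qed.

(** Each step of the filtration is a triangle, and vanishing of maps is preserved by
    extensions in both variables and by the shift of triangles. *)
Lemma HN_factors (P : R -> cpx A -> Prop) E : HN_filtration P E ->
  exists (n : nat) (F : 'I_n -> cpx A) (phi : 'I_n -> R),
    [/\ forall i, P (phi i) (F i),
        forall W, (forall i, homz (F i) W) -> homz E W
      & forall W p, (forall i, homz W (cshiftn p (F i))) -> homz W (cshiftn p E)].
Proof.
move=> [n [X [u [F [phi [X0 Xn hu _]]]]]].
exists n, (fun i => F i), (fun i => phi i); split=> [i|W hF|W p hF].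
- by have [] := hu i (ltn_ord i).
- apply: (homz_iso Xn (diso_refl W)).
  have : (n <= n)%N by []; elim: {1 3}n => [_|i IH lt]; first exact: homz_zerol.
  have [c _ _] := hu i lt.
  exact: homz_tri_l (is_cone_tri c) (IH (ltnW lt)) (hF (Ordinal lt)).
- apply: (homz_iso (diso_refl W) (diso_cshiftn p Xn)).
  have : (n <= n)%N by []; elim: {1 3}n => [_|i IH lt].
    by apply: homz_zeror; apply: cshiftn_zero.
  have [c _ _] := hu i lt.
  exact: homz_tri_r (tri_cshiftn p (is_cone_tri c)) (IH (ltnW lt)) (hF (Ordinal lt)).
Qed.

(** The zero object is the case of no factors. *)
Lemma slicing_factors (P : slicing A R) E :
  exists (n : nat) (F : 'I_n -> cpx A) (phi : 'I_n -> R),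
    [/\ forall i, P (phi i) (F i),
        forall W, (forall i, homz (F i) W) -> homz E W
      & forall W p, (forall i, homz W (cshiftn p (F i))) -> homz W (cshiftn p E)].
Proof.
have [zE|/(sl_HN P)/HN_factors //] := pselect (dzero_obj E).
have F0 : 'I_0 -> cpx A by case.
have phi0 : 'I_0 -> R by case.
exists 0%N, F0, phi0; split=> [[]//|W _|W p _]; first exact: homz_zerol.
by apply: homz_zeror; apply: cshiftn_zero.
Qed.

Section Bounded.
Context (P : slicing A R) (G : R).
Hypothesis hG : forall phi1 phi2 E1 E2, P phi1 E1 -> P phi2 E2 ->
  G < phi2 - phi1 -> homz E1 E2.

(** The factors of [E2] shifted by [p] have phases larger than those of [E1] by more
    than [G] for large [p]. *)
Lemma homz_shift_large E1 E2 : exists B : nat, forall p, (B <= p)%N ->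
  homz E1 (cshiftn p E2).
Proof.
have [n [F [phi [hF hl _]]]] := slicing_factors P E1.
have [n' [F' [phi' [hF' _ hr]]]] := slicing_factors P E2.
pose b i j := Num.bound `|G + phi i - phi' j|.
exists (\max_i \max_j b i j) => p Bp; apply: hr => j; apply: hl => i.
apply: (hG (hF i) (slicing_cshiftn p (hF' j))).
have bp : (b i j <= p)%N.
  by apply: leq_trans Bp; apply: leq_trans (leq_bigmax i); apply: (leq_bigmax j).
have lt : G + phi i - phi' j < p%:R.
  apply: le_lt_trans (ler_norm _) _; apply: lt_le_trans (archi_boundP (normr_ge0 _)) _.
  by rewrite ler_nat.
by rewrite ltrBrDr -ltrBlDl.
Qed.

(** Modules are iterated extensions of finitely many simple modules, so the
    bound can be taken uniform. *)
Lemma homz_stalks_large : exists B : nat, forall p M N, (B <= p)%N ->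
  homz (stalk M 0) (cshiftn p (stalk N 0)).
Proof.
have [n [S [_ _ cS]]] := @finite_simples _ A.
have /choice[B hB] (ij : 'I_n * 'I_n) := homz_shift_large (stalk (S ij.1) 0) (stalk (S ij.2) 0).
exists (\max_ij B ij) => p M N Bp.
have ss T T' : msimple T -> msimple T' -> homz (stalk T 0) (cshiftn p (stalk T' 0)).
  move=> /cS[i ni iT] /cS[j nj jT'].
  apply: (homz_iso (stalk_iso 0 iT) (diso_cshiftn p (stalk_iso 0 jT'))).
  apply: (hB (Ordinal ni, Ordinal nj)); apply: leq_trans Bp.
  exact: (leq_bigmax (Ordinal ni, Ordinal nj)).
have z M' : trivm M' -> dzero_obj (stalk M' 0).
  by move=> tM; apply: triv_dzero => i x; rewrite -[x]st_outK (tM (st_out _ _ _ x)) mh0.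
have sM T : msimple T -> homz (stalk T 0) (cshiftn p (stalk N 0)).
  move=> sT; elim/(@module_devissage _ A): N => [N tN|T' N Q f g sT' s hQ].
    by apply: homz_zeror; apply: cshiftn_zero; apply: z.
  exact: homz_tri_r (tri_cshiftn p (cses_tri (stalk_ses 0 s))) (ss _ _ sT sT') hQ.
elim/(@module_devissage _ A): M => [M tM|T M Q f g sT s hQ].
  by apply: homz_zerol; apply: z.
exact: homz_tri_l (cses_tri (stalk_ses 0 s)) (sM T sT) hQ.
Qed.

Lemma gl_dim_finite : (gl_dim A R < +oo)%E.
Proof.
have [B hB] := homz_stalks_large.
apply: (@le_lt_trans _ _ (B%:R : R)%:E); last exact: ltry.
apply: ge_ereal_sup => _ [p [M [N [/(ext_neq0_homz M N 0) nh ->]]]].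
rewrite lee_fin ler_nat leqNgt; apply/negP => Bp; apply: nh.
exact: homz_iso (diso_refl _) (stalk_cshiftn p N 0) (hB p M N (ltnW Bp)).
Qed.

End Bounded.

Lemma gldim_infinite (sigma : Stab A) : gl_dim A R = +oo%E -> gldim sigma = +oo%E.
Proof.
move=> gi; have [//|ne] := eqVneq (gldim sigma) +oo%E.
have [G hG] : exists G : R, (gldim sigma <= G%:E)%E.
  by case: (gldim sigma) ne => [g _|//|_]; [exists g|exists 0; rewrite leNye].
suff /gl_dim_finite : forall phi1 phi2 E1 E2, sigma phi1 E1 -> sigma phi2 E2 ->
    G < phi2 - phi1 -> homz E1 E2 by rewrite gi.
move=> phi1 phi2 E1 E2 h1 h2 lt; apply: contrapT => /dhom_neq0P nh.
have : ((phi2 - phi1)%:E <= gldim sigma)%E.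
  by apply: ereal_sup_ubound; exists phi1, phi2, E1, E2.
by move=> /le_trans/(_ hG); rewrite lee_fin leNgt lt.
Qed.

End GlobalDimension.

Theorem proposition5p1 (R : realType) (A : falgType R[i]) :
  (forall n : nat, gl_dim A R = (n%:R : R)%:E ->
     exists sigma : Stab A, gldim sigma = (n%:R : R)%:E) /\
  (gl_dim A R = +oo%E -> forall sigma : Stab A, gldim sigma = +oo%E).
Proof.
split=> [n gn|gi sigma]; last exact: gldim_infinite.
have [m] := @mult_system_ex _ A.
by exists (degree_stability m); apply: gldim_degree.
Qed.
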